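(* Suppose that the linear model $Y=\beta_0+\sum_{j=1}^d\beta_jX_j+\epsilon$ holds, $\mathbb{E}(Y^2)<+\infty$, $\mathbb{E}(\|\mathbf X\|^2)<+\infty$ and $\operatorname{rank}(\boldsymbol\mu_{1,X})=d+1$. Then, as $n$ tends to infinity, $$\sqrt n\left(\widehat{\boldsymbol\beta}^M-\boldsymbol\beta\right)\ \text{ converges in distribution to }\ \mathcal N(0,\boldsymbol\Gamma_{\beta_M}),\qquad \boldsymbol\Gamma_{\beta_M}=\mathbf J_\theta\boldsymbol\Gamma_\mu\mathbf J_\theta^\top ,$$ where $\boldsymbol\Gamma_\mu$ is the block diagonal matrix with diagonal blocks $\boldsymbol\Gamma_X^1,\dots,\boldsymbol\Gamma_X^K,\sigma_{Y,1}^2,\dots,\sigma_{Y,K}^2$, and $\mathbf J_\theta$ is the Jacobian matrix at $\boldsymbol\theta=(\boldsymbol\mu_X^1,\dots,\boldsymbol\mu_X^K,\mu_Y^1,\dots,\mu_Y^K)$ of the map $g$ with values in $\mathbb{R}^{d+1}$, defined on a neighbourhood of $\boldsymbol\theta$ in $\mathbb{R}^{dK+K}$ by $$g(m^1,\dots,m^K,y^1,\dots,y^K)=\left(\mathbf m^\top\mathbf w\,\mathbf m\right)^{-1}\mathbf m^\top\mathbf w\,\mathbf y,$$ with $\mathbf m$ the $K\times(d+1)$ matrix whose $k$th row is $(1,(m^k)^\top)$, $m^k\in\mathbb{R}^d$, and $\mathbf y=(y^1,\dots,y^K)^\top$.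
   Context: Setting. $Y$ is a real random variable, $\mathbf X=(X_1,\dots,X_d)$ a random vector in $\mathbb{R}^d$, $G$ a categorical variable with values in $\{1,\dots,K\}$ and $\mathbb{P}[G=k]>0$ for all $k$, with $Y=\beta_0+\sum_{j=1}^d\beta_jX_j+\epsilon$, where $\epsilon$ is independent of $(\mathbf X,G)$, has mean zero and variance $\sigma_\epsilon^2$, and $\boldsymbol\beta=(\beta_0,\dots,\beta_d)^\top$. Put $\mu_Y^k=\mathbb{E}(Y\mid G=k)$, $\boldsymbol\mu_X^k=\mathbb{E}(\mathbf X\mid G=k)\in\mathbb{R}^d$, $\sigma_{Y,k}^2=\mathrm{Var}(Y\mid G=k)$, $\boldsymbol\Gamma_X^k=\mathrm{Var}(\mathbf X\mid G=k)$ (covariance matrix), and let $\boldsymbol\mu_{1,X}$ be the $K\times(d+1)$ matrix with $k$th row $(1,\boldsymbol\mu_X^{k\top})$. Data. $\mathbf X$ and $Y$ are never observed jointly. $K$ is fixed. For each $k$ there are an i.i.d. sample $Y_1^k,\dots,Y_n^k$ from the conditional law of $Y$ given $G=k$ and an i.i.d. sample $\mathbf X_1^k,\dots,\mathbf X_n^k$ from the conditional law of $\mathbf X$ given $G=k$; these $2K$ samples are mutually independent and all have the same size $n$. Estimator. $\widehat\mu_Y^k=\frac1n\sum_iY_i^k$, $\widehat{\boldsymbol\mu}_X^k=\frac1n\sum_i\mathbf X_i^k$, $\widehat{\boldsymbol\mu}_Y=(\widehat\mu_Y^1,\dots,\widehat\mu_Y^K)^\top$, $\widehat{\boldsymbol\mu}_{1,X}$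 is the $K\times(d+1)$ matrix with $k$th row $(1,\widehat{\boldsymbol\mu}_X^{k\top})$, and $\mathbf w=\mathrm{diag}(w_1,\dots,w_K)$ with fixed weights $w_k>0$, $\sum_kw_k=1$. The moment estimator is $$\widehat{\boldsymbol\beta}^M=\left(\widehat{\boldsymbol\mu}_{1,X}^\top\mathbf w\widehat{\boldsymbol\mu}_{1,X}\right)^{-1}\widehat{\boldsymbol\mu}_{1,X}^\top\mathbf w\widehat{\boldsymbol\mu}_Y$$ when $\widehat{\boldsymbol\mu}_{1,X}$ has full rank $d+1$ (defined arbitrarily otherwise). The Gaussian limit is allowed to be degenerate. *)

(* Defs.v *)
From HB Require Import structures.
From mathcomp Require Import all_boot all_order all_algebra finmap.
From mathcomp Require Import all_classical all_reals all_analysis.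

Set Implicit Arguments.
Unset Strict Implicit.
Unset Printing Implicit Defensive.

Import Order.TTheory GRing.Theory Num.Theory.
Import numFieldNormedType.Exports.

Local Open Scope classical_set_scope.
Local Open Scope ring_scope.

(** Matrices, hence vectors, over a [realType] carry the Borel sigma-algebra. *)
Section borel_matrix.
Context (R : realType) (m n : nat).

Definition borel_mx : set (set 'M[R]_(m, n)) := <<s @open 'M[R]_(m, n) >>.

Let borel_mx0 : borel_mx set0.
Proof. exact: sigma_algebra0. Qed.

Let borel_mxC A : borel_mx A -> borel_mx (~` A).
Proof. exact: sigma_algebraC. Qed.

Let borel_mx_bigcup (F : (set 'M[R]_(m, n))^nat) :
  (forall i, borel_mx (F i)) -> borel_mx (\bigcup_i F i).
Proof. exact: sigma_algebra_bigcup. Qed.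

HB.instance Definition _ :=
  @isMeasurable.Build (sigma_display (@open 'M[R]_(m, n))) 'M[R]_(m, n)
    borel_mx borel_mx0 borel_mxC borel_mx_bigcup.

End borel_matrix.

Section independence.
Context d (T : measurableType d) (R : realType) (P : probability T R).
Local Open Scope ereal_scope.

Definition independent_RVs d1 d2 (T1 : measurableType d1)
    (T2 : measurableType d2) (X : T -> T1) (Y : T -> T2) : Prop :=
  forall A B, measurable A -> measurable B ->
    P (X @^-1` A `&` Y @^-1` B) = P (X @^-1` A) * P (Y @^-1` B).

(** For a family of random variables [X i] with values in possibly different
    spaces, take for [F i] the sigma-algebra generated by [X i], which is
    [g_sigma_algebra_preimage (X i)]. *)
Definition mutually_independent (I : choiceType) (F : I -> set (set T)) :
    Prop :=
  forall (J : {fset I}) (A : I -> set T),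
    (forall i, i \in J -> F i (A i)) ->
    P (\bigcap_(i in [set` J]) A i) = \prod_(i <- J) P (A i).

End independence.

Section conditional_law.
Context d (T : measurableType d) (R : realType) (P : probability T R).
Variables (G : {RV P >-> nat}) (k : nat).

Lemma measurable_label : measurable (G @^-1` [set k]).
Proof. exact: measurable_funPTI. Qed.

(** [P( . | G = k)], which is [P( . , G = k) / P(G = k)] when [0 < P(G = k)]. *)
Definition cond_prob : probability T R := mnormalize (mrestr P measurable_label) P.

End conditional_law.

Section multivariate_normal.
Context (R : realType) (p : nat).

(** [normal_prob m s] is parameterized by the standard deviation [s], and is
    not a Dirac mass when [s = 0]. *)
Definition normal1 (m v : R) (B : set R) : \bar R :=
  if 0 < v then normal_prob m (Num.sqrt v) B else \d_m B.

(** Possibly degenerate: every linear combination of the coordinates is normal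
    with the prescribed mean and variance. *)
Definition is_normal (mu : probability 'cV[R]_p R) (m : 'cV[R]_p)
    (S : 'M[R]_p) : Prop :=
  forall (a : 'cV[R]_p) (B : set R), measurable B ->
    mu [set x | B ((a^T *m x) 0 0)] =
    normal1 ((a^T *m m) 0 0) ((a^T *m S *m a) 0 0) B.

Definition cvg_in_distribution d (T : measurableType d) (P : probability T R)
    (Z : nat -> T -> 'cV[R]_p) (mu : probability 'cV[R]_p R) : Prop :=
  forall f : 'cV[R]_p -> R, continuous f -> (exists M, forall x, `|f x| <= M) ->
    ('E_P[f \o Z n] @[n --> \oo] --> 'E_mu[f])%E.

End multivariate_normal.

Section moment_map.
Context (R : realType) (K d : nat).

(** [design m] is the matrix with k-th row [(1, row k m)]. *)
Definition design (m : 'M[R]_(K, d)) : 'M[R]_(K, 1 + d) :=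
  row_mx (const_mx 1) m.

Definition moment_map (w : 'rV[R]_K) (m : 'M[R]_(K, d)) (y : 'cV[R]_K) :
    'cV[R]_(1 + d) :=
  invmx ((design m)^T *m diag_mx w *m design m)
    *m (design m)^T *m diag_mx w *m y.

(** The point [(m^1, ..., m^K, y^1, ..., y^K)] of [R^(dK + K)]. *)
Definition stack (m : 'M[R]_(K, d)) (y : 'cV[R]_K) :
    'rV[R]_(\sum_(k < K) d + K) :=
  row_mx (\mxrow_(k < K) row k m) y^T.

Definition stacked_moment_map (w : 'rV[R]_K)
    (x : 'rV[R]_(\sum_(k < K) d + K)) : 'rV[R]_(1 + d) :=
  (moment_map w (\matrix_(k < K) submxrow (lsubmx x) k) (rsubmx x)^T)^T.

(** The library's ['J f x] acts on row vectors on the right: it is the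
    transpose of the usual Jacobian matrix. *)
Definition jacobian_at (w : 'rV[R]_K) (x : 'rV[R]_(\sum_(k < K) d + K)) :
    'M[R]_(1 + d, \sum_(k < K) d + K) :=
  ('J (stacked_moment_map w) x)^T.

End moment_map.

Section population_moments.
Context dT (T : measurableType dT) (R : realType) (P : probability T R).
Context (d K : nat) (Y : T -> R) (X : T -> 'rV[R]_d) (G : {RV P >-> nat}).

Definition meanY : 'cV[R]_K := \col_k fine ('E_(cond_prob G k)[Y])%E.

Definition meanX : 'M[R]_(K, d) :=
  \matrix_(k, j) fine ('E_(cond_prob G k)[fun o => X o ord0 j])%E.

Definition varY (k : 'I_K) : R := fine ('V_(cond_prob G k)[Y])%E.

Definition covX (k : 'I_K) : 'M[R]_d :=
  \matrix_(i, j)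
    fine (covariance (cond_prob G k) (fun o => X o ord0 i) (fun o => X o ord0 j)).

Definition Gamma_mu : 'M[R]_(\sum_(k < K) d + K) :=
  block_mx (\mxdiag_(k < K) covX k) 0 0 (diag_mx (\row_k varY k)).

Definition Gamma_beta (w : 'rV[R]_K) : 'M[R]_(1 + d) :=
  let J := jacobian_at w (stack meanX meanY) in J *m Gamma_mu *m J^T.

End population_moments.

Section data.
Context (T : Type) (R : realType) (d K : nat).
Variables (Ys : 'I_K -> nat -> T -> R) (Xs : 'I_K -> nat -> T -> 'rV[R]_d).

Definition sample_meanY (n : nat) (o : T) : 'cV[R]_K :=
  \col_k (n%:R^-1 * \sum_(i < n) Ys k i o).

Definition sample_meanX (n : nat) (o : T) : 'M[R]_(K, d) :=
  \matrix_(k < K) (n%:R^-1 *: \sum_(i < n) Xs k i o).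

End data.

(** [inl (k, i)] is the i-th element of the k-th sample of Y, [inr (k, i)] that
    of X. Mutual independence of this family says both that each of the 2K
    samples consists of independent variables and that the 2K samples are
    mutually independent. *)
Definition observations dT (T : measurableType dT) (R : realType) (d K : nat)
    (Ys : 'I_K -> nat -> T -> R) (Xs : 'I_K -> nat -> T -> 'rV[R]_d)
    (a : ('I_K * nat) + ('I_K * nat)) : set (set T) :=
  match a with
  | inl (k, i) => g_sigma_algebra_preimage (Ys k i)
  | inr (k, i) => g_sigma_algebra_preimage (Xs k i)
  end.

(* Main.v *)
(** With [H m = (m^T w m)^-1 m^T w] acting on design matrices, [betaM - beta] is
    [H mhat *m (yhat - design mhat *m beta)]. The K coordinates of
    [yhat - design mhat *m beta] are independent, and the k-th one is the mean of the
    n i.i.d. variables [Y_i - beta_0 - sum_j beta_j X_ij] of group k, which are centered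
    because the noise is independent of the group and have variance
    [sigma_{Y,k}^2 + beta^T Gamma_X^k beta]. A one-dimensional central limit theorem
    (Lindeberg's replacement argument along the Gaussian semigroup), extended to vectors
    with independent coordinates by approximating a test function on a grid by sums of
    products of B-splines, gives the limit of the score; since [H mhat] converges to [H m]
    in probability, Slutsky's theorem applies. Finally the Jacobian of [g] at [theta] is
    [(dm, dy) |-> H m *m (dy - dm *m beta)], as [g (m, y) = beta + H m *m (y - design m *m beta)]
    and the last factor vanishes at [theta], so [Gamma_beta] is the covariance matrix
    of the limit. *)

From HB Require Import structures.
Require Import Defs.
From mathcomp Require Import all_boot all_order all_algebra finmap.
From mathcomp Require Import all_classical all_reals all_analysis measurable_realfun.
From mathcomp Require Import ring lra.

Set Implicit Arguments.
Unset Strict Implicit.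
Unset Printing Implicit Defensive.

Import Order.TTheory GRing.Theory Num.Theory.
Import numFieldNormedType.Exports.

Local Open Scope classical_set_scope.
Local Open Scope ring_scope.

(** * Real-valued expectation *)

(** The probability space of the data need not carry Gaussian variables. This dictates the class
    [taylor2] of test functions: it is stable under Gaussian smoothing with an unchanged constant,
    so the Gaussian summands can live in the test function and the space is never enlarged. With
    second moments only, a third-moment bound on the Taylor remainder is out of reach; the remainder
    is measured by min(t^2, |t|^3) instead, which is integrable under a second moment and still has
    expectation o(1/n) once the variable is divided by sqrt n. For vectors, products of functions of
    one coordinate are used because their expectations factor under independence. Cubic B-splines
    are C^2, nonnegative and form a partition of unity, so the approximant keeps the sup bound of
    the test function outside the box, where only tightness is available. Every Gaussian is written
    as sqrt v times a standard one, so that zero variances need no separate limit theorem. *)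

Section real_expectation.
Context d (T : measurableType d) (R : realType) (P : probability T R).
Implicit Types f g : T -> R.

Definition summable f := P.-integrable setT (fun x => (f x)%:E).

(** Real-valued, so that estimates end in [lra] or [nra]. The price is a junk value on nonsummable
    functions, hence the [summable] side conditions of the algebraic rules. *)
Definition Ex f : R := \int[P]_x f x.

Lemma summable_measurable f : summable f -> measurable_fun setT f.
Proof. by move=> /integrableP[/measurable_EFinP]. Qed.

Lemma Ex_cst (r : R) : Ex (fun=> r) = r.
Proof.
rewrite /Ex Rintegral_cst// [X in fine X](_ : _ = 1%E) ?mulr1//.
exact: probability_setT.
Qed.

Lemma le_summable f g : measurable_fun setT f -> (forall x, `|f x| <= g x) ->
  summable g -> summable f.
Proof.
move=> mf fg; apply: le_integrable => //; first exact/measurable_EFinP.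
by move=> x _; rewrite /= lee_fin (le_trans (fg x))// ler_norm.
Qed.

Lemma summable_cst (r : R) : summable (fun=> r).
Proof.
apply/integrableP; split; first exact: measurable_cst.
rewrite [X in (X < _)%E](_ : _ = `|r%:E| * P setT)%E; last exact: integral_cst.
by rewrite [X in (_ * X)%E](_ : _ = 1%E) ?mule1 ?ltry//; exact: probability_setT.
Qed.

Lemma bounded_summable f (M : R) : measurable_fun setT f ->
  (forall x, `|f x| <= M) -> summable f.
Proof. by move=> mf fM; apply: le_summable fM _ => //; exact: summable_cst. Qed.

Lemma summableD f g : summable f -> summable g -> summable (fun x => f x + g x).
Proof. by move=> itf itg; by apply: eq_integrable (integrableD measurableT itf itg) => //. Qed.

Lemma summableZ (r : R) f : summable f -> summable (fun x => r * f x).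
Proof. by move=> itf; by apply: eq_integrable (integrableZl measurableT r itf) => //. Qed.

Lemma summableB f g : summable f -> summable g -> summable (fun x => f x - g x).
Proof. by move=> itf itg; by apply: eq_integrable (integrableB measurableT itf itg) => //. Qed.

Lemma summable_norm f : summable f -> summable (fun x => `|f x|).
Proof. exact: integrable_norm. Qed.

Lemma summable_sum I (s : seq I) (h : I -> T -> R) :
  (forall i, summable (h i)) -> summable (fun x => \sum_(i <- s) h i x).
Proof.
move=> hi; elim: s => [|i s ih].
  by under eq_fun do rewrite big_nil; exact: summable_cst.
by under eq_fun do rewrite big_cons; exact: summableD.
Qed.

Lemma summableM f g : measurable_fun setT f -> measurable_fun setT g ->
  summable (fun x => f x ^+ 2) -> summable (fun x => g x ^+ 2) ->
  summable (fun x => f x * g x).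
Proof.
move=> mf mg f2 g2; apply: (le_summable _ _ (summableD f2 g2)).
  exact: measurable_funM.
by move=> x; rewrite ler_norml; apply/andP; split; nra.
Qed.

Lemma summable_sqrD f g : measurable_fun setT f -> measurable_fun setT g ->
  summable (fun x => f x ^+ 2) -> summable (fun x => g x ^+ 2) ->
  summable (fun x => (f x + g x) ^+ 2).
Proof.
move=> mf mg f2 g2; apply: (le_summable _ _ (summableZ 2 (summableD f2 g2))).
  by apply: measurable_funX; exact: measurable_funD.
by move=> x; rewrite ger0_norm ?sqr_ge0//; have := sqr_ge0 (f x - g x); nra.
Qed.

Lemma summable_sqrZ (r : R) f :
  summable (fun x => f x ^+ 2) -> summable (fun x => (r * f x) ^+ 2).
Proof. by move=> f2; under eq_fun do rewrite exprMn; exact: summableZ. Qed.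

Lemma summable_sqrB f (c : R) : measurable_fun setT f ->
  summable (fun x => f x ^+ 2) -> summable (fun x => (f x - c) ^+ 2).
Proof.
move=> mf f2; apply: summable_sqrD => //.
by under eq_fun do rewrite sqrrN; exact: summable_cst.
Qed.

Lemma summable_sqr_sum I (s : seq I) (h : I -> T -> R) :
  (forall i, measurable_fun setT (h i)) -> (forall i, summable (fun x => h i x ^+ 2)) ->
  summable (fun x => (\sum_(i <- s) h i x) ^+ 2).
Proof.
move=> mh h2; elim: s => [|i s ih].
  by under eq_fun do rewrite big_nil; exact: summable_cst.
under eq_fun do rewrite big_cons; apply: summable_sqrD => //.
exact: measurable_sum.
Qed.

Lemma summable_sqr f : measurable_fun setT f ->
  summable (fun x => f x ^+ 2) -> summable f.
Proof.
move=> mf f2; apply: (le_summable mf _ (summableD (summable_cst 1) f2)).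
by move=> x; rewrite ler_norml; apply/andP; split; nra.
Qed.

Lemma ExD f g : summable f -> summable g ->
  Ex (fun x => f x + g x) = Ex f + Ex g.
Proof. by move=> itf itg; rewrite /Ex RintegralD. Qed.

Lemma ExB f g : summable f -> summable g ->
  Ex (fun x => f x - g x) = Ex f - Ex g.
Proof. by move=> itf itg; rewrite /Ex RintegralB. Qed.

Lemma ExZ (r : R) f : summable f -> Ex (fun x => r * f x) = r * Ex f.
Proof. by move=> itf; rewrite /Ex RintegralZl. Qed.

Lemma eq_Ex f g : f =1 g -> Ex f = Ex g.
Proof. by move=> fg; apply: eq_Rintegral => x _; exact: fg. Qed.

Lemma Ex_sum I (s : seq I) (h : I -> T -> R) : (forall i, summable (h i)) ->
  Ex (fun x => \sum_(i <- s) h i x) = \sum_(i <- s) Ex (h i).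
Proof.
move=> hi; elim: s => [|i s ih].
  by under eq_Ex do rewrite big_nil; rewrite big_nil Ex_cst.
under eq_Ex do rewrite big_cons.
by rewrite big_cons ExD ?ih//; exact: summable_sum.
Qed.

Lemma le_Ex f g : summable f -> summable g -> (forall x, f x <= g x) ->
  Ex f <= Ex g.
Proof. by move=> itf itg fg; apply: le_Rintegral. Qed.

Lemma Ex_ge0 f : (forall x, 0 <= f x) -> 0 <= Ex f.
Proof. by move=> f0; apply: Rintegral_ge0. Qed.

Lemma norm_Ex f g : summable f -> summable g -> (forall x, `|f x| <= g x) ->
  `|Ex f| <= Ex g.
Proof.
move=> itf itg fg; apply: (le_trans (le_normr_Rintegral _ itf)) => //.
by apply: le_Ex => //; exact: summable_norm.
Qed.

Lemma norm_Ex_cst f (M : R) : measurable_fun setT f ->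
  (forall x, `|f x| <= M) -> `|Ex f| <= M.
Proof.
move=> mf fM; rewrite -[leRHS]Ex_cst; apply: norm_Ex => //.
  exact: bounded_summable fM.
exact: summable_cst.
Qed.

Lemma Ex_EFin f : summable f -> (\int[P]_x (f x)%:E = (Ex f)%:E)%E.
Proof. by move=> itf; rewrite fineK// integrable_fin_num. Qed.

Lemma expectation_Ex f : summable f -> ('E_P[f] = (Ex f)%:E)%E.
Proof. by move=> itf; rewrite -Ex_EFin// unlock. Qed.

Lemma fine_expectation f : fine 'E_P[f]%E = Ex f.
Proof. by rewrite unlock. Qed.

Lemma Ex_indic A : measurable A -> Ex \1_A = fine (P A).
Proof. by move=> mA; rewrite /Ex /Rintegral integral_indic// setIT. Qed.

Lemma summable_indic A : measurable A -> summable \1_A.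
Proof.
move=> mA; apply: (@bounded_summable _ 1); first exact: measurable_indic.
by move=> x; rewrite indicE; case: (_ \in _); rewrite ?normr1 ?normr0.
Qed.

End real_expectation.

Section independence_expectation.
Context d (T : measurableType d) (R : realType) (P : probability T R).

Lemma independent_RVs_comp d1 d2 d3 d4 (T1 : measurableType d1)
    (T2 : measurableType d2) (T3 : measurableType d3) (T4 : measurableType d4)
    (X : T -> T1) (Y : T -> T2) (f : T1 -> T3) (g : T2 -> T4) :
  measurable_fun setT f -> measurable_fun setT g ->
  independent_RVs P X Y -> independent_RVs P (f \o X) (g \o Y).
Proof.
move=> mf mg XY A B mA mB; apply: (XY (f @^-1` A) (g @^-1` B)).
- by rewrite -[_ @^-1` _]setTI; exact: mf.
- by rewrite -[_ @^-1` _]setTI; exact: mg.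
Qed.

(** Independence on rectangles identifies the law of the pair with the product of the marginals.
    Tonelli then gives integrability of the product, and Fubini the factorization. *)
Lemma independent_RVs_mul (f g : T -> R) :
  independent_RVs P f g -> summable P f -> summable P g ->
  summable P (fun x => f x * g x) /\ Ex P (fun x => f x * g x) = Ex P f * Ex P g.
Proof.
move=> fg itf itg.
have mf := summable_measurable itf; have mg := summable_measurable itg.
pose X : {RV P >-> R} := HB.pack f (isMeasurableFun.Build _ _ _ _ _ mf).
pose Y : {RV P >-> R} := HB.pack g (isMeasurableFun.Build _ _ _ _ _ mg).
pose m1 := distribution P X; pose m2 := distribution P Y.
have mXY : measurable_fun setT (fun x => (f x, g x)).
  exact: measurable_fun_pair.
pose XY : {RV P >-> (R * R)%type} := HB.pack (fun x => (f x, g x)) (isMeasurableFun.Build _ _ _ _ _ mXY).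
have mE A : measurable A -> (m1 \x m2)%E A = distribution P XY A.
  apply: (@product_measure_unique _ _ _ _ _ m1 m2 (distribution P XY)).
  by move=> A1 B mA mB /=; exact: fg.
pose h (p : R * R) := p.1 * p.2.
have mh : measurable_fun setT h by exact: measurable_funM.
have mhE : measurable_fun setT (EFin \o h) by exact/measurable_EFinP.
have E1 : (\int[m1]_x (`|x|)%:E = (Ex P (fun x => `|f x|))%:E)%E.
  rewrite ge0_integral_distribution//; first exact/Ex_EFin/summable_norm.
  by apply/measurable_EFinP; exact: normr_measurable.
have E2 : (\int[m2]_x (`|x|)%:E = (Ex P (fun x => `|g x|))%:E)%E.
  rewrite ge0_integral_distribution//; first exact/Ex_EFin/summable_norm.
  by apply/measurable_EFinP; exact: normr_measurable.
have E3 : (\int[m1]_x x%:E = (Ex P f)%:E)%E.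
  by rewrite integral_distribution//; exact: Ex_EFin.
have E4 : (\int[m2]_x x%:E = (Ex P g)%:E)%E.
  by rewrite integral_distribution//; exact: Ex_EFin.
have it1 : m1.-integrable setT EFin.
  by apply/integrableP; split => //; rewrite E1 ltry.
have it2 : m2.-integrable setT EFin.
  by apply/integrableP; split => //; rewrite E2 ltry.
have ith : (m1 \x m2)%E.-integrable setT (EFin \o h).
  apply/integrable12ltyP => //=.
  rewrite (eq_integral (fun x : R => (Ex P (fun x => `|g x|%R))%:E * (`|x|%R)%:E))%E.
    rewrite ge0_integralZl//; first by rewrite E1 -EFinM ltry.
      by apply/measurable_EFinP; exact: normr_measurable.
    by rewrite lee_fin Ex_ge0.
  move=> x _; rewrite -E2 muleC -ge0_integralZl//.
    by apply: eq_integral => y _; rewrite /h /= normrM EFinM.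
  by apply/measurable_EFinP; exact: normr_measurable.
have itXY : P.-integrable setT ((EFin \o h) \o XY).
  apply/integrableP; split; first by apply: measurableT_comp.
  rewrite -(ge0_integral_distribution XY (f := fun p => `|(EFin \o h) p|%E))//; last exact: measurableT_comp.
  case/integrableP: ith => _; congr (_ < _)%E.
  by apply: eq_measure_integral => A mA _; exact: mE.
split; first exact: itXY.
apply: EFin_inj; rewrite -Ex_EFin//.
rewrite -[LHS](integral_distribution mhE itXY).
transitivity (\int[(m1 \x m2)%E]_p (EFin \o h) p)%E.
  by apply/esym; apply: eq_measure_integral => A mA _; exact: mE.
rewrite -integral12_prod_meas1//.
rewrite (eq_integral (fun x : R => (Ex P g)%:E * x%:E))%E.
  by rewrite integralZl// E3 -EFinM mulrC.
move=> x _; rewrite -E4 muleC -integralZl//.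
Qed.

End independence_expectation.

(** * The standard Gaussian law *)

Section lebesgue_affine.
Context (R : realType).
Local Notation mu := (@lebesgue_measure R).

(** Uniqueness of Lebesgue measure: the rescaled pushforward gives half-open intervals their
    length. *)
Lemma lebesgue_measure_affine (a c : R) (A : set R) : 0 < a -> measurable A ->
  (a%:E * pushforward mu (fun x : measurableTypeR R => (a * x + c)%R : measurableTypeR R) A)%E
  = mu A.
Proof.
move=> a0 mA.
have mf : measurable_fun setT (fun x : measurableTypeR R => (a * x + c)%R : measurableTypeR R).
  by apply: measurable_funD => //; exact: measurable_funM.
pose nu : {measure set (measurableTypeR R) -> \bar R} :=
  mscale (NngNum (ltW a0)) (pushforward mu
    (fun x : measurableTypeR R => (a * x + c)%R : measurableTypeR R)).
transitivity (nu mf A); first by []. 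
apply/esym/lebesgue_measure_unique => //.
move=> _ [[u v]] _ <-.
rewrite /nu/= /mscale/= /pushforward /=.
rewrite (_ : _ @^-1` _ = `](u - c) / a, (v - c) / a]%classic); last first.
  apply/seteqP; split => x /=; rewrite !in_itv/=;
  by rewrite ltr_pdivrMr// ler_pdivlMr// ltrBlDr lerBrDr [x * a]mulrC.
rewrite !lebesgue_measure_itv/= !lte_fin ltr_pM2r ?invr_gt0// ltrD2r.
case: ifPn => _; last by rewrite mule0.
rewrite -!EFinD -EFinM; congr EFin; by field; rewrite gt_eqF.
Qed.

Lemma ge0_integral_affine (a c : R) (f : R -> \bar R) : 0 < a ->
  measurable_fun setT f -> (forall x, 0 <= f x)%E ->
  (a%:E * \int[mu]_x f (a * x + c)%R = \int[mu]_x f x)%E.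
Proof.
move=> a0 mf f0.
have mg : measurable_fun setT (fun x : measurableTypeR R => (a * x + c)%R : measurableTypeR R).
  by apply: measurable_funD => //; exact: measurable_funM.
have -> : (\int[mu]_x f (a * x + c)%R =
  \int[pushforward mu (fun x : measurableTypeR R => (a * x + c)%R : measurableTypeR R)]_x f x)%E.
  by rewrite ge0_integral_pushforward.
pose nu : {measure set (measurableTypeR R) -> \bar R} := pushforward mu
    (fun x : measurableTypeR R => (a * x + c)%R : measurableTypeR R).
have := @ge0_integral_mscale _ (measurableTypeR R) R (nu mg) setT measurableT
  (NngNum (ltW a0)) f mf (fun x _ => f0 x).
move=> /= <-.
apply: eq_measure_integral => //= A mA _.
by rewrite /mscale/= lebesgue_measure_affine.
Qed.

End lebesgue_affine.

Section gauss.
Context (R : realType).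
Local Notation mu := (@lebesgue_measure R).
Local Notation gauss := (@normal_prob R 0 1).

Definition gpdf (x : R) : R := normal_peak 1 * expR (- x ^+ 2 / 2).

Lemma normal_pdf01 : @normal_pdf R 0 1 = gpdf.
Proof.
apply/funext => x; rewrite /normal_pdf oner_eq0 /gpdf.
by rewrite /normal_fun subr0 expr1n mulNr.
Qed.

Lemma gpdf_ge0 x : 0 <= gpdf x.
Proof. by rewrite mulr_ge0 ?expR_ge0 ?normal_peak_ge0. Qed.

Lemma measurable_gpdf : measurable_fun setT gpdf.
Proof. rewrite -normal_pdf01; exact: measurable_normal_pdf. Qed.

Lemma integral_gpdf : (\int[mu]_x (gpdf x)%:E = 1)%E.
Proof. by rewrite -normal_pdf01 integral_normal_pdf. Qed.

(** Since [normal_prob] is the set integral of its density, [gpdf] is almost everywhere the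
    Radon-Nikodym derivative. *)
Lemma ge0_integral_gauss (f : R -> \bar R) :
  measurable_fun setT f -> (forall x, 0 <= f x)%E ->
  (\int[gauss]_x f x = \int[mu]_x (f x * (gpdf x)%:E))%E.
Proof.
move=> mf f0; have dom := @normal_prob_dominates R 0 1.
rewrite -(Radon_Nikodym_SigmaFinite.change_of_variables dom)//.
apply: ae_eq_integral => //.
- apply: emeasurable_funM => //.
  exact: measurable_int (Radon_Nikodym_SigmaFinite.f_integrable dom).
- apply: emeasurable_funM => //; apply/measurable_EFinP.
  exact: measurable_gpdf.
- apply: ae_eqe_mul2l; apply: integral_ae_eq => //=.
  + exact: Radon_Nikodym_SigmaFinite.f_integrable.
  + apply/measurable_EFinP; exact: measurable_gpdf.
  + move=> E _ mE; rewrite -Radon_Nikodym_SigmaFinite.f_integral//=.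
    by rewrite /normal_prob normal_pdf01.
Qed.

(** Completing the square. For s = a x + b y, the joint density of (x, s) is that of s, centered
    with variance c^2, times the conditional density of x, normal with mean a s / c^2 and standard
    deviation b / c. *)
Lemma gpdf_convE (a b s x : R) (c := Num.sqrt (a ^+ 2 + b ^+ 2)) :
  0 < a -> 0 < b ->
  b^-1 * gpdf ((s - a * x) / b) * gpdf x =
  c^-1 * gpdf (s / c) * (c / b * gpdf (c / b * x + - (a * s / (b * c)))).
Proof.
move=> a0 b0.
have c20 : 0 < a ^+ 2 + b ^+ 2 by rewrite addr_gt0// exprn_gt0.
have c0 : 0 < c by rewrite sqrtr_gt0.
have c2 : c ^+ 2 = a ^+ 2 + b ^+ 2 by rewrite sqr_sqrtr// ltW.
rewrite /gpdf; set p := normal_peak 1.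
rewrite [LHS](_ : _ = b^-1 * p ^+ 2 *
    expR (- ((s - a * x) / b) ^+ 2 / 2 + - x ^+ 2 / 2)); last first.
  by rewrite expRD; ring.
rewrite [RHS](_ : _ = b^-1 * p ^+ 2 *
    expR (- (s / c) ^+ 2 / 2 + - (c / b * x - a * s / (b * c)) ^+ 2 / 2)).
  congr (_ * expR _).
  have -> : (c / b * x - a * s / (b * c)) ^+ 2 =
    (c ^+ 2 * x - a * s) ^+ 2 / (b ^+ 2 * c ^+ 2).
    by field; rewrite !gt_eqF.
  rewrite expr_div_n c2 [in RHS]expr_div_n c2; field.
  by rewrite !gt_eqF.
by rewrite expRD; field; rewrite !gt_eqF.
Qed.

Lemma ge0_gauss_conv_pos (a b : R) (f : R -> \bar R) : 0 < a -> 0 < b ->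
  measurable_fun setT f -> (forall x, 0 <= f x)%E ->
  (\int[gauss]_x \int[gauss]_y f (a * x + b * y)%R =
   \int[gauss]_z f (Num.sqrt (a ^+ 2 + b ^+ 2) * z)%R)%E.
Proof.
move=> a0 b0 mf f0; set c := Num.sqrt _.
have c0 : 0 < c by rewrite sqrtr_gt0 addr_gt0// exprn_gt0.
have mg := measurable_gpdf.
have mgE : measurable_fun setT (EFin \o gpdf) by exact/measurable_EFinP.
have mlin (u v : R) : measurable_fun setT (fun z : R => u * z + v).
  by apply: measurable_funD => //; exact: measurable_funM.
have mfab x : measurable_fun setT (fun y => f (a * x + b * y)%R).
  apply: measurableT_comp => //.
  by under eq_fun do rewrite addrC; exact: mlin.
have innerE x : (\int[gauss]_y f (a * x + b * y)%R =
    \int[mu]_s (f s * (b^-1 * gpdf ((s - a * x) / b))%:E))%E.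
  rewrite ge0_integral_gauss//.
  rewrite -[RHS](ge0_integral_affine (a * x) b0); last 2 first.
  - apply: emeasurable_funM => //; apply/measurable_EFinP.
    apply: measurable_funM => //; apply: (measurableT_comp mg).
    by apply: measurable_funM => //; exact: measurable_funB.
  - by move=> s; rewrite mule_ge0// lee_fin mulr_ge0 ?gpdf_ge0 ?invr_ge0 ?ltW.
  rewrite -ge0_integralZl//; last 3 first.
  - apply: emeasurable_funM => //; first exact: measurableT_comp (mlin _ _).
    apply/measurable_EFinP.
    apply: measurable_funM => //; apply: (measurableT_comp mg).
    by apply: measurable_funM => //; apply: measurable_funB => //; exact: mlin.
  - by move=> y _; rewrite mule_ge0// lee_fin mulr_ge0 ?gpdf_ge0 ?invr_ge0 ?ltW.
  - by rewrite lee_fin ltW.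
  apply: eq_integral => y _.
  rewrite addrK [(b * y)%R]mulrC mulfK ?gt_eqF// [in RHS]addrC [(y * b)%R]mulrC.
  by rewrite muleCA -EFinM mulrA divff ?mul1r ?gt_eqF.
pose k (p : R * R) := (f p.2 * (b^-1 * gpdf ((p.2 - a * p.1) / b) * gpdf p.1)%:E)%E.
have mk : measurable_fun setT k.
  apply: emeasurable_funM; first exact: measurableT_comp.
  apply/measurable_EFinP; apply: measurable_funM; last first.
    exact: measurableT_comp.
  apply: measurable_funM => //; apply: (measurableT_comp mg).
  apply: measurable_funM => //; apply: measurable_funB => //.
  exact: measurable_funM.
have k0 p : (0 <= k p)%E.
  by rewrite mule_ge0// lee_fin mulr_ge0 ?gpdf_ge0// mulr_ge0 ?gpdf_ge0// invr_ge0 ltW.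
transitivity (\int[mu]_x \int[mu]_s k (x, s))%E.
  rewrite ge0_integral_gauss; last 2 first.
  - apply: (@measurable_fun_fubini_tonelli_F _ _ _ _ R gauss
      (fun p : R * R => f (a * p.1 + b * p.2)%R)) => //.
    apply: measurableT_comp => //; apply: measurable_funD => //;
    exact: measurable_funM.
  - by move=> x; exact: integral_ge0.
  apply: eq_integral => x _; rewrite innerE -ge0_integralZr//; last 3 first.
  - apply: emeasurable_funM => //; apply/measurable_EFinP.
    apply: measurable_funM => //; apply: (measurableT_comp mg).
    by apply: measurable_funM => //; exact: measurable_funB.
  - by move=> s _; rewrite mule_ge0// lee_fin mulr_ge0 ?gpdf_ge0// invr_ge0 ltW.
  - by rewrite lee_fin gpdf_ge0.
  by apply: eq_integral => s _; rewrite /k/= -muleA -EFinM.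
(* After the exchange, [gpdf_convE] leaves a probability density in x, which integrates to 1. *)
rewrite (@fubini_tonelli _ _ _ _ R mu mu k)//.
pose h (s : R) : \bar R := (f s * (c^-1 * gpdf (s / c))%:E)%E.
transitivity (\int[mu]_s h s)%E; rewrite /h {h}.
  apply: eq_integral => s _.
  under eq_integral do rewrite /k/= gpdf_convE// -/c EFinM muleA.
  have mh : measurable_fun setT (fun x : R => c / b * gpdf (c / b * x + - (a * s / (b * c)))).
    by apply: measurable_funM => //; exact: (measurableT_comp mg (mlin _ _)).
  rewrite ge0_integralZl//; last 3 first.
  - exact/measurable_EFinP.
  - by move=> x _; rewrite lee_fin mulr_ge0 ?gpdf_ge0// divr_ge0// ltW.
  - by rewrite mule_ge0// lee_fin mulr_ge0 ?gpdf_ge0// invr_ge0 ltW.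
  rewrite -[RHS]mule1; congr (_ * _)%E; rewrite -integral_gpdf.
  rewrite -[RHS](@ge0_integral_affine _ (c / b) (- (a * s / (b * c)))); last 3 first.
  - by rewrite divr_gt0.
  - exact/measurable_EFinP.
  - by move=> x; rewrite lee_fin gpdf_ge0.
  rewrite -ge0_integralZl//.
  - by apply/measurable_EFinP; exact: (measurableT_comp mg (mlin _ _)).
  - by move=> x _; rewrite lee_fin gpdf_ge0.
  - by rewrite lee_fin divr_ge0// ltW.
have mc : measurable_fun setT (fun s : R => c^-1 * gpdf (s / c)).
  by apply: measurable_funM => //; apply: (measurableT_comp mg); exact: measurable_funM.
have mfc : measurable_fun setT (fun z : R => f (c * z)%R).
  by apply: measurableT_comp => //; exact: measurable_funM.
rewrite ge0_integral_gauss//.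
rewrite -[LHS](ge0_integral_affine 0 c0); last 2 first.
- by apply: emeasurable_funM => //; exact/measurable_EFinP.
- by move=> s; rewrite mule_ge0// lee_fin mulr_ge0 ?gpdf_ge0// invr_ge0 ltW.
rewrite -ge0_integralZl//; last 3 first.
- apply: emeasurable_funM; first exact: measurableT_comp (mlin _ _).
  by apply/measurable_EFinP; exact: (measurableT_comp mc (mlin _ _)).
- by move=> s _; rewrite mule_ge0// lee_fin mulr_ge0 ?gpdf_ge0// invr_ge0 ltW.
- by rewrite lee_fin ltW.
apply: eq_integral => z _.
have -> : (c * z + 0) / c = z by field; rewrite gt_eqF.
rewrite addr0.
by rewrite muleCA -EFinM mulrA divff ?mul1r ?gt_eqF.
Qed.

Lemma ge0_gaussN (f : R -> \bar R) :
  measurable_fun setT f -> (forall x, 0 <= f x)%E ->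
  (\int[gauss]_x f (- x)%R = \int[gauss]_x f x)%E.
Proof.
move=> mf f0.
have mN : measurable_fun setT (-%R : measurableTypeR R -> measurableTypeR R).
  exact: oppr_measurable.
have mfg : measurable_fun setT (fun x => f x * (gpdf x)%:E)%E.
  by apply: emeasurable_funM => //; apply/measurable_EFinP; exact: measurable_gpdf.
rewrite !ge0_integral_gauss//; last first.
  exact: measurableT_comp.
transitivity (\int[pushforward mu (-%R : measurableTypeR R -> measurableTypeR R)]_x
  (f x * (gpdf x)%:E))%E.
  rewrite ge0_integral_pushforward//.
    by apply: eq_integral => x _ /=; rewrite /gpdf sqrrN.
  by move=> x _; rewrite mule_ge0// lee_fin gpdf_ge0.
apply: eq_measure_integral => A mA _; exact: lebesgue_measureN.
Qed.

Lemma gauss_abs_scale (a : R) (f : R -> \bar R) :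
  measurable_fun setT f -> (forall x, 0 <= f x)%E ->
  (\int[gauss]_x f (a * x)%R = \int[gauss]_x f (`|a| * x)%R)%E.
Proof.
move=> mf f0; have [a0|a0] := leP 0 a; first by rewrite ger0_norm.
rewrite (ltr0_norm a0) -(@ge0_gaussN (fun x => f (- a * x)%R))//.
  by apply: eq_integral => x _; rewrite mulrNN.
by apply: measurableT_comp => //; exact: measurable_funM.
Qed.

(** Symmetry of the law reduces to nonnegative coefficients, and a vanishing coefficient leaves a
    single integral. *)
Lemma ge0_gauss_conv (a b : R) (f : R -> \bar R) :
  measurable_fun setT f -> (forall x, 0 <= f x)%E ->
  (\int[gauss]_x \int[gauss]_y f (a * x + b * y)%R =
   \int[gauss]_z f (Num.sqrt (a ^+ 2 + b ^+ 2) * z)%R)%E.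
Proof.
move=> mf f0.
have mlin (u v : R) : measurable_fun setT (fun z : R => u * z + v).
  by apply: measurable_funD => //; exact: measurable_funM.
have mf2 (u v : R) : measurable_fun setT (fun p : R * R => f (u * p.1 + v * p.2)%R).
  apply: measurableT_comp => //; apply: measurable_funD => //;
  exact: measurable_funM.
have gauss_cst (r : \bar R) : (0 <= r)%E -> (\int[gauss]_x r = r)%E.
  move=> _; transitivity (r * gauss setT)%E; first exact: integral_cst.
  by rewrite probability_setT mule1.
transitivity (\int[gauss]_x \int[gauss]_y f (`|a| * x + `|b| * y)%R)%E.
  rewrite -(@gauss_abs_scale a (fun s => \int[gauss]_y f (s + `|b| * y)%R)%E).
  - apply: eq_integral => x _.
    rewrite -(@gauss_abs_scale b (fun s => f (a * x + s)%R))//.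
    by apply: measurableT_comp => //; exact: measurable_funD.
  - have := @measurable_fun_fubini_tonelli_F _ _ _ _ R gauss
      (fun p : R * R => f (1 * p.1 + `|b| * p.2)%R) (mf2 _ _) (fun _ => f0 _).
    by rewrite /fubini_F/=; under eq_fun do under eq_integral do rewrite mul1r.
  - by move=> x; exact: integral_ge0.
rewrite -[a ^+ 2]real_normK ?num_real// -[b ^+ 2]real_normK ?num_real//.
have [->|a0] := eqVneq a 0.
  rewrite normr0 expr0n/= add0r sqrtr_sqr normr_id.
  by under eq_integral do under eq_integral do rewrite mul0r add0r; rewrite gauss_cst// integral_ge0.
have [->|b0] := eqVneq b 0.
  rewrite normr0 expr0n/= addr0 sqrtr_sqr normr_id.
  by under eq_integral do [under eq_integral do rewrite mul0r addr0; rewrite gauss_cst//].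
by apply: ge0_gauss_conv_pos; rewrite ?normr_gt0.
Qed.

End gauss.

Section gauss_moments.
Context (R : realType).
Local Notation mu := (@lebesgue_measure R).
Local Notation gauss := (@normal_prob R 0 1).

(** The exponential factor turns the density at x into the density at a x, so a change of scale
    suffices. *)
Lemma gauss_exp_sqr (a : R) : 0 < a ->
  (\int[gauss]_x (expR ((1 - a ^+ 2) / 2 * x ^+ 2))%:E = (a^-1)%:E)%E.
Proof.
move=> a0; have mg := @measurable_gpdf R.
rewrite ge0_integral_gauss; last 2 first.
- apply/measurable_EFinP/measurableT_comp => //.
  by apply: measurable_funM => //; exact: measurable_funX.
- by move=> x; rewrite lee_fin expR_ge0.
transitivity (\int[mu]_x (gpdf (a * x + 0))%:E)%E.
  apply: eq_integral => x _; rewrite -EFinM /gpdf mulrCA -expRD; congr (_ * expR _)%:E.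
  by field.
have := @ge0_integral_affine R a 0 (EFin \o @gpdf R) a0.
rewrite /= integral_gpdf => H.
rewrite -[LHS]mul1e -(mulVf (lt0r_neq0 a0)) EFinM -muleA H ?mule1//.
  exact/measurable_EFinP.
by move=> x; rewrite lee_fin gpdf_ge0.
Qed.

(** The bound [1 + t <= expR t] in [gauss_exp_sqr], for [a] close to 1 on either side,
    squeezes the second moment. *)
Lemma integral_gauss_sqr : (\int[gauss]_x (x ^+ 2)%:E = 1)%E.
Proof.
set V := (\int[gauss]_x _)%E.
have mexp (t : R) : measurable_fun setT (fun x : R => expR (t * x ^+ 2)).
  apply/measurableT_comp => //.
  by apply: measurable_funM => //; exact: measurable_funX.
have msq (t : R) : measurable_fun setT (fun x : R => (t * x ^+ 2)).
  by apply: measurable_funM => //; exact: measurable_funX.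
have msq1 : measurable_fun setT (fun x : R => x ^+ 2) by exact: measurable_funX.
have V0 : (0 <= V)%E by apply: integral_ge0 => x _; rewrite lee_fin sqr_ge0.
have cst1 : (\int[gauss]_x 1 = 1)%E.
  transitivity (1 * gauss setT)%E; first exact: integral_cst.
  by rewrite probability_setT mule1.
have up (a : R) : 0 < a < 1 -> (1%:E + ((1 - a ^+ 2) / 2)%:E * V <= (a^-1)%:E)%E.
  move=> /andP[a0 a1]; rewrite -gauss_exp_sqr//.
  have t0 : 0 <= (1 - a ^+ 2) / 2 by rewrite divr_ge0// subr_ge0 expr_le1 ?ltW.
  rewrite -ge0_integralZl//; last 2 first.
    exact/measurable_EFinP.
    by move=> x _; rewrite lee_fin sqr_ge0.
  rewrite -[X in (X + _)%E]cst1 -ge0_integralD//; last 2 first.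
    by move=> x _; rewrite -EFinM lee_fin mulr_ge0// sqr_ge0.
    by apply: emeasurable_funM => //; exact/measurable_EFinP.
  apply: ge0_le_integral => //.
  - by move=> x _; rewrite -EFinM -EFinD lee_fin addr_ge0// mulr_ge0// sqr_ge0.
  - by apply: emeasurable_funD => //; apply: emeasurable_funM => //; exact/measurable_EFinP.
  - by apply/measurable_EFinP; exact: (mexp ((1 - a ^+ 2) / 2)).
  - by move=> x _; rewrite -EFinM -EFinD lee_fin expR_ge1Dx.
(* The bound at a = 1/2 already forces a finite second moment. *)
have Vfin : V \is a fin_num.
  rewrite ge0_fin_numE//; have := up (2^-1); rewrite invr_gt0 ltr0n invf_lt1// ltr1n => /(_ isT).
  rewrite -leeBrDl// -EFinB -lee_pdivlMl; last by lra.
  by move=> /le_lt_trans; apply; rewrite -EFinM ltry.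
rewrite -(fineK Vfin); congr EFin; set v := fine V.
have {}up (a : R) : 0 < a < 1 -> 1 + (1 - a ^+ 2) / 2 * v <= a^-1.
  by move=> /up; rewrite -(fineK Vfin) -EFinM -EFinD lee_fin.
have v0 : 0 <= v by rewrite fine_ge0.
have dn (a : R) : 1 < a -> 1 <= a^-1 + (a ^+ 2 - 1) / 2 * v.
  move=> a1; have a0 : 0 < a by rewrite (lt_trans _ a1).
  have t0 : 0 <= (a ^+ 2 - 1) / 2 by rewrite divr_ge0// subr_ge0 expr_ge1// ltW.
  rewrite -lee_fin EFinD EFinM (fineK Vfin) -(gauss_exp_sqr a0) -[leLHS]cst1.
  rewrite -ge0_integralZl//; last 2 first.
    exact/measurable_EFinP.
    by move=> x _; rewrite lee_fin sqr_ge0.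
  rewrite -ge0_integralD//; last 3 first.
  - by apply/measurable_EFinP; exact: (mexp ((1 - a ^+ 2) / 2)).
  - by move=> x _; rewrite -EFinM lee_fin mulr_ge0// sqr_ge0.
  - by apply: emeasurable_funM => //; exact/measurable_EFinP.
  apply: ge0_le_integral => //.
  - apply: emeasurable_funD; first by apply/measurable_EFinP; exact: (mexp ((1 - a ^+ 2) / 2)).
    by apply: emeasurable_funM => //; exact/measurable_EFinP.
  - move=> x _; rewrite -EFinM -EFinD lee_fin.
    by have := expR_ge1Dx ((1 - a ^+ 2) / 2 * x ^+ 2); nra.
(* For a = 1 - e the bound becomes (1 - e)(2 - e) v <= 2 after division by e, and (1 - e)(2 - e) >=
   2 (1 - 2 e). *)
have {}up (e : R) : 0 < e < 1 -> v * (1 - 2 * e) <= 1.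
  move=> /andP[e0 e1]; have := up (1 - e); rewrite subr_gt0 gtrBl e0 e1 => /(_ isT).
  rewrite -[leRHS]mul1r ler_pdivlMr ?subr_gt0// => H.
  have : (1 - e) * (2 - e) * v <= 2 by rewrite -(ler_pM2l e0); nra.
  nra.
have {}dn (e : R) : 0 < e < 1 -> 1 <= v * (1 + 3 * e).
  move=> /andP[e0 e1]; have := dn (1 + e); rewrite ltrDl e0 => /(_ isT).
  rewrite -lerBlDr -(@ler_pM2r _ (1 + e)) ?addr_gt0//.
  rewrite mulrBl mulVf ?gt_eqF ?addr_gt0// => H.
  have : 2 <= (1 + e) * (2 + e) * v by rewrite -(ler_pM2l e0); nra.
  nra.
apply/eqP; rewrite eq_le; apply/andP; split; rewrite leNgt; apply/negP => v1.
  have w0 : 0 < v by lra.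
  (* This e makes v (1 - 2 e) equal to (v + 1) / 2, which exceeds 1. *)
  have e01 : 0 < (v - 1) / (4 * v) < 1.
    by rewrite divr_gt0 ?subr_gt0 ?mulr_gt0//= ltr_pdivrMr ?mulr_gt0//; lra.
  have := up _ e01.
  have -> : v * (1 - 2 * ((v - 1) / (4 * v))) = v - (v - 1) / 2 by field; rewrite gt_eqF.
  lra.
(* Here v (1 + 3 e) - 1 = - (1 - v)(2 - v) / 2 is negative. *)
have e01 : 0 < (1 - v) / 6 < 1 by apply/andP; split; lra.
have := dn _ e01; nra.
Qed.

Lemma integrable_gauss_sqr : gauss.-integrable setT (EFin \o (fun x => x ^+ 2)).
Proof.
apply/integrableP; split; first exact/measurable_EFinP/measurable_funX.
under eq_integral do rewrite /= ger0_norm ?sqr_ge0//.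
by rewrite integral_gauss_sqr ltry.
Qed.

(** By symmetry the positive and negative parts have the same integral, finite because x^+ <= 1 +
    x^2, so their difference is 0. *)
Lemma integral_gauss_id : (\int[gauss]_x x%:E = 0)%E.
Proof.
rewrite integralE.
have -> : (\int[gauss]_x (EFin : R -> _)^\- x = \int[gauss]_x (EFin : R -> _)^\+ x)%E.
  rewrite -[RHS]ge0_gaussN//; last exact: measurable_funepos.
  apply: eq_integral => x _; by rewrite funenegE funeposE.
rewrite subee// ge0_fin_numE ?integral_ge0//.
apply: (@le_lt_trans _ _ (\int[gauss]_x (1 + x ^+ 2)%:E)%E); last first.
  under eq_integral do rewrite EFinD.
  rewrite ge0_integralD//.
  - rewrite integral_gauss_sqr lte_add_pinfty// ?ltry//.
    rewrite [X in (X < _)%E](_ : _ = 1 * gauss setT)%E; last exact: integral_cst.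
    by rewrite probability_setT mule1 ltry.
  - by move=> x _; rewrite lee_fin sqr_ge0.
  - exact/measurable_EFinP/measurable_funX.
apply: ge0_le_integral => //.
- exact: measurable_funepos.
- by apply/measurable_EFinP; apply: measurable_funD => //; exact: measurable_funX.
- move=> x _; rewrite funeposE ge_max !lee_fin; apply/andP; split; nra.
Qed.

End gauss_moments.

(** * One-dimensional central limit theorem *)

Section lindeberg.
Context (R : realType).
Local Notation gauss := (@normal_prob R 0 1).
Implicit Types f : R -> R.

(** The square makes it integrable under a second moment; the cube makes its expectation o(1/n) once
    the variable is divided by sqrt n. *)
Definition cut (t : R) : R := Num.min (t ^+ 2) (`|t| ^+ 3).

Lemma cut_ge0 t : 0 <= cut t.
Proof. by rewrite le_min sqr_ge0 exprn_ge0. Qed.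

Lemma cut_le_sqr t : cut t <= t ^+ 2.
Proof. by rewrite ge_min lexx. Qed.

Lemma measurable_cut : measurable_fun setT cut.
Proof.
apply: measurable_minr; first exact: measurable_funX.
by apply: measurable_funX; exact: normr_measurable.
Qed.

Lemma summable_cut d (T : measurableType d) (P : probability T R) (U : T -> R) :
  measurable_fun setT U -> summable P (fun x => U x ^+ 2) ->
  summable P (fun x => cut (U x)).
Proof.
move=> mU U2; apply: le_summable U2; first exact: measurableT_comp measurable_cut _.
by move=> x; rewrite ger0_norm ?cut_ge0// cut_le_sqr.
Qed.

(** Second order Taylor expansion with a remainder that is at the same time
    quadratic and cubic; [f2] plays the role of half the second derivative. *)
Definition taylor2 (C : R) f f1 f2 : Prop :=
  [/\ measurable_fun setT f, measurable_fun setT f1, measurable_fun setT f2,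
    exists M, forall x, [/\ `|f x| <= M, `|f1 x| <= M & `|f2 x| <= M] &
    forall x t, `|f (x + t) - f x - t * f1 x - t ^+ 2 * f2 x| <= C * cut t].

(** The Gaussian semigroup, indexed by standard deviation. At s = 0 it is the identity, so a
    degenerate normal limit is covered as well. *)
Definition gconv (s : R) f (x : R) : R := Ex gauss (fun z => f (x + s * z)).

Let maff (x s : R) : measurable_fun setT (fun z : measurableTypeR R => x + s * z).
Proof. by apply: measurable_funD => //; exact: measurable_funM. Qed.

(** Adding the bound M makes the integrand nonnegative, which transfers Tonelli-type statements to
    bounded functions. *)
Let gconv_shift s f M x : measurable_fun setT f -> (forall x, `|f x| <= M) ->
  (\int[gauss]_z (f (x + s * z) + M)%:E = (gconv s f x + M)%:E)%E.
Proof.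
move=> mf fM.
have sf : summable gauss (fun z => f (x + s * z)).
  by apply: bounded_summable => // ; exact: measurableT_comp.
rewrite Ex_EFin; last by apply: summableD => //; exact: summable_cst.
by rewrite ExD ?Ex_cst//; exact: summable_cst.
Qed.

Lemma measurable_gconv s f M : measurable_fun setT f ->
  (forall x, `|f x| <= M) -> measurable_fun setT (gconv s f).
Proof.
move=> mf fM.
pose g (p : R * measurableTypeR R) := (f (p.1 + s * p.2) + M)%:E.
have mg : measurable_fun setT g.
  apply/measurable_EFinP; apply: measurable_funD => //.
  apply: measurableT_comp => //.
  by apply: measurable_funD => //; exact: measurable_funM.
have g0 p : (0 <= g p)%E.
  by rewrite lee_fin -lerBlDr sub0r; have := fM (p.1 + s * p.2); rewrite ler_norml => /andP[].
have := @measurable_fun_fubini_tonelli_F _ _ _ _ R gauss g mg g0.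
rewrite /fubini_F; under eq_fun do rewrite (gconv_shift _ _ mf fM).
move=> /measurable_EFinP mgM.
rewrite (_ : gconv s f = (fun x => gconv s f x + M - M)).
  exact: measurable_funB.
by apply/funext => x; rewrite addrK.
Qed.

Lemma norm_gconv s f M x : measurable_fun setT f ->
  (forall x, `|f x| <= M) -> `|gconv s f x| <= M.
Proof.
move=> mf fM; apply: norm_Ex_cst => //.
exact: measurableT_comp.
Qed.

Lemma gauss_summable : summable gauss (fun z => z).
Proof.
apply: summable_sqr; first exact: measurable_id.
exact: integrable_gauss_sqr.
Qed.

Lemma Ex_gauss : Ex gauss (fun z => z) = 0.
Proof. by rewrite /Ex /Rintegral integral_gauss_id. Qed.

Lemma Ex_gauss_sqr : Ex gauss (fun z => z ^+ 2) = 1.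
Proof. by rewrite /Ex /Rintegral integral_gauss_sqr. Qed.

(** Smoothing averages translates of [f], which all share the constant C; no loss accumulates along
    the induction of [lindeberg]. *)
Lemma taylor2_gconv s C f f1 f2 : taylor2 C f f1 f2 ->
  taylor2 C (gconv s f) (gconv s f1) (gconv s f2).
Proof.
move=> [mf mf1 mf2 [M fM] tf].
have fM0 x : `|f x| <= M by case: (fM x).
have fM1 x : `|f1 x| <= M by case: (fM x).
have fM2 x : `|f2 x| <= M by case: (fM x).
have su (g : R -> R) x : measurable_fun setT g -> (forall x, `|g x| <= M) ->
    summable gauss (fun z => g (x + s * z)).
  by move=> mg gM; apply: (@bounded_summable _ _ _ _ _ M) => //; exact: measurableT_comp.
split; [exact: measurable_gconv fM0|exact: measurable_gconv fM1|
  exact: measurable_gconv fM2| |].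
  by exists M => x; split; exact: norm_gconv.
move=> x t; rewrite /gconv -!ExZ; [|exact: su..].
rewrite -!ExB; [|by do ?apply: summableB; do ?apply: summableZ; exact: su..].
apply: norm_Ex_cst.
  apply: (summable_measurable (P := gauss)).
  by do ?apply: summableB; do ?apply: summableZ; exact: su.
by move=> z; rewrite (addrAC x t); exact: tf.
Qed.

(** Independent Gaussian increments add their variances; the shift by M reduces this to
    [ge0_gauss_conv]. *)
Lemma gconv_gconv s t f M : measurable_fun setT f -> (forall x, `|f x| <= M) ->
  gconv t (gconv s f) = gconv (Num.sqrt (t ^+ 2 + s ^+ 2)) f.
Proof.
move=> mf fM; apply/funext => x; apply: (@addIr _ M); apply: EFin_inj.
rewrite -!gconv_shift//; last 2 first.
  exact: measurable_gconv fM.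
  by move=> y; exact: norm_gconv.
under eq_integral do rewrite -gconv_shift//.
rewrite -(@ge0_gauss_conv _ t s (fun y => (f (x + y) + M)%:E)).
- by apply: eq_integral => y _; apply: eq_integral => z _; rewrite addrA.
- apply/measurable_EFinP; apply: measurable_funD => //.
  by apply: measurableT_comp => //; exact: measurable_funD.
- move=> y; rewrite lee_fin -lerBlDr sub0r.
  by have := fM (x + y); rewrite ler_norml => /andP[].
Qed.

Lemma gconv0 f : gconv 0 f = f.
Proof.
by apply/funext => x; rewrite /gconv; under eq_Ex do rewrite mul0r addr0; rewrite Ex_cst.
Qed.

(** The first order term vanishes because the Gaussian is centered; the second order one has
    coefficient t^2, the variance of the increment. *)
Lemma gconv_taylor t C f f1 f2 x : taylor2 C f f1 f2 ->
  `|gconv t f x - f x - t ^+ 2 * f2 x| <= C * Ex gauss (fun z => cut (t * z)).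
Proof.
move=> [mf mf1 mf2 [M fM] tf].
have sf : summable gauss (fun z => f (x + t * z)).
  apply: (@bounded_summable _ _ _ _ _ M); first exact: measurableT_comp.
  by move=> z; case: (fM (x + t * z)).
have s2 : summable gauss (fun z => t ^+ 2 * z ^+ 2 * f2 x).
  under eq_fun do rewrite mulrAC; apply: summableZ; exact: integrable_gauss_sqr.
have s1 : summable gauss (fun z => t * z * f1 x).
  under eq_fun do rewrite mulrAC; apply: summableZ; exact: gauss_summable.
have -> : t ^+ 2 * f2 x = Ex gauss (fun z => t ^+ 2 * z ^+ 2 * f2 x).
  under eq_Ex do rewrite mulrAC.
  by rewrite ExZ ?Ex_gauss_sqr ?mulr1//; exact: integrable_gauss_sqr.
have -> : gconv t f x - f x = Ex gauss (fun z => f (x + t * z) - f x - t * z * f1 x).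
  rewrite !ExB//; last 2 first.
  - exact: summable_cst.
  - by apply: summableB => //; exact: summable_cst.
  rewrite Ex_cst; under [X in _ = _ - X]eq_Ex do rewrite mulrAC.
  by rewrite ExZ ?Ex_gauss ?mulr0 ?subr0//; exact: gauss_summable.
have sc : summable gauss (fun z => cut (t * z)).
  apply: summable_cut; first exact: measurable_funM.
  by under eq_fun do rewrite exprMn; apply: summableZ; exact: integrable_gauss_sqr.
have sl : summable gauss (fun z => f (x + t * z) - f x - t * z * f1 x).
  by do ?apply: summableB => //; exact: summable_cst.
rewrite -ExB// -ExZ//; apply: norm_Ex.
- exact: summableB.
- exact: summableZ.
- by move=> z; rewrite -exprMn; exact: tf.
Qed.

Section swap.
Context d (T : measurableType d) (P : probability T R).

(** The counterpart of [gconv_taylor] for a general increment: by independence the first order term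
    vanishes and the second order one sees the law of [U] through its variance. *)
Lemma taylor2_add (S U : T -> R) (v : R) C f f1 f2 : taylor2 C f f1 f2 ->
  measurable_fun setT S -> measurable_fun setT U ->
  independent_RVs P S U -> summable P (fun x => U x ^+ 2) ->
  Ex P U = 0 -> Ex P (fun x => U x ^+ 2) = v ->
  `|Ex P (fun x => f (S x + U x)) - Ex P (fun x => f (S x))
    - v * Ex P (fun x => f2 (S x))| <= C * Ex P (fun x => cut (U x)).
Proof.
move=> [mf mf1 mf2 [M fM] tf] mS mU SU U2 EU EU2.
have sU := summable_sqr mU U2.
have su (g : R -> R) (V : T -> R) : measurable_fun setT g -> (forall x, `|g x| <= M) ->
    measurable_fun setT V -> summable P (fun x => g (V x)).
  by move=> mg gM mV; apply: (@bounded_summable _ _ _ _ _ M) => //; exact: measurableT_comp.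
have sf : summable P (fun x => f (S x)) by apply: su => // x; case: (fM x).
have sf1 : summable P (fun x => f1 (S x)) by apply: su => // x; case: (fM x).
have sf2 : summable P (fun x => f2 (S x)) by apply: su => // x; case: (fM x).
have sfU : summable P (fun x => f (S x + U x)).
  by apply: (su f) => //; [move=> x; case: (fM x)|exact: measurable_funD].
have [s1 E1] : summable P (fun x => U x * f1 (S x)) /\ Ex P (fun x => U x * f1 (S x)) = 0.
  have SU1 : independent_RVs P (fun x => f1 (S x)) U.
    exact: independent_RVs_comp mf1 (@measurable_id _ _ setT) SU.
  have [s1 E1] := independent_RVs_mul SU1 sf1 sU.
  split; first by under eq_fun do rewrite mulrC.
  by under eq_Ex do rewrite mulrC; rewrite [LHS]E1 EU mulr0.
have [s2 E2] : summable P (fun x => U x ^+ 2 * f2 (S x)) /\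
    Ex P (fun x => U x ^+ 2 * f2 (S x)) = v * Ex P (fun x => f2 (S x)).
  have msq : measurable_fun setT (fun t : R => t ^+ 2) by exact: measurable_funX.
  have SU2 : independent_RVs P (fun x => f2 (S x)) (fun x => U x ^+ 2).
    exact: independent_RVs_comp mf2 msq SU.
  have [s1' E1'] := independent_RVs_mul SU2 sf2 U2.
  split; first by under eq_fun do rewrite mulrC.
  by under eq_Ex do rewrite mulrC; rewrite [LHS]E1' EU2 mulrC.
have sB : summable P (fun x => f (S x + U x) - f (S x)) by exact: summableB.
rewrite -E2 -[X in `|X - _|]subr0 -E1 -!ExB//; last exact: summableB.
rewrite -ExZ; last exact: summable_cut.
apply: norm_Ex.
- by do 2 apply: summableB => //.
- by apply: summableZ; exact: summable_cut.
- by move=> x; exact: tf.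
Qed.

(** Summands are replaced one at a time from the last one: the Gaussian ones already
    substituted are absorbed in the test function, which becomes [gconv _ f]. *)
Lemma lindeberg (U : nat -> T -> R) (t C : R) (n : nat) f f1 f2 :
  taylor2 C f f1 f2 ->
  (forall i, measurable_fun setT (U i)) ->
  (forall i, independent_RVs P (fun x => \sum_(j < i) U j x) (U i)) ->
  (forall i, summable P (fun x => U i x ^+ 2)) ->
  (forall i, Ex P (U i) = 0) -> (forall i, Ex P (fun x => U i x ^+ 2) = t ^+ 2) ->
  `|Ex P (fun x => f (\sum_(j < n) U j x)) - gconv (Num.sqrt (n%:R * t ^+ 2)) f 0|
   <= \sum_(j < n) C * (Ex P (fun x => cut (U j x)) + Ex gauss (fun z => cut (t * z))).
Proof.
move=> tf mU iU U2 EU EU2; elim: n f f1 f2 tf => [|n ih] f f1 f2 tf.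
  rewrite big_ord0 mul0r sqrtr0 gconv0; under eq_Ex do rewrite big_ord0.
  by rewrite Ex_cst subrr normr0.
have [mf mf1 mf2 [M fM] _] := tf.
have mS : measurable_fun setT (fun x => \sum_(j < n) U j x) by exact: measurable_sum.
(* The last summand, in Gaussian form, is moved into the test function: the induction hypothesis is
   used at [gconv t f]. *)
have := ih _ _ _ (taylor2_gconv t tf).
rewrite (@gconv_gconv _ _ _ M)//; last by move=> x; case: (fM x).
rewrite sqr_sqrtr; last by apply: mulr_ge0 => //; exact: sqr_ge0.
have -> : n%:R * t ^+ 2 + t ^+ 2 = n.+1%:R * t ^+ 2.
  by rewrite -natr1 mulrDl mul1r.
move=> {}ih.
rewrite [leRHS]big_ord_recr/=; apply: le_trans (lerD ih (le_refl _)).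
have -> : Ex P (fun x => f (\sum_(j < n.+1) U j x)) =
    Ex P (fun x => f (\sum_(j < n) U j x + U n x)).
  by apply: eq_Ex => x; rewrite big_ord_recr.
apply: le_trans (ler_distD (Ex P (fun x => gconv t f (\sum_(j < n) U j x))) _ _) _.
rewrite [leLHS]addrC lerD2l.
have fM0 x : `|f x| <= M by case: (fM x).
have fM2 x : `|f2 x| <= M by case: (fM x).
have sS (g : R -> R) : measurable_fun setT g -> (forall x, `|g x| <= M) ->
    summable P (fun x => g (\sum_(j < n) U j x)).
  by move=> mg gM; apply: (@bounded_summable _ _ _ _ _ M) => //; exact: measurableT_comp.
have sfS := sS _ mf fM0; have sf2S := sS _ mf2 fM2.
have sgS : summable P (fun x => gconv t f (\sum_(j < n) U j x)).
  apply: sS; first exact: measurable_gconv fM0.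
  by move=> x; exact: norm_gconv.
(* [U n] and a Gaussian of variance t^2 produce the same second order term, which cancels in the
   difference. *)
have := taylor2_add tf mS (mU n) (iU n) (U2 n) (EU n) (EU2 n).
have : `|Ex P (fun x => gconv t f (\sum_(j < n) U j x)) -
    Ex P (fun x => f (\sum_(j < n) U j x)) -
    t ^+ 2 * Ex P (fun x => f2 (\sum_(j < n) U j x))| <=
    C * Ex gauss (fun z => cut (t * z)).
  rewrite -ExZ// -!ExB//; [|exact: summableB|exact: summableZ].
  apply: norm_Ex_cst; last by move=> x; apply: (@gconv_taylor _ _ _ f1); exact: tf.
  apply: (summable_measurable (P := P)).
  by apply: summableB; [exact: summableB|exact: summableZ].
rewrite mulrDr; set a := Ex P _; set b := Ex P _; set c := t ^+ 2 * _.
rewrite !ler_norml => /andP[? ?] /andP[? ?]; apply/andP; split; lra.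
Qed.

End swap.
End lindeberg.

Section central_limit.
Context (R : realType).
Local Notation gauss := (@normal_prob R 0 1).

Lemma cvg_inv_sqrtn : (fun n => (Num.sqrt (n%:R : R))^-1) @ \oo --> (0 : R).
Proof.
have h : (fun n => (n%:R : R)^-1) @ \oo --> (0 : R).
  by apply/gtr0_cvgV0; [near=> n; rewrite ltr0n; near: n; exists 1%N|exact: cvgr_idn].
under eq_fun do rewrite -sqrtrV//.
have := cvg_comp _ _ h (@sqrt_continuous R 0).
by rewrite sqrtr0; apply: cvg_trans; apply: near_eq_cvg; near=> n.
Unshelve. all: by end_near. Qed.

(** For n > 0 the integrand is min(U^2, |U|^3 / sqrt n): it is dominated by U^2 and tends to 0
    pointwise, so dominated convergence applies. *)
Lemma cvg_cut d (T : measurableType d) (P : probability T R) (U : T -> R) :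
  measurable_fun setT U -> summable P (fun x => U x ^+ 2) ->
  (fun n => n%:R * Ex P (fun x => cut (U x / Num.sqrt n%:R))) @ \oo --> (0 : R).
Proof.
move=> mU U2.
have scut n : summable P (fun x => cut (U x / Num.sqrt n%:R)).
  apply: summable_cut; first exact: measurable_funM.
  under eq_fun do rewrite exprMn mulrC; exact: summableZ.
pose fn (n : nat) (x : T) : \bar R := (n%:R * cut (U x / Num.sqrt n%:R))%:E.
have mfn n : measurable_fun setT (fn n).
  by apply: measurable_int; exact: summableZ (scut n).
have cutE n x : (0 < n)%N ->
    n%:R * cut (U x / Num.sqrt n%:R) = Num.min (U x ^+ 2) (`|U x| ^+ 3 * (Num.sqrt n%:R)^-1).
  move=> n0; have s0 : 0 < Num.sqrt (n%:R : R) by rewrite sqrtr_gt0 ltr0n.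
  have nE : n%:R = Num.sqrt (n%:R : R) ^+ 2 by rewrite sqr_sqrtr.
  rewrite /cut minr_pMr ?ler0n// {1 3}nE normrM normfV (gtr0_norm s0).
  by congr Num.min; field; rewrite gt_eqF.
have cut_le n x : `|n%:R * cut (U x / Num.sqrt n%:R)| <= U x ^+ 2.
  case: (posnP n) => [->|n0]; first by rewrite mul0r normr0 sqr_ge0.
  by rewrite ger0_norm ?mulr_ge0 ?cut_ge0// cutE// ge_min lexx.
have f0 x : (fun n => n%:R * cut (U x / Num.sqrt n%:R)) @ \oo --> (0 : R).
  apply: (@squeeze_cvgr _ _ _ _ (fun=> 0) (fun n => `|U x| ^+ 3 * (Num.sqrt n%:R)^-1)).
  - near=> n; rewrite mulr_ge0 ?cut_ge0//= cutE ?ge_min ?lexx ?orbT//.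
    by near: n; exists 1%N.
  - exact: cvg_cst.
  - rewrite -[X in _ --> X](mulr0 (`|U x| ^+ 3)); apply: cvgM; first exact: cvg_cst.
    exact: cvg_inv_sqrtn.
have aef : {ae P, forall x, setT x -> fn^~ x @ \oo --> (cst 0%E : T -> \bar R) x}.
  by apply: aeW => x _ /=; apply: cvg_EFin; [exact: nearW|exact: f0].
have aele : {ae P, forall x n, setT x -> (`|fn n x| <= (U x ^+ 2)%:E)%E}.
  by apply: aeW => x n _; rewrite lee_fin.
have [_ _] := dominated_convergence measurableT mfn (measurable_cst _) aef U2 aele.
rewrite integral0 => /fine_cvg; apply: cvg_trans; apply: near_eq_cvg.
by apply: nearW => n; rewrite -ExZ.
Unshelve. all: by end_near. Qed.

(** The replacement errors sum to C n (E cut(U_0 / sqrt n) + E cut(sqrt v z / sqrt n)), and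
    [cvg_cut] applies to both terms. The hypothesis on [cut] is the form in which identical
    distribution enters. *)
Lemma clt_taylor2 d (T : measurableType d) (P : probability T R) (U : nat -> T -> R)
    (v C : R) f f1 f2 : taylor2 C f f1 f2 -> 0 <= v ->
  (forall i, measurable_fun setT (U i)) ->
  (forall i, independent_RVs P (fun x => \sum_(j < i) U j x) (U i)) ->
  (forall i, summable P (fun x => U i x ^+ 2)) ->
  (forall i, Ex P (U i) = 0) -> (forall i, Ex P (fun x => U i x ^+ 2) = v) ->
  (forall i r, Ex P (fun x => cut (U i x * r)) = Ex P (fun x => cut (U 0 x * r))) ->
  (fun n => Ex P (fun x => f ((\sum_(j < n) U j x) / Num.sqrt n%:R))) @ \oo -->
  gconv (Num.sqrt v) f 0.
Proof.
move=> tf v0 mU iU U2 EU EU2 lawU.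
apply/cvgrPdist_le => e e0.
pose r n := n%:R * Ex P (fun x => cut (U 0 x / Num.sqrt n%:R)) +
  n%:R * Ex gauss (fun z => cut (Num.sqrt v * z / Num.sqrt n%:R)).
have r0 : r @ \oo --> 0.
  rewrite -[X in _ --> X](addr0 0); apply: cvgD; first exact: cvg_cut.
  apply: (@cvg_cut _ _ gauss (fun z => Num.sqrt v * z)); first exact: measurable_funM.
  by under eq_fun do rewrite exprMn; apply: summableZ; exact: integrable_gauss_sqr.
have Cr0 : (fun n => C * r n) @ \oo --> 0.
  by rewrite -[X in _ --> X](mulr0 C); apply: cvgM => //; exact: cvg_cst.
have : \forall n \near \oo, C * r n <= e.
  move/cvgrPdist_le : Cr0 => /(_ _ e0); apply: filterS => n.
  by rewrite sub0r normrN; apply: le_trans; exact: ler_norm.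
apply: filter_app; near=> n => rn; apply: le_trans rn.
have n0 : (0 < n)%N by near: n; exists 1%N.
have s0 : 0 < Num.sqrt (n%:R : R) by rewrite sqrtr_gt0 ltr0n.
pose V i x := U i x / Num.sqrt (n%:R : R).
pose t := Num.sqrt v / Num.sqrt (n%:R : R).
have tE : n%:R * t ^+ 2 = v.
  by rewrite /t expr_div_n !sqr_sqrtr ?ler0n// mulrC divfK// gt_eqF// ltr0n.
have mV i : measurable_fun setT (V i) by exact: measurable_funM.
have mscal : measurable_fun setT (fun x : R => x / Num.sqrt (n%:R : R)) by exact: measurable_funM.
have iV i : independent_RVs P (fun x => \sum_(j < i) V j x) (V i).
  under eq_fun do rewrite /V -mulr_suml.
  exact: (independent_RVs_comp mscal mscal (iU i)).
have V2 i : summable P (fun x => V i x ^+ 2).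
  by under eq_fun do rewrite exprMn mulrC; exact: summableZ.
have EV i : Ex P (V i) = 0.
  rewrite /V; under eq_Ex do rewrite mulrC.
  by rewrite ExZ ?EU ?mulr0//; exact: summable_sqr.
have EV2 i : Ex P (fun x => V i x ^+ 2) = t ^+ 2.
  under eq_Ex do rewrite exprMn mulrC.
  by rewrite ExZ// EU2 /t exprMn sqr_sqrtr// mulrC.
have := lindeberg n tf mV iV V2 EV EV2.
rewrite tE distrC; under eq_Ex do rewrite /V -mulr_suml.
move=> /le_trans; apply.
rewrite -mulr_sumr [X in C * X](_ : _ = r n)//.
rewrite (eq_bigr (fun=> Ex P (fun x => cut (U 0 x / Num.sqrt n%:R)) +
  Ex gauss (fun z => cut (Num.sqrt v * z / Num.sqrt n%:R)))); last first.
  move=> j _; congr (_ + _); first exact: lawU.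
  by apply: eq_Ex => z; rewrite /t mulrAC.
by rewrite sumr_const card_ord /r -mulrDr mulr_natl.
Unshelve. all: by end_near. Qed.

End central_limit.

(** * Independence of blocks *)

Section block_independence.
Context d (T : measurableType d) (R : realType) (P : probability T R).
Local Open Scope ereal_scope.

(** For fixed [B], both sides are finite measures in [A] that agree on a pi-system containing the
    whole space. *)
Lemma independent_sigmal (C : set (set T)) (B : set T) :
  setI_closed C -> C setT -> C `<=` measurable -> measurable B ->
  (forall A, C A -> P (A `&` B) = P A * P B) ->
  forall A, <<s C >> A -> P (A `&` B) = P A * P B.
Proof.
move=> CI CT mC mB CB A sA.
pose r : {nonneg R} := NngNum (fine_ge0 (measure_ge0 P B)).
have rE : r%:num%:E = P B by rewrite /= fineK// fin_num_measure.
rewrite muleC -rE; change (mrestr P mB A = mscale r P A).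
apply: (g_sigma_algebra_measure_unique C _ (fun=> setT)) => //.
- by rewrite bigcup_const.
- move=> X CX; transitivity (P X * P B); first exact: CB.
  by rewrite -rE muleC.
- move=> k; apply: (@le_lt_trans _ _ 1); last exact: ltry.
  by apply: probability_le1; exact: measurableI.
Qed.

(** [independent_sigmal] extends one argument at a time, first to the sigma-algebra of [D], then to
    that of [C]. *)
Lemma independent_sigma (C D : set (set T)) :
  setI_closed C -> C setT -> C `<=` measurable ->
  setI_closed D -> D setT -> D `<=` measurable ->
  (forall A B, C A -> D B -> P (A `&` B) = P A * P B) ->
  forall A B, <<s C >> A -> <<s D >> B -> P (A `&` B) = P A * P B.
Proof.
move=> CI CT mC DI DT mD CD A B sA sB.
have mS (E : set (set T)) : E `<=` measurable -> <<s E >> `<=` measurable.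
  by move=> mE; apply: smallest_sub => //; exact: sigma_algebra_measurable.
apply: (independent_sigmal CI) => //; first exact: mS sB.
move=> X CX; rewrite setIC muleC.
apply: (independent_sigmal DI) => //; first exact: mC.
by move=> Y DY; rewrite setIC muleC; exact: CD.
Qed.

Context (I : choiceType) (F : I -> set (set T)).
Hypothesis F_setT : forall i, F i setT.
Hypothesis F_setI : forall i, setI_closed (F i).
Hypothesis F_measurable : forall i, F i `<=` measurable.
Hypothesis F_indep : mutually_independent P F.

(** A pi-system generating the sigma-algebra of the block [J]; [mutually_independent] evaluates its
    members directly. *)
Definition cylinder (J : {fset I}) : set (set T) :=
  [set \bigcap_(i in [set` J]) A i | A in [set A | forall i, i \in J -> F i (A i)]].

Lemma cylinderT J : cylinder J setT.
Proof.
exists (fun=> setT); last by rewrite bigcapT.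
by move=> i _.
Qed.

Lemma cylinderI J : setI_closed (cylinder J).
Proof.
move=> _ _ [A FA <-] [B FB <-]; exists (fun i => A i `&` B i); last by rewrite bigcapI.
by move=> i iJ; apply: F_setI; [exact: FA|exact: FB].
Qed.

Lemma cylinder_measurable J : cylinder J `<=` measurable.
Proof.
move=> _ [A FA <-]; apply: fin_bigcap_measurable; first exact: finite_fset.
by move=> i /= iJ; apply: (F_measurable (i := i)); exact: FA.
Qed.

Lemma sub_cylinder J i : i \in J -> F i `<=` cylinder J.
Proof.
move=> iJ A FA; exists (fun j => if j == i then A else setT).
  by move=> j jJ; case: eqP => [->|].
apply/seteqP; split => x; first by move=> /(_ i iJ); rewrite eqxx.
by move=> Ax j _; case: eqP.
Qed.

Lemma cylinder_independent (J L : {fset I}) d1 d2 (T1 : measurableType d1)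
    (T2 : measurableType d2) (f : T -> T1) (g : T -> T2) :
  [disjoint J & L]%fset ->
  measurable_fun (setT : set (g_sigma_algebraType (cylinder J))) f ->
  measurable_fun (setT : set (g_sigma_algebraType (cylinder L))) g ->
  independent_RVs P f g.
Proof.
move=> JL mf mg A B mA mB.
apply: (independent_sigma (@cylinderI J) (cylinderT J) (@cylinder_measurable J)
  (@cylinderI L) (cylinderT L) (@cylinder_measurable L)).
- move=> _ _ [A' FA <-] [B' FB <-].
  (* Disjointness lets the two families be glued into one, to which mutual independence over the
     union applies. *)
  pose C i := if i \in J then A' i else B' i.
  have CJ : \bigcap_(i in [set` J]) A' i = \bigcap_(i in [set` J]) C i.
    by apply: eq_bigcapr => i /= iJ; rewrite /C iJ.
  have CL : \bigcap_(i in [set` L]) B' i = \bigcap_(i in [set` L]) C i.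
    apply: eq_bigcapr => i /= iL; rewrite /C; case: ifPn => // iJ.
    by move/fdisjointP : JL => /(_ _ iJ); rewrite iL.
  have FCJ i : i \in J -> F i (C i) by move=> iJ; rewrite /C iJ; exact: FA.
  have FCL i : i \in L -> F i (C i).
    move=> iL; rewrite /C; case: ifPn => iJ; first exact: FA.
    exact: FB.
  have FCU i : i \in (J `|` L)%fset -> F i (C i).
    by rewrite inE => /orP[/FCJ|/FCL].
  rewrite CJ CL -bigcap_setU (_ : [set` J] `|` [set` L] = [set` (J `|` L)%fset]); last first.
    by apply/seteqP; split => x /=; rewrite inE => /orP.
  rewrite !F_indep//=.
  rewrite -big_cat/=; apply: perm_big; apply: uniq_perm => //.
    rewrite cat_uniq !fset_uniq andbT/=; apply/hasPn => i iL.
    by apply/negP => iJ; move/fdisjointP : JL => /(_ _ iJ); rewrite iL.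
  by move=> i; rewrite mem_cat inE.
- by rewrite -[X in <<s _ >> X]setTI; exact: mf.
- by rewrite -[X in <<s _ >> X]setTI; exact: mg.
Qed.

End block_independence.

(** * Approximation by products of B-splines *)

Section spline.
Context (R : realType).

Definition tame (f : R -> R) := exists C f1 f2, taylor2 C f f1 f2.

Lemma tameB f g : tame f -> tame g -> tame (fun x => f x - g x).
Proof.
move=> [C [f1 [f2 [mf mf1 mf2 [M fM] tf]]]] [D [g1 [g2 [mg mg1 mg2 [N gN] tg]]]].
exists (C + D), (fun x => f1 x - g1 x), (fun x => f2 x - g2 x); split.
1-3: exact: measurable_funB.
- exists (M + N) => x; have [? ? ?] := fM x; have [? ? ?] := gN x.
  by split; apply: (le_trans (ler_normB _ _)); exact: lerD.
- move=> x t; have := tf x t; have := tg x t; rewrite mulrDl.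
  rewrite !ler_norml => /andP[? ?] /andP[? ?]; apply/andP; split; lra.
Qed.

Lemma tame_affine (a b : R) f : tame f -> tame (fun x => f (a * x + b)).
Proof.
move=> [C [f1 [f2 [mf mf1 mf2 [M fM] tf]]]].
have maff : measurable_fun setT (fun x : R => a * x + b).
  by apply: measurable_funD => //; exact: measurable_funM.
have C0 : 0 <= C.
  have := tf 0 1; rewrite /cut expr1n normr1 expr1n /Num.min ltxx mulr1.
  by apply: le_trans.
have M0 : 0 <= M by have [/(le_trans (normr_ge0 _))] := fM 0.
(* The factor dominates both a^2 and |a|^3, hence cut(a t) <= (a^2 + |a|^3) cut(t). *)
exists (C * (a ^+ 2 + `|a| ^+ 3)), (fun x => a * f1 (a * x + b)),
  (fun x => a ^+ 2 * f2 (a * x + b)); split.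
- exact: measurableT_comp.
- by apply: measurable_funM => //; exact: measurableT_comp.
- by apply: measurable_funM => //; exact: measurableT_comp.
- exists ((1 + `|a| + a ^+ 2) * M) => x; have [h0 h1 h2] := fM (a * x + b).
  have a0 := normr_ge0 a; have a20 := sqr_ge0 a.
  split; first by apply: (le_trans h0); nra.
  + by rewrite normrM; apply: (le_trans (ler_wpM2l a0 h1)); nra.
  + by rewrite normrM (ger0_norm a20); apply: (le_trans (ler_wpM2l a20 h2)); nra.
- move=> x t; have := tf (a * x + b) (a * t).
  rewrite (_ : a * x + b + a * t = a * (x + t) + b); last by ring.
  rewrite (_ : a * t * f1 _ = t * (a * f1 (a * x + b))); last by ring.
  rewrite (_ : (a * t) ^+ 2 * f2 _ = t ^+ 2 * (a ^+ 2 * f2 (a * x + b))); last by ring.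
  move=> /le_trans; apply; rewrite -mulrA ler_wpM2l// /cut normrM !exprMn.
  rewrite minr_pMr; last by rewrite addr_ge0 ?sqr_ge0 ?exprn_ge0.
  rewrite le_min !ge_min; apply/andP; split; apply/orP; [left|right].
    by rewrite mulrDl lerDl mulr_ge0 ?sqr_ge0// exprn_ge0.
  by rewrite mulrDl lerDr mulr_ge0 ?sqr_ge0// exprn_ge0.
Qed.

Let pos (x : R) : R := Num.max x 0.

Let posP x : (pos x = x /\ 0 <= x) \/ (pos x = 0 /\ x <= 0).
Proof. by rewrite /pos; have [h|h] := leP x 0; [right|left; split => //; exact: ltW]. Qed.

Let mpos (c : R) n : measurable_fun setT (fun x : R => pos (x - c) ^+ n).
Proof.
apply: measurable_funX; apply: measurable_maxr; last exact: measurable_cst.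
exact: measurable_funB.
Qed.

Let mpos0 n : measurable_fun setT (fun x : R => pos x ^+ n).
Proof. by have := mpos 0 n; under eq_fun do rewrite subr0. Qed.

(** The truncated cube is C^2 and its second derivative 6 pos x is 6-Lipschitz, so the Taylor
    remainder is at most |t|^3. *)
Let pos3 x t : `|pos (x + t) ^+ 3 - pos x ^+ 3 - t * (3 * pos x ^+ 2) - t ^+ 2 * (3 * pos x)|
  <= `|t| ^+ 3.
Proof.
have [[-> x0]|[-> x0]] := posP x; have [[-> xt]|[-> xt]] := posP (x + t).
- by rewrite (_ : _ - _ = t ^+ 3) ?normrX//; ring.
- have t0 : t <= 0 by lra.
  have s0 : 0 <= - (x + t) by lra.
  have s1 : 0 <= (- (x + t)) ^+ 3 by exact: exprn_ge0.
  have s2 : (- (x + t)) ^+ 3 <= (- t) ^+ 3.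
    by rewrite lerXn2r// ?nnegrE ?oppr_ge0//; lra.
  rewrite (ler0_norm t0) ler_norml.
  rewrite (_ : _ - _ = (- (x + t)) ^+ 3 - (- t) ^+ 3); last by ring.
  by apply/andP; split; lra.
- have t0 : 0 <= t by lra.
  have s1 : 0 <= (x + t) ^+ 3 by exact: exprn_ge0.
  have s2 : (x + t) ^+ 3 <= t ^+ 3.
    by rewrite lerXn2r// ?nnegrE//; lra.
  rewrite (ger0_norm t0) ler_norml.
  rewrite (_ : _ - _ = (x + t) ^+ 3); last by ring.
  by apply/andP; split; lra.
- by rewrite !expr0n/= !mulr0 !subr0 normr0 exprn_ge0.
Qed.

(** Third differences of truncated powers, so that [spline_step] is a C^2 function
    going from 0 (before 0) to 1 (after 3). *)
Let comb (g : R -> R) (x : R) : R := g x - 3 * g (x - 1) + 3 * g (x - 2) - g (x - 3).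

Definition spline_step (x : R) : R := comb (fun x => pos x ^+ 3) x / 6.
(** The derivative of [spline_step] and, in [step2], half its second derivative, as [taylor2]
    expects. *)
Let step1 (x : R) : R := comb (fun x => pos x ^+ 2) x / 2.
Let step2 (x : R) : R := comb (fun x => pos x) x / 2.

Let posE x c : pos (x - c) = if c <= x then x - c else 0.
Proof.
by case: leP => h; [apply/max_idPl; rewrite subr_ge0|
  apply/max_idPr; rewrite subr_le0 ltW].
Qed.

Let pos0E x : pos x = if 0 <= x then x else 0.
Proof. by rewrite -[in LHS](subr0 x) posE subr0. Qed.

Let step_bound x : [/\ `|spline_step x| <= 10, `|step1 x| <= 10 & `|step2 x| <= 10].
Proof.
rewrite /spline_step /step1 /step2 /comb !posE !pos0E.
have [h0|h0] := leP 0 x; have [h1|h1] := leP 1 x; have [h2|h2] := leP 2 x;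
  have [h3|h3] := leP 3 x; try (exfalso; lra);
  by split; rewrite ler_norml; apply/andP; split; nra.
Qed.

Lemma tame_spline_step : tame spline_step.
Proof.
(* The cubic bound has constant (1 + 3 + 3 + 1) / 6 <= 2, and gives the quadratic one for |t| <= 1.
   For |t| > 1, bounding the four terms separately by [step_bound] gives 20 + 10 t^2 + 10 t^2 <= 40
   t^2. *)
exists 40, step1, step2; split.
- apply: measurable_funM => //; apply: measurable_funB; last exact: mpos.
  apply: measurable_funD; last by apply: measurable_funM => //; exact: mpos.
  apply: measurable_funB; last by apply: measurable_funM => //; exact: mpos.
  exact: mpos0.
- apply: measurable_funM => //; apply: measurable_funB; last exact: mpos.
  apply: measurable_funD; last by apply: measurable_funM => //; exact: mpos.
  apply: measurable_funB; last by apply: measurable_funM => //; exact: mpos.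
  exact: mpos0.
- apply: measurable_funM => //; apply: measurable_funB; last exact: (mpos _ 1).
  apply: measurable_funD; last by apply: measurable_funM => //; exact: (mpos _ 1).
  apply: measurable_funB; last by apply: measurable_funM => //; exact: (mpos _ 1).
  exact: (mpos0 1).
- by exists 10; exact: step_bound.
- move=> x t.
  have t1 : `|spline_step (x + t) - spline_step x - t * step1 x - t ^+ 2 * step2 x|
      <= 2 * `|t| ^+ 3.
    have := pos3 x t; have := pos3 (x - 1) t; have := pos3 (x - 2) t; have := pos3 (x - 3) t.
    rewrite /spline_step /step1 /step2 /comb !(addrAC x (- _) t).
    rewrite !ler_norml => /andP[? ?] /andP[? ?] /andP[? ?] /andP[? ?].
    by apply/andP; split; lra.
  rewrite /cut minr_pMr// le_min; apply/andP; split; last first.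
    by apply: (le_trans t1); rewrite ler_wpM2r ?exprn_ge0//; lra.
  have [th|th] := leP `|t| 1.
    apply: (le_trans t1); rewrite -[t ^+ 2]real_normK ?num_real// exprS.
    by have := normr_ge0 t; have := sqr_ge0 `|t|; nra.
  have [a0 a1 a2] := step_bound x; have [b0 _ _] := step_bound (x + t).
  have t2 : 1 <= t ^+ 2 by rewrite -[t ^+ 2]real_normK ?num_real//; nra.
  have t3 : `|t * step1 x| <= 10 * t ^+ 2.
    rewrite normrM -[t ^+ 2]real_normK ?num_real// expr2 mulrCA ler_wpM2l//; lra.
  have t4 : `|t ^+ 2 * step2 x| <= 10 * t ^+ 2.
    by rewrite normrM (ger0_norm (sqr_ge0 t)) mulrC ler_wpM2r ?sqr_ge0.
  move: a0 b0 t3 t4; rewrite !ler_norml => /andP[? ?] /andP[? ?] /andP[? ?] /andP[? ?].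
  by apply/andP; split; lra.
Qed.

Lemma spline_step_eq0 x : x <= 0 -> spline_step x = 0.
Proof.
move=> x0; rewrite /spline_step /comb !posE pos0E.
have [h0|h0] := leP 0 x; have [h1|h1] := leP 1 x; have [h2|h2] := leP 2 x;
  have [h3|h3] := leP 3 x; try (exfalso; lra); nra.
Qed.

Lemma spline_step_eq1 x : 3 <= x -> spline_step x = 1.
Proof.
move=> x0; rewrite /spline_step /comb !posE pos0E.
have [h0|h0] := leP 0 x; have [h1|h1] := leP 1 x; have [h2|h2] := leP 2 x;
  have [h3|h3] := leP 3 x; try (exfalso; lra).
by field.
Qed.

Let step_01 x : 0 <= x <= 1 -> spline_step x = x ^+ 3 / 6.
Proof.
move=> /andP[? ?]; rewrite /spline_step /comb !posE pos0E.
have [h0|h0] := leP 0 x; have [h1|h1] := leP 1 x; have [h2|h2] := leP 2 x;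
  have [h3|h3] := leP 3 x; try (exfalso; lra); try by field.
by rewrite (_ : x = 1); [field|lra].
Qed.

Let step_12 x : 1 <= x <= 2 ->
  spline_step x = (1 + 3 * (x - 1) + 3 * (x - 1) ^+ 2 - 2 * (x - 1) ^+ 3) / 6.
Proof.
move=> /andP[? ?]; rewrite /spline_step /comb !posE pos0E.
have [h0|h0] := leP 0 x; have [h1|h1] := leP 1 x; have [h2|h2] := leP 2 x;
  have [h3|h3] := leP 3 x; try (exfalso; lra); try by field.
by rewrite (_ : x = 2); [field|lra].
Qed.

Let step_23 x : 2 <= x <= 3 -> spline_step x = 1 - (3 - x) ^+ 3 / 6.
Proof.
move=> /andP[? ?]; rewrite /spline_step /comb !posE pos0E.
have [h0|h0] := leP 0 x; have [h1|h1] := leP 1 x; have [h2|h2] := leP 2 x;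
  have [h3|h3] := leP 3 x; try (exfalso; lra); try by field.
by rewrite (_ : x = 3); [field|lra].
Qed.

(** These inequalities make the range and sign checks below linear in u, u^2 and u^3; 3 u - 2 is the
    tangent of the cube at 1. *)
Let cube01 (u : R) : 0 <= u <= 1 ->
  [/\ 0 <= u ^+ 3, u ^+ 3 <= u ^+ 2, u ^+ 2 <= u, 3 * u - 2 <= u ^+ 3 &
    2 * u ^+ 2 - u <= u ^+ 3].
Proof.
move=> /andP[u0 u1]; have u2 := sqr_ge0 u; have v2 := sqr_ge0 (u - 1).
have w1 : 0 <= u * (u - 1) ^+ 2 by exact: mulr_ge0.
have w2 : 0 <= (u + 2) * (u - 1) ^+ 2 by apply: mulr_ge0 => //; lra.
have w3 : 0 <= (1 - u) * u ^+ 2 by apply: mulr_ge0 => //; lra.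
have w4 : 0 <= (1 - u) * u by apply: mulr_ge0 => //; lra.
split; [exact: exprn_ge0|lra..].
Qed.

Lemma spline_step_itv x : 0 <= spline_step x <= 1.
Proof.
have [h0|h0] := leP x 0; first by rewrite spline_step_eq0// lexx ler01.
have [h3|h3] := leP 3 x; first by rewrite spline_step_eq1// ler01 lexx.
have [h1|h1] := leP x 1.
  have x01 : 0 <= x <= 1 by apply/andP; split; lra.
  rewrite step_01//; have [? ? ? ? ?] := cube01 x01; apply/andP; split; lra.
have [h2|h2] := leP x 2.
  have x01 : 0 <= x - 1 <= 1 by apply/andP; split; lra.
  rewrite step_12; last by apply/andP; split; lra.
  by have [? ? ? ? ?] := cube01 x01; move: x01 => /andP[? ?]; apply/andP; split; lra.
have x01 : 0 <= 3 - x <= 1 by apply/andP; split; lra.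
rewrite step_23; last by apply/andP; split; lra.
by have [? ? ? ? ?] := cube01 x01; move: x01 => /andP[? ?]; apply/andP; split; lra.
Qed.

(** Cubic B-spline with support [[0, 4]]. *)
Definition bspline (x : R) : R := spline_step x - spline_step (x - 1).

(** Up to 1 or beyond 3 one of the two steps is saturated; in between, consecutive polynomial pieces
    are compared. *)
Lemma bspline_ge0 x : 0 <= bspline x.
Proof.
rewrite /bspline subr_ge0.
have [h1|h1] := leP x 1.
  by rewrite [leLHS]spline_step_eq0 ?subr_le0//; have /andP[] := spline_step_itv x.
have [h3|h3] := leP 3 x.
  by rewrite [leRHS]spline_step_eq1//; have /andP[] := spline_step_itv (x - 1).
have [h2|h2] := leP x 2.
  have x01 : 0 <= x - 1 <= 1 by apply/andP; split; lra.
  rewrite step_01// step_12; last by apply/andP; split; lra.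
  have [? ? ? ? ?] := cube01 x01; move: x01 => /andP[? ?]; lra.
have x01 : 0 <= x - 2 <= 1 by apply/andP; split; lra.
rewrite step_12 ?step_23; [|apply/andP; split; lra..].
have [? ? ? ? ?] := cube01 x01.
have -> : 3 - x = 1 - (x - 2) by ring.
have -> : x - 1 - 1 = x - 2 by ring.
have -> : (1 - (x - 2)) ^+ 3 = 1 - 3 * (x - 2) + 3 * (x - 2) ^+ 2 - (x - 2) ^+ 3 by ring.
move: x01 => /andP[? ?]; lra.
Qed.

Lemma bspline_eq0 x : x <= 0 \/ 4 <= x -> bspline x = 0.
Proof.
rewrite /bspline => -[x0|x4].
  by rewrite !spline_step_eq0 ?subrr//; lra.
by rewrite !spline_step_eq1 ?subrr//; lra.
Qed.

(** The sum telescopes. It equals 1 for 3 <= x <= N: a partition of unity on that range. *)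
Lemma sum_bspline N x : \sum_(i < N) bspline (x - i%:R) = spline_step x - spline_step (x - N%:R).
Proof.
elim: N => [|N ih]; first by rewrite big_ord0 subr0 subrr.
rewrite big_ord_recr/= ih /bspline.
have -> : x - N%:R - 1 = x - N.+1%:R by rewrite -natr1; ring.
by ring.
Qed.

Lemma tame_bspline (a b : R) : tame (fun x => bspline (a * x + b)).
Proof.
apply: (tame_affine a b); apply: tameB; first exact: tame_spline_step.
have := tame_affine 1 (- 1) tame_spline_step.
by under eq_fun do rewrite mul1r.
Qed.

End spline.

Section grid.
Context (R : realType) (K : nat).

(** Values of [f] at grid points are weighted by tensor products of B-splines. The weights are
    nonnegative with sum at most 1, which gives the global bound F, and sum exactly 1 on the box. *)
Lemma grid_approximation (f : 'cV[R]_K -> R) (F M r e : R) :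
  0 <= M -> 0 < r -> (forall v, `|f v| <= F) ->
  (forall v u : 'cV[R]_K, (forall k, `|v k 0| <= M) ->
    (forall k, `|v k 0 - u k 0| <= r) -> `|f v - f u| <= e) ->
  exists N (a : {ffun 'I_K -> 'I_N} -> R) (b : 'I_N -> R -> R),
    [/\ forall i, tame (b i),
      forall v : 'cV[R]_K, `|\sum_phi a phi * \prod_k b (phi k) (v k 0)| <= F &
      forall v : 'cV[R]_K, (forall k, `|v k 0| <= M) ->
        `|f v - \sum_phi a phi * \prod_k b (phi k) (v k 0)| <= e].
Proof.
(* Supports have length 4 h = 2 r, so their points are within r of the center [pt]. The offset L
   sends [-M, M] to [3, 2 M / h + 3] on the spline scale, and N exceeds the right end. *)
move=> M0 r0 fF fe; pose h := r / 2.
have h0 : 0 < h by rewrite divr_gt0.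
pose L := M + 3 * h.
pose N := Num.bound (2 * M / h + 3).
pose b (i : 'I_N) (x : R) := bspline (h^-1 * x + (L / h - i%:R)).
pose pt (phi : {ffun 'I_K -> 'I_N}) : 'cV[R]_K := \col_k (h * (phi k)%:R - L + r).
have b0 i x : 0 <= b i x by exact: bspline_ge0.
have sumb x : \sum_i b i x = spline_step (h^-1 * x + L / h) - spline_step (h^-1 * x + L / h - N%:R).
  by rewrite -sum_bspline; apply: eq_bigr => i _; rewrite /b addrA.
have pb0 phi (v : 'cV[R]_K) : 0 <= \prod_k b (phi k) (v k 0) by exact: prodr_ge0.
have sump (v : 'cV[R]_K) : \sum_(phi : {ffun 'I_K -> 'I_N}) \prod_k b (phi k) (v k 0) =
    \prod_k \sum_i b i (v k 0) by rewrite bigA_distr_bigA.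
have F0 : 0 <= F by apply: le_trans (fF 0).
exists N, (fun phi => f (pt phi)), b; split.
- by move=> i; exact: tame_bspline.
- move=> v; apply: (le_trans (ler_norm_sum _ _ _)).
  apply: (@le_trans _ _ (\sum_(phi : {ffun 'I_K -> 'I_N}) F * \prod_k b (phi k) (v k 0))).
    by apply: ler_sum => phi _; rewrite normrM (ger0_norm (pb0 _ _)) ler_wpM2r.
  rewrite -mulr_sumr sump -[leRHS]mulr1 ler_wpM2l//.
  apply: prodr_ile1 => k _; rewrite sumr_ge0//= sumb.
  have /andP[? ?] := spline_step_itv (h^-1 * v k 0 + L / h).
  by have /andP[? ?] := spline_step_itv (h^-1 * v k 0 + L / h - N%:R); lra.
- move=> v vM.
  have vM' k : - M <= v k 0 <= M by rewrite -ler_norml.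
  have sum1 : \sum_(phi : {ffun 'I_K -> 'I_N}) \prod_k b (phi k) (v k 0) = 1.
    rewrite sump big1// => k _; rewrite sumb; have /andP[v1 v2] := vM' k.
    have -> : h^-1 * v k 0 + L / h = (v k 0 + M) / h + 3 by rewrite /L; field; rewrite gt_eqF.
    have v0 : 0 <= (v k 0 + M) / h by rewrite divr_ge0 ?(ltW h0)//; lra.
    have vN : (v k 0 + M) / h + 3 < N%:R.
      apply: (@le_lt_trans _ _ (2 * M / h + 3)).
        by rewrite lerD2r ler_wpM2r ?invr_ge0 ?(ltW h0)//; lra.
      by apply: archi_boundP; rewrite addr_ge0// divr_ge0 ?(ltW h0)// mulr_ge0.
    rewrite [X in X - _]spline_step_eq1 ?spline_step_eq0 ?subr0//; lra.
  have e0 : 0 <= e by apply: le_trans (fe v v vM _) => // k; rewrite subrr normr0 ltW.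
  rewrite -[f v]mulr1 -[X in f v * X]sum1 mulr_sumr -sumrB.
  apply: (le_trans (ler_norm_sum _ _ _)).
  rewrite -[leRHS]mulr1 -[X in _ <= _ * X]sum1 mulr_sumr.
  apply: ler_sum => phi _; rewrite -mulrBl normrM (ger0_norm (pb0 _ _)).
  (* A nonzero weight forces every coordinate of [v] into the support centered at [pt phi], hence
     within r of it. *)
  have [->|] := eqVneq (\prod_k b (phi k) (v k 0)) 0; first by rewrite !mulr0.
  move=> /prodf_neq0 bn0; rewrite ler_wpM2r//; apply: fe => // k.
  rewrite mxE.
  have := bn0 k isT; apply: contraNle => far.
  rewrite /b; apply/eqP; apply: bspline_eq0.
  have hE : h * (h^-1 * v k 0 + (L / h - (phi k)%:R)) = v k 0 + L - h * (phi k)%:R.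
    by field; rewrite gt_eqF.
  have rE : r = 2 * h by rewrite /h; field.
  move: far; rewrite ltNge ler_norml negb_and -!ltNge => /orP[far|far]; [left|right].
    by rewrite -(ler_pM2l h0) hE mulr0; lra.
  by rewrite -(ler_pM2l h0) hE; lra.
Qed.

End grid.

(** * Random vectors *)

Section borel_matrices.
Context (R : realType).

Lemma measurable_continuous_mx m n (f : 'M[R]_(m, n) -> R) :
  continuous f -> measurable_fun setT f.
Proof.
move=> /continuousP cf; apply: (measurability _ (RGenOpens.measurableE R)).
move=> _ [_ [a [b ->] <-]]; rewrite setTI; apply: sub_sigma_algebra.
exact/cf/interval_open.
Qed.

Lemma measurable_continuous_mxmx m n p q (f : 'M[R]_(m, n) -> 'M[R]_(p, q)) :
  continuous f -> measurable_fun setT f.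
Proof.
move=> /continuousP cf; apply: (@measurability _ _ 'M[R]_(m, n) 'M[R]_(p, q) setT f (@open 'M[R]_(p, q))) => //.
move=> _ [A oA <-]; rewrite setTI; apply: sub_sigma_algebra; exact: cf.
Qed.

Lemma measurable_coord m n i j :
  measurable_fun setT (fun A : 'M[R]_(m, n) => A i j).
Proof. by apply: measurable_continuous_mx; exact: coord_continuous. Qed.

Lemma rat_approximation (x c : R) : 0 < c -> exists q : rat, `|x - ratr q| < c.
Proof.
move=> c0; have : x - c < x + c by lra.
move=> /rat_in_itvoo[q]; rewrite in_itv/= => /andP[? ?]; exists q.
by rewrite ltr_norml; apply/andP; split; lra.
Qed.

(** Every open set is a countable union of balls with rational center and radius, and the preimage
    of such a ball is a finite intersection of coordinate conditions. *)
Lemma measurable_mx d (T : measurableType d) m n (f : T -> 'M[R]_(m, n)) :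
  (forall i j, measurable_fun setT (fun x => f x i j)) -> measurable_fun setT f.
Proof.
move=> mf; apply: (@measurability _ _ T 'M[R]_(m, n) setT f (@open 'M[R]_(m, n))) => //.
move=> _ [A oA <-]; rewrite setTI.
pose bx (p : 'M[rat]_(m, n) * nat) := ball (map_mx ratr p.1 : 'M[R]_(m, n)) p.2.+1%:R^-1.
have -> : A = \bigcup_(p in setT) (if `[< bx p `<=` A >] then bx p else set0).
  apply/seteqP; split => [M AM|M [p _]]; last first.
    by case: asboolP => // pA Mp; exact: pA.
  have := oA; rewrite openE => /(_ _ AM)/nbhs_ballP[e e0 eA].
  (* A ball of radius 1 / (k + 1) around a rational point that close to [M] stays within 2 / (k + 1)
     of [M]. *)
  have [k ke] : exists k : nat, 2 / k.+1%:R < e.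
    have e2 : 0 <= 2 / e by rewrite divr_ge0// ltW.
    exists (Num.bound (2 / e)); rewrite ltr_pdivrMr ?ltr0n//.
    have := archi_boundP e2; rewrite ltr_pdivrMr// => /lt_le_trans; apply.
    by rewrite mulrC ler_wpM2l ?(ltW e0)// ler_nat.
  have k0 : 0 < k.+1%:R^-1 :> R by rewrite invr_gt0.
  have hq i j := rat_approximation (M i j) k0.
  pose q : 'M[rat]_(m, n) := \matrix_(i, j) sval (cid (hq i j)).
  have Mq : bx (q, k) M.
    split => //= i j; rewrite /ball/= !mxE distrC; exact: (svalP (cid (hq i j))).
  exists (q, k) => //; case: asboolP => // qA; exfalso; apply: qA => N qN.
  apply: eA; apply: (le_ball (ltW ke)).
  rewrite (_ : 2 / _ = k.+1%:R^-1 + k.+1%:R^-1); last by rewrite mulrDl !mul1r.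
  by apply: ball_triangle qN; exact: ball_sym.
rewrite preimage_bigcup; apply: countable_bigcupT_measurable; first exact: countableP.
move=> p; case: asboolP => _; last by rewrite preimage_set0.
rewrite (_ : _ @^-1` _ = \bigcap_(i in setT) \bigcap_(j in setT)
  [set x | `|ratr (p.1 i j) - f x i j| < p.2.+1%:R^-1]); last first.
  apply/seteqP; split => x /=.
    by move=> [_ h] i _ j _ /=; have := h i j; rewrite /ball/= mxE.
  by move=> h; split => // i j; rewrite /ball/= mxE; exact: h.
apply: fin_bigcap_measurable => // i _; apply: fin_bigcap_measurable => // j _.
rewrite -[X in measurable X]setTI.
have mg : measurable_fun setT (fun x => `|ratr (p.1 i j) - f x i j|).
  by apply: measurableT_comp => //; exact: measurable_funB.
rewrite (_ : [set x | _] = (fun x => `|ratr (p.1 i j) - f x i j|) @^-1` `]-oo, p.2.+1%:R^-1[%classic).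
  by apply: mg => //; exact: measurable_itv.
by apply/seteqP; split => x /=; rewrite in_itv.
Qed.

End borel_matrices.

Section law.
Context d d' (T : measurableType d) (T' : measurableType d') (R : realType).
Variables (P : probability T R) (P' : probability T' R) (X : T -> T').
Hypothesis mX : measurable_fun setT X.
Hypothesis law : forall A, measurable A -> P (X @^-1` A) = P' A.

Lemma law_ge0_integral (f : T' -> \bar R) : measurable_fun setT f ->
  (forall x, 0 <= f x)%E -> (\int[P]_x f (X x) = \int[P']_x f x)%E.
Proof.
move=> mf f0; transitivity (\int[pushforward P X]_x f x)%E.
  by rewrite ge0_integral_pushforward.
by apply: eq_measure_integral => A mA _; exact: law.
Qed.

(** Positive and negative parts are transported separately, so the identity also covers the junk
    value of [Ex] on nonsummable functions. *)
Lemma law_Ex (f : T' -> R) : measurable_fun setT f ->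
  Ex P (fun x => f (X x)) = Ex P' f.
Proof.
move=> mf; have mfE : measurable_fun setT (EFin \o f) by exact/measurable_EFinP.
congr fine; rewrite integralE [RHS]integralE; congr (_ - _)%E.
- rewrite -(law_ge0_integral (f := ((EFin \o f)^\+)%E))//; last exact: measurable_funepos.
  by apply: eq_integral => x _; rewrite !funeposE.
- rewrite -(law_ge0_integral (f := ((EFin \o f)^\-)%E))//; last exact: measurable_funeneg.
  by apply: eq_integral => x _; rewrite !funenegE.
Qed.

Lemma law_summable (f : T' -> R) : measurable_fun setT f ->
  summable P (fun x => f (X x)) <-> summable P' f.
Proof.
move=> mf; have mfE : measurable_fun setT (EFin \o f) by exact/measurable_EFinP.
have E : (\int[P]_x `|(f (X x))%:E| = \int[P']_x `|(f x)%:E|)%E.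
  by rewrite (law_ge0_integral (f := fun x => `|(f x)%:E|%E))//; exact: measurableT_comp.
split => /integrableP[_ h]; apply/integrableP; split => //.
- by rewrite -E.
- exact/measurable_EFinP/(measurableT_comp mf mX).
- by rewrite E.
Qed.

End law.

Lemma Ex_distribution d d' (T : measurableType d) (T' : measurableType d')
    (R : realType) (P : probability T R) (X : {RV P >-> T'}) (f : T' -> R) :
  measurable_fun setT f -> Ex (distribution P X) f = Ex P (f \o X).
Proof. by move=> mf; rewrite -(law_Ex (P := P) (X := X)). Qed.

Section gauss_vector.
Context (R : realType).
Local Notation gauss := (@normal_prob R 0 1).

(** The two properties of independent standard coordinates that serve below: products factor, for
    the spline approximation, and linear forms are Gaussian, for [is_normal]. *)
Definition std_gaussian K (mu : probability 'cV[R]_K R) :=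
  (forall (g : 'I_K -> R -> R) M, (forall k, measurable_fun setT (g k)) ->
    (forall k x, `|g k x| <= M) ->
    Ex mu (fun v => \prod_k g k (v k 0)) = \prod_k Ex gauss (g k)) /\
  (forall (c : 'I_K -> R) B, measurable B ->
    mu [set v | B (\sum_k c k * v k 0)] =
    gauss [set z | B (Num.sqrt (\sum_k c k ^+ 2) * z)]).

Lemma measurable_preimage_set d (T : measurableType d) d' (T' : measurableType d')
  (f : T -> T') (B : set T') : measurable_fun setT f -> measurable B ->
  measurable [set x | B (f x)].
Proof. by move=> mf mB; rewrite -[X in measurable X]setTI; exact: mf. Qed.

(** Induction on the dimension: a standard Gaussian coordinate is prepended through a product
    measure. *)
Lemma std_gaussian_exists K : exists mu : probability 'cV[R]_K R, std_gaussian mu.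
Proof.
elim: K => [|K [mu [muE muL]]].
  exists (\d_(0 : 'cV[R]_0)); split.
    move=> g M _ _; rewrite big_ord0; under eq_Ex do rewrite big_ord0.
    exact: Ex_cst.
  move=> c B mB; rewrite big_ord0 sqrtr0.
  under eq_set do rewrite big_ord0.
  under [in RHS]eq_set do rewrite mul0r.
  have [B0|B0] := pselect (B 0).
    rewrite (_ : [set _ | _] = setT) ?probability_setT//; last first.
      by apply/seteqP; split.
    rewrite (_ : [set _ | _] = setT) ?probability_setT//.
    by apply/seteqP; split.
  rewrite (_ : [set _ | _] = set0) ?measure0//; last first.
    by apply/seteqP; split.
  rewrite (_ : [set _ | _] = set0) ?measure0//.
  by apply/seteqP; split.
pose cons (p : measurableTypeR R * 'cV[R]_K) : 'cV[R]_K.+1 :=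
  \col_k oapp (fun j => p.2 j 0) p.1 (unlift ord0 k).
have cons0 p : cons p ord0 0 = p.1 by rewrite mxE unlift_none.
have consS p j : cons p (lift ord0 j) 0 = p.2 j 0 by rewrite mxE liftK.
have mcons : measurable_fun setT cons.
  apply: measurable_mx => i j; rewrite ord1.
  case: (unliftP ord0 i) => [k ->|->].
    under eq_fun do rewrite consS.
    exact: measurableT_comp (measurable_coord k 0) measurable_snd.
  by under eq_fun do rewrite cons0; exact: measurable_fst.
pose nu : probability (measurableTypeR R * 'cV[R]_K)%type R := (gauss \x mu)%E.
pose X : {RV nu >-> 'cV[R]_K.+1} := HB.pack cons (isMeasurableFun.Build _ _ _ _ _ mcons).
exists (distribution nu X); split.
  move=> g M mg gM.
  have mprod L (h : 'I_L -> R -> R) : (forall k, measurable_fun setT (h k)) ->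
      measurable_fun setT (fun v : 'cV[R]_L => \prod_k h k (v k 0)).
    move=> mh; apply: measurable_prod => k _.
    exact: measurableT_comp (mh k) (measurable_coord k 0).
  have bprod L (h : 'I_L -> R -> R) (v : 'cV[R]_L) : (forall k x, `|h k x| <= M) ->
      `|\prod_k h k (v k 0)| <= M ^+ L.
    move=> hM; rewrite normr_prod -[L in M ^+ L]card_ord -prodr_const.
    by apply: ler_prod => k _; rewrite normr_ge0 hM.
  rewrite Ex_distribution; last exact: mprod.
  rewrite big_ord_recl -(muE (fun k => g (lift ord0 k)) M)//.
  have nuE A B : measurable A -> measurable B ->
      nu ((fst @^-1` A) `&` (snd @^-1` B)) = (gauss A * mu B)%E.
    by move=> mA mB; rewrite -product_measure1E.
  have nu1 A : measurable A -> nu (fst @^-1` A) = gauss A.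
    move=> mA; have := nuE A setT mA measurableT.
    by rewrite preimage_setT setIT probability_setT mule1.
  have nu2 B : measurable B -> nu (snd @^-1` B) = mu B.
    move=> mB; have := nuE setT B measurableT mB.
    by rewrite preimage_setT setTI probability_setT mul1e.
  have indep : independent_RVs nu (fun p => g ord0 p.1)
      (fun p => \prod_k g (lift ord0 k) (p.2 k 0)).
    apply: (@independent_RVs_comp _ _ _ nu _ _ _ _ _ _ _ _ fst snd (g ord0)
      (fun v : 'cV[R]_K => \prod_k g (lift ord0 k) (v k 0))); first exact: mg.
      exact: (mprod K (fun k => g (lift ord0 k)) (fun k => mg _)).
    by move=> A B mA mB; rewrite nuE// nu1// nu2.
  have s1 : summable nu (fun p => g ord0 p.1).
    apply: (@bounded_summable _ _ _ _ _ M) => //.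
    exact: measurableT_comp (mg ord0) measurable_fst.
  have s2 : summable nu (fun p => \prod_k g (lift ord0 k) (p.2 k 0)).
    apply: (@bounded_summable _ _ _ _ _ (M ^+ K)) => [|x]; last by apply: (bprod K (fun k => g (lift ord0 k))).
    exact: measurableT_comp (mprod K (fun k => g (lift ord0 k)) (fun k => mg _)) measurable_snd.
  have [s12 E12] := independent_RVs_mul indep s1 s2.
  transitivity (Ex nu (fun p => g ord0 p.1 * \prod_k g (lift ord0 k) (p.2 k 0))).
    apply: eq_Ex => p /=; rewrite big_ord_recl cons0; congr (_ * _).
    by apply: eq_bigr => k _; rewrite consS.
  rewrite E12; congr (_ * _).
    exact: (law_Ex measurable_fst nu1 (mg ord0)).
  exact: (law_Ex measurable_snd nu2 (mprod K (fun k => g (lift ord0 k)) (fun k => mg _))).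
move=> c B mB.
pose s (v : 'cV[R]_K) := \sum_k c (lift ord0 k) * v k 0.
pose c0 := c ord0.
pose c' := Num.sqrt (\sum_k c (lift ord0 k) ^+ 2).
have ms : measurable_fun setT s.
  apply: measurable_sum => k; apply: measurable_funM => //; exact: measurable_coord.
have mshift x : measurable [set t : R | B (c0 * x + t)].
  by apply: measurable_preimage_set mB; exact: measurable_funD.
transitivity (nu [set p | B (c0 * p.1 + s p.2)]).
  rewrite /= /distribution /pushforward; congr (nu _); apply/seteqP.
  have E p : \sum_k c k * X p k 0 = c0 * p.1 + s p.2.
    rewrite big_ord_recl cons0; congr (_ + _).
    by apply: eq_bigr => k _; rewrite consS.
  by split => p /=; rewrite E.
have indicg (a b : R) : gauss [set z | B (a + b * z)] =
    (\int[gauss]_z (\1_B (a + b * z))%:E)%E.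
  have mS : measurable [set z : R | B (a + b * z)].
    apply: (@measurable_preimage_set _ _ _ _ (fun z : R => a + b * z) B _ mB).
    by apply: measurable_funD => //; exact: measurable_funM.
  transitivity (gauss ([set z : R | B (a + b * z)] `&` setT)); first by rewrite setIT.
  by rewrite -integral_indic.
(* By induction the linear form in the remaining coordinates has the law of c' times a standard
   Gaussian; [ge0_gauss_conv] then adds the two variances. *)
transitivity (\int[gauss]_x \int[gauss]_z (\1_B (c0 * x + c' * z))%:E)%E.
  rewrite /nu /= /product_measure1; apply: eq_integral => x _ /=.
  rewrite -indicg -(muL _ _ (mshift x)); congr (mu _).
  by apply/seteqP; split => v /=; rewrite /xsection /= inE.
rewrite (ge0_gauss_conv c0 c' (f := fun t => (\1_B t)%:E)).
- rewrite big_ord_recl [c' ^+ 2]sqr_sqrtr; last by apply: sumr_ge0 => k _; exact: sqr_ge0.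
  have := indicg 0 (Num.sqrt (c ord0 ^+ 2 + \sum_(k < K) c (lift ord0 k) ^+ 2)).
  under eq_set do rewrite add0r.
  by under eq_integral do rewrite add0r.
- exact/measurable_EFinP/measurable_indic.
- by move=> t; rewrite lee_fin.
Qed.
End gauss_vector.

(** * Uniform continuity on boxes, Chebyshev bounds, variance of sums *)

Section uniform_continuity.
Context (R : realType).

Lemma trmx_continuous m n : continuous (@trmx R m n).
Proof.
move=> M s /= /nbhs_ballP[e e0 es]; apply/nbhs_ballP; exists e => //= N [_ MN].
by apply: es; split => // i j; rewrite !mxE; exact: MN.
Qed.

(** Heine's argument on a compact box. Only [v] ranges over the box; [u] may leave it. The function
    is moved to row vectors, the setting of [rV_compact]. *)
Lemma box_uniform_continuity p (f : 'cV[R]_p -> R) (M e : R) :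
  continuous f -> 0 < e -> exists2 r, 0 < r &
    forall v u : 'cV[R]_p, (forall k, `|v k 0| <= M) ->
      (forall k, `|v k 0 - u k 0| <= r) -> `|f v - f u| <= e.
Proof.
move=> cf e0; pose g (v : 'rV[R]_p) := f v^T.
have cg : continuous g.
  by move=> v; apply: continuous_comp; [exact: trmx_continuous|exact: cf].
pose A := [set v : 'rV[R]_p | forall i, `[- M, M]%classic (v ord0 i)].
have cA : compact A.
  apply: (@rV_compact R p (fun=> `[- M, M]%classic)) => i; exact: segment_compact.
move/compact_near_coveringP : cA => cA.
pose Q (r : R) (v : 'rV[R]_p) := forall u, ball v r u -> `|g v - g u| <= e.
have : \forall r \near (0 : R)^'+, A `<=` Q r.
  apply: cA => v Av.
  have e20 : 0 < e / 2 by rewrite divr_gt0.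
  have /cvgrPdist_lt/(_ _ e20) := cg v.
  move=> /nbhs_ballP[d /= d0 dv].
  near=> v' r => u v'u.
  have v1 : ball v (d / 2) v' by near: v'; apply: nbhsx_ballx; rewrite divr_gt0.
  have r1 : r <= d / 2 by near: r; apply: nbhs_right_le; rewrite divr_gt0.
  have h1 : `|g v - g v'| < e / 2.
    by apply: dv; apply: le_ball v1; lra.
  have h2 : `|g v - g u| < e / 2.
    by apply: dv; rewrite (splitr d); apply: (ball_triangle v1); exact: le_ball v'u.
  rewrite (_ : g v' - g u = (g v - g u) - (g v - g v')); last by ring.
  by apply: (le_trans (ler_normB _ _)); lra.
move=> near0.
have [r [r0 rA]] : exists r : R, 0 < r /\ A `<=` Q r.
  near (0 : R)^'+ => r; exists r; split; first by near: r; exact: nbhs_right_gt.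
  by near: r.
exists (r / 2); first by rewrite divr_gt0.
move=> v u vM vu; have := rA v^T _ u^T; rewrite /g !trmxK; apply.
  by move=> i /=; rewrite mxE in_itv/= -ler_norml.
split => // i j; rewrite !mxE /ball/= ord1; apply: (le_lt_trans (vu j)).
by rewrite ltr_pdivrMr// ltr_pMr// ltr1n.
Unshelve. all: by end_near. Qed.

End uniform_continuity.

Section chebyshev.
Context d (T : measurableType d) (R : realType) (P : probability T R).

Lemma chebyshev_sqr (Z : T -> R) (M : R) : 0 < M -> measurable_fun setT Z ->
  summable P (fun x => Z x ^+ 2) ->
  measurable [set x | M < `|Z x|] /\
  fine (P [set x | M < `|Z x|]) <= Ex P (fun x => Z x ^+ 2) / M ^+ 2.
Proof.
move=> M0 mZ Z2.
have mA : measurable [set x | M < `|Z x|].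
  have mN : measurable_fun setT (fun x => `|Z x|) by exact: measurableT_comp.
  have := measurable_preimage_set mN (measurable_itv `]M, +oo[).
  by under eq_set do rewrite /= in_itv/= andbT.
split=> //; rewrite ler_pdivlMr ?exprn_gt0// -Ex_indic// mulrC -ExZ; last exact: summable_indic.
apply: le_Ex => //; first by apply: summableZ; exact: summable_indic.
move=> x; rewrite indicE; have [xA|_] := boolP (x \in _); last by rewrite mulr0 sqr_ge0.
rewrite mulr1 -[leRHS]real_normK ?num_real// lerXn2r ?nnegrE ?normr_ge0 ?(ltW M0)//.
by move: xA; rewrite inE => /ltW.
Qed.

(** On the exceptional set [A] the bound F on each function limits the difference to 2 F. *)
Lemma Ex_close (f g : T -> R) (F e : R) (A : set T) :
  measurable_fun setT f -> measurable_fun setT g ->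
  (forall x, `|f x| <= F) -> (forall x, `|g x| <= F) -> measurable A -> 0 <= e ->
  (forall x, ~ A x -> `|f x - g x| <= e) ->
  `|Ex P f - Ex P g| <= e + 2 * F * fine (P A).
Proof.
move=> mf mg fF gF mA e0 fg.
have sf := bounded_summable P mf fF; have sg := bounded_summable P mg gF.
have sA := summable_indic P mA.
rewrite -ExB// -(Ex_cst P e) -Ex_indic// -ExZ// -ExD; [|exact: summable_cst|exact: summableZ].
apply: norm_Ex.
- exact: summableB.
- by apply: summableD; [exact: summable_cst|exact: summableZ].
- move=> x; rewrite indicE; have [xA|xA] := boolP (x \in A).
    apply: (le_trans (ler_normB _ _)).
    by rewrite mulr1; have := fF x; have := gF x; lra.
  by rewrite mulr0 addr0; apply: fg; move=> Ax; move: xA; rewrite mem_set.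
Qed.

End chebyshev.

Section sum_variance.
Context d (T : measurableType d) (R : realType) (P : probability T R).

(** Each new summand is centered and independent of the partial sum, so the cross term has zero
    expectation. *)
Lemma sum_sqr (U : nat -> T -> R) (v : R) n :
  (forall i, measurable_fun setT (U i)) ->
  (forall i, independent_RVs P (fun x => \sum_(j < i) U j x) (U i)) ->
  (forall i, summable P (fun x => U i x ^+ 2)) ->
  (forall i, Ex P (U i) = 0) -> (forall i, Ex P (fun x => U i x ^+ 2) = v) ->
  summable P (fun x => (\sum_(j < n) U j x) ^+ 2) /\
  Ex P (fun x => (\sum_(j < n) U j x) ^+ 2) = n%:R * v.
Proof.
move=> mU iU U2 EU EU2; elim: n => [|n [s2 E2]].
  under eq_fun do rewrite big_ord0 expr0n/=.
  by split; [exact: summable_cst|rewrite mul0r Ex_cst].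
pose S x := \sum_(j < n) U j x.
have mS : measurable_fun setT S by exact: measurable_sum.
have sS : summable P S by exact: summable_sqr.
have sU : summable P (U n) by exact: summable_sqr.
have [sSU ESU] := independent_RVs_mul (iU n) sS sU.
have E x : (\sum_(j < n.+1) U j x) ^+ 2 = (S x ^+ 2 + 2 * (S x * U n x)) + U n x ^+ 2.
  by rewrite big_ord_recr /= -/(S x); ring.
under eq_fun do rewrite E.
have s1 : summable P (fun x => S x ^+ 2 + 2 * (S x * U n x)).
  by apply: summableD => //; exact: summableZ.
split; first exact: summableD.
rewrite ExD// ExD//; last exact: summableZ.
by rewrite ExZ// ESU EU mulr0 mulr0 addr0 E2 EU2 -natr1 mulrDl mul1r.
Qed.

End sum_variance.

(** * Limits of random vectors with independent coordinates *)

Section vector_limit.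
Context (R : realType).
Local Notation gauss := (@normal_prob R 0 1).

(** Chebyshev's inequality in each coordinate, and a union bound. *)
Lemma outside_box d (T : measurableType d) (P : probability T R) K
    (W : T -> 'cV[R]_K) (v : 'I_K -> R) (M : R) : 0 < M ->
  measurable_fun setT W ->
  (forall k, summable P (fun x => W x k 0 ^+ 2)) ->
  (forall k, Ex P (fun x => W x k 0 ^+ 2) <= v k) ->
  measurable [set x | exists k, M < `|W x k 0|] /\
  fine (P [set x | exists k, M < `|W x k 0|]) <= (\sum_k v k) / M ^+ 2.
Proof.
move=> M0 mW W2 EW2; pose A k := [set x | M < `|W x k 0|].
have mWk k : measurable_fun setT (fun x => W x k 0).
  exact: measurableT_comp (measurable_coord k 0) mW.
have mA k : measurable (A k) by have [] := chebyshev_sqr M0 (mWk k) (W2 k).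
have PA k : fine (P (A k)) <= v k / M ^+ 2.
  have [_] := chebyshev_sqr M0 (mWk k) (W2 k); move=> /le_trans; apply.
  by rewrite ler_wpM2r// invr_ge0 exprn_ge0// ltW.
have -> : [set x | exists k, M < `|W x k 0|] = \bigcup_(k in setT) A k.
  by apply/seteqP; split => x /=; [move=> [k]; exists k|move=> [k _]; exists k].
have mU : measurable (\bigcup_(k in setT) A k) by apply: fin_bigcup_measurable.
split => //; rewrite -Ex_indic// mulr_suml.
have sA k : summable P \1_(A k) by exact: summable_indic.
apply: (@le_trans _ _ (Ex P (fun x => \sum_k \1_(A k) x))).
  apply: le_Ex; [exact: summable_indic|exact: summable_sum|].
  move=> x; rewrite indicE; have [xA|_] := boolP (x \in _); last first.
    by apply: sumr_ge0 => k _; rewrite indicE.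
  move: xA; rewrite inE => -[k _ xk]; rewrite (bigD1 k)//= indicE mem_set// lerDl.
  by apply: sumr_ge0 => j _; rewrite indicE.
rewrite Ex_sum//; apply: ler_sum => k _; rewrite Ex_indic//; exact: PA.
Qed.

Lemma cvg_prodr (S I : Type) (F : set_system S) {FF : Filter F} (s : seq I)
    (u : I -> S -> R) (l : I -> R) :
  (forall i, u i @ F --> l i) ->
  (fun n => \prod_(i <- s) u i n) @ F --> \prod_(i <- s) l i.
Proof.
move=> ul; elim: s => [|i s ih].
  by under eq_fun do rewrite big_nil; rewrite big_nil; exact: cvg_cst.
by under eq_fun do rewrite big_cons; rewrite big_cons; exact: cvgM.
Qed.

Lemma cvg_sumr (S I : Type) (F : set_system S) {FF : Filter F} (s : seq I)
    (u : I -> S -> R) (l : I -> R) :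
  (forall i, u i @ F --> l i) ->
  (fun n => \sum_(i <- s) u i n) @ F --> \sum_(i <- s) l i.
Proof.
move=> ul; elim: s => [|i s ih].
  by under eq_fun do rewrite big_nil; rewrite big_nil; exact: cvg_cst.
by under eq_fun do rewrite big_cons; rewrite big_cons; exact: cvgD.
Qed.

Lemma std_gaussian_coord K (mu : probability 'cV[R]_K R) k :
  std_gaussian mu -> summable mu (fun u => u k 0 ^+ 2) /\
    Ex mu (fun u => u k 0 ^+ 2) = 1.
Proof.
move=> [_ muL].
have law A : measurable A -> mu ((fun u : 'cV[R]_K => u k 0) @^-1` A) = gauss A.
  move=> mA; have := muL (fun j => (j == k)%:R) A mA.
  have -> : \sum_j (j == k)%:R ^+ 2 = 1 :> R.
    rewrite (bigD1 k)//= eqxx expr1n big1 ?addr0// => j /negbTE ->.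
    by rewrite expr0n.
  rewrite sqrtr1; under [in RHS]eq_set do rewrite mul1r.
  have E (u : 'cV[R]_K) : \sum_j (j == k)%:R * u j 0 = u k 0.
    rewrite (bigD1 k)//= eqxx mul1r big1 ?addr0// => j /negbTE ->.
    by rewrite mul0r.
  by move=> <-; congr (mu _); apply/seteqP; split => u /=; rewrite E.
have mk : measurable_fun setT (fun u : 'cV[R]_K => u k 0 : measurableTypeR R).
  exact: measurable_coord.
have msq : measurable_fun setT (fun z : measurableTypeR R => (z : R) ^+ 2).
  exact: measurable_funX.
split.
  by apply: (proj2 (law_summable mk law msq)); exact: integrable_gauss_sqr.
by rewrite [LHS](law_Ex mk law msq) Ex_gauss_sqr.
Qed.

(** Uniform second moments leave little mass outside a box, and on the box [f] is close to a sum of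
    products of tame functions of one coordinate. Expectations of such products factor and converge
    by [cvgZ]. *)
Lemma cvg_vector d (T : measurableType d) (Q : probability T R) K
    (Z : nat -> T -> 'cV[R]_K) (v : 'I_K -> R) (mu : probability 'cV[R]_K R) :
  (forall k, 0 <= v k) ->
  (forall n, measurable_fun setT (Z n)) ->
  (forall n (g : 'I_K -> R -> R) M, (forall k, measurable_fun setT (g k)) ->
    (forall k x, `|g k x| <= M) ->
    Ex Q (fun x => \prod_k g k (Z n x k 0)) = \prod_k Ex Q (fun x => g k (Z n x k 0))) ->
  (forall k f, tame f ->
    (fun n => Ex Q (fun x => f (Z n x k 0))) @ \oo --> gconv (Num.sqrt (v k)) f 0) ->
  (forall n k, summable Q (fun x => Z n x k 0 ^+ 2)) ->
  (forall n k, Ex Q (fun x => Z n x k 0 ^+ 2) <= v k) ->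
  std_gaussian mu -> forall f : 'cV[R]_K -> R, continuous f ->
  (exists F, forall x, `|f x| <= F) ->
  (fun n => Ex Q (fun x => f (Z n x))) @ \oo -->
  Ex mu (fun u => f (\col_k (Num.sqrt (v k) * u k 0))).
Proof.
move=> v0 mZ prodZ cvgZ Z2 EZ2 stdmu f cf [F fF].
pose D (u : 'cV[R]_K) : 'cV[R]_K := \col_k (Num.sqrt (v k) * u k 0).
have mD : measurable_fun setT D.
  apply: measurable_mx => i j; rewrite ord1; under eq_fun do rewrite mxE.
  by apply: measurable_funM => //; exact: measurable_coord.
have D2 k : summable mu (fun u => D u k 0 ^+ 2).
  under eq_fun do rewrite mxE exprMn; apply: summableZ.
  by have [] := std_gaussian_coord k stdmu.
have ED2 k : Ex mu (fun u => D u k 0 ^+ 2) <= v k.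
  have [s1 E1] := std_gaussian_coord k stdmu.
  under eq_Ex do rewrite mxE exprMn.
  by rewrite ExZ// E1 mulr1 sqr_sqrtr.
have mf : measurable_fun setT f by exact: measurable_continuous_mx.
have F0 : 0 <= F by apply: le_trans (fF 0).
(* The five parts: an approximation error 2 e for [Z n], another 2 e for the limit, and e for the
   convergence of the expectations of [g]. *)
apply/cvgrPdist_le => e' e'0; pose e := e' / 5.
have e0 : 0 < e by rewrite divr_gt0.
pose V := \sum_k v k.
have V0 : 0 <= V by exact: sumr_ge0.
(* As M >= 1, M^2 is at least M, and the mass outside the box costs 2 F V / M^2 <= e. *)
pose M := 1 + 2 * F * V / e.
have M1 : 1 <= M by rewrite lerDl divr_ge0 ?(ltW e0)// !mulr_ge0.
have M0 : 0 < M by rewrite (lt_le_trans _ M1).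
have MV : 2 * F * (V / M ^+ 2) <= e.
  rewrite mulrA ler_pdivrMr ?exprn_gt0//.
  apply: (@le_trans _ _ (e * M)); last by rewrite ler_wpM2l ?(ltW e0)// expr2 ler_peMl// ltW.
  by rewrite /M mulrDr mulr1 [e * _]mulrC divfK ?gt_eqF// lerDr ltW.
have [r r0 fr] := box_uniform_continuity M cf e0.
have [N [a [b [tb gF fg]]]] := grid_approximation (ltW M0) r0 fF fr.
pose g (u : 'cV[R]_K) := \sum_phi a phi * \prod_k b (phi k) (u k 0).
have mb i : measurable_fun setT (b i) by have [? [? [? []]]] := tb i.
have mg : measurable_fun setT g.
  apply: measurable_sum => phi; apply: measurable_funM => //.
  by apply: measurable_prod => k _; exact: measurableT_comp (mb _) (measurable_coord k 0).
have approx d' (T' : measurableType d') (P : probability T' R) (W : T' -> 'cV[R]_K) :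
    measurable_fun setT W -> (forall k, summable P (fun x => W x k 0 ^+ 2)) ->
    (forall k, Ex P (fun x => W x k 0 ^+ 2) <= v k) ->
    `|Ex P (fun x => f (W x)) - Ex P (fun x => g (W x))| <= 2 * e.
  move=> mW W2 EW2; have [mA PA] := outside_box M0 mW W2 EW2.
  apply: (le_trans (Ex_close (F := F) (e := e) _ _ _ _ _ mA _ _)) => //.
  - exact: measurableT_comp.
  - exact: measurableT_comp.
  - by move=> x; exact: gF.
  - exact: ltW.
  - by move=> x nA; apply: fg => k; rewrite leNgt; apply/negP => h; apply: nA; exists k.
  - have := ler_wpM2l (mulr_ge0 (ler0n R 2) F0) PA; rewrite -/V; lra.
have bbound : exists B, forall i x, `|b i x| <= B.
  have /choice[Bi bBi] : forall i, exists Bi, forall x, `|b i x| <= Bi.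
    by move=> i; have [? [? [? [_ _ _ [Mi bM] _]]]] := tb i; exists Mi => x; have [] := bM x.
  exists (\sum_i `|Bi i|) => i x; apply: (le_trans (bBi i x)).
  rewrite (bigD1 i)//=; apply: (le_trans (ler_norm _)).
  by rewrite lerDl; exact: sumr_ge0.
have [B bB] := bbound.
have sprod d' (T' : measurableType d') (P : probability T' R) (W : T' -> 'cV[R]_K) phi :
    measurable_fun setT W -> summable P (fun x => \prod_k b (phi k) (W x k 0)).
  move=> mW; apply: (@bounded_summable _ _ _ _ _ (B ^+ K)).
    apply: measurable_prod => k _; apply: (measurableT_comp (mb _)).
    exact: measurableT_comp (measurable_coord k 0) mW.
  move=> x; rewrite normr_prod -[K in B ^+ K]card_ord -prodr_const.
  by apply: ler_prod => k _; rewrite normr_ge0 bB.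
have Eg d' (T' : measurableType d') (P : probability T' R) (W : T' -> 'cV[R]_K) :
    measurable_fun setT W -> Ex P (fun x => g (W x)) =
    \sum_phi a phi * Ex P (fun x => \prod_k b (phi k) (W x k 0)).
  move=> mW; rewrite Ex_sum; last by move=> phi; apply: summableZ; exact: sprod.
  by apply: eq_bigr => phi _; rewrite ExZ//; exact: sprod.
have cvgg : (fun n => Ex Q (fun x => g (Z n x))) @ \oo --> Ex mu (fun u => g (D u)).
  under eq_fun do rewrite Eg//; rewrite Eg//.
  apply: cvg_sumr => phi; apply: cvgM; first exact: cvg_cst.
  under eq_fun do rewrite (prodZ _ (fun k => b (phi k)) B)//.
  have -> : Ex mu (fun u => \prod_k b (phi k) (D u k 0)) =
      \prod_k gconv (Num.sqrt (v k)) (b (phi k)) 0.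
    have [muE _] := stdmu.
    transitivity (Ex mu (fun u => \prod_k b (phi k) (Num.sqrt (v k) * u k 0))).
      by apply: eq_Ex => u; apply: eq_bigr => k _; rewrite mxE.
    rewrite (muE (fun k t => b (phi k) (Num.sqrt (v k) * t)) B)//.
      by apply: eq_bigr => k _; apply: eq_Ex => z; rewrite add0r.
    by move=> k; apply: (measurableT_comp (mb _)); exact: measurable_funM.
  by apply: cvg_prodr => k; exact: cvgZ.
move/cvgrPdist_le : cvgg => /(_ _ e0); apply: filterS => n gn.
have h1 := approx _ _ _ _ (mZ n) (Z2 n) (EZ2 n).
have h2 := approx _ _ _ _ mD D2 ED2.
move: gn h1 h2; rewrite -/D !ler_norml => /andP[? ?] /andP[? ?] /andP[? ?].
have -> : e' = 5 * e by rewrite /e; field.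
by apply/andP; split; lra.
Qed.
End vector_limit.

(** * The moment estimator as a function of the sample means *)

Section entrywise_limits.
Context (R : realType) (S : Type) (F : set_system S) {FF : Filter F}.

(** Limits are entrywise and along any filter: they are taken near 0 for the Jacobian and near the
    population means for Slutsky's theorem. *)
Lemma cvg_mulmx m n p (A : S -> 'M[R]_(m, n)) (B : S -> 'M[R]_(n, p))
    (A0 : 'M[R]_(m, n)) (B0 : 'M[R]_(n, p)) :
  (forall i j, (fun x => A x i j) @ F --> A0 i j) ->
  (forall i j, (fun x => B x i j) @ F --> B0 i j) ->
  forall i j, (fun x => (A x *m B x) i j) @ F --> (A0 *m B0) i j.
Proof.
move=> hA hB i j; under eq_fun do rewrite mxE; rewrite mxE.
by apply: cvg_sumr => k; exact: cvgM.
Qed.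

Lemma cvg_det n (A : S -> 'M[R]_n) (A0 : 'M[R]_n) :
  (forall i j, (fun x => A x i j) @ F --> A0 i j) ->
  (fun x => \det (A x)) @ F --> \det A0.
Proof.
move=> hA; rewrite /determinant; apply: cvg_sumr => s.
by apply: cvgM; [exact: cvg_cst|exact: cvg_prodr].
Qed.

(** Cramer's rule makes the entries of the inverse continuous where the determinant is nonzero.
    [invmx] obeys the rule only on invertible matrices, hence the passage through [near_eq_cvg]. *)
Lemma cvg_invmx n (A : S -> 'M[R]_n) (A0 : 'M[R]_n) :
  (forall i j, (fun x => A x i j) @ F --> A0 i j) -> A0 \in unitmx ->
  (\forall x \near F, A x \in unitmx) /\
  forall i j, (fun x => invmx (A x) i j) @ F --> invmx A0 i j.
Proof.
move=> hA; rewrite unitmxE unitfE => d0.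
have hd := cvg_det hA.
have nearu : \forall x \near F, A x \in unitmx.
  have h := cvgr_neq0 _ hd d0.
  by near=> x; rewrite unitmxE unitfE; near: x; exact: h.
split=> // i j.
have -> : invmx A0 i j = (\det A0)^-1 * \adj A0 i j.
  by rewrite /invmx unitmxE unitfE d0 [LHS]mxE.
have h : (fun x => (\det (A x))^-1 * \adj (A x) i j) @ F --> (\det A0)^-1 * \adj A0 i j.
  apply: cvgM; first exact: cvgV.
  under eq_fun do rewrite mxE /cofactor; rewrite mxE /cofactor.
  apply: cvgM; first exact: cvg_cst.
  apply: cvg_det => k l; under eq_fun do rewrite !mxE; rewrite !mxE; exact: hA.
apply: cvg_trans h; apply: near_eq_cvg; near=> x.
have u : A x \in unitmx by near: x.
by rewrite /invmx u [RHS]mxE.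
Unshelve. all: by end_near. Qed.

End entrywise_limits.

Section moment_matrix.
Context (R : realType) (K d : nat) (w : 'rV[R]_K).
Hypothesis w_gt0 : forall k, 0 < w 0 k.

Definition gram (m : 'M[R]_(K, d)) : 'M[R]_(1 + d) :=
  (design m)^T *m diag_mx w *m design m.

Definition moment_mx (m : 'M[R]_(K, d)) : 'M[R]_(1 + d, K) :=
  invmx (gram m) *m (design m)^T *m diag_mx w.

(** A row vector v killed by the Gram matrix gives a zero sum of w_k u_k^2, where u = v (design
    m)^T; positive weights force u = 0, and full column rank then forces v = 0. *)
Lemma gram_unit m : \rank (design m) = d.+1 -> gram m \in unitmx.
Proof.
move=> rm.
have full : row_full (design m) by rewrite /row_full rm.
rewrite -row_free_unit -kermx_eq0; apply/eqP/row_matrixP => i.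
set v := row i _; rewrite row0.
have vg : v *m gram m = 0.
  by apply/sub_kermxP; exact: row_sub.
pose u := v *m (design m)^T.
have u0 : u = 0.
  have q0 : u *m diag_mx w *m u^T = 0.
    by rewrite /u trmx_mul trmxK !mulmxA -(mulmxA v) -(mulmxA v) -/(gram m) vg mul0mx.
  have : \sum_k w 0 k * u 0 k ^+ 2 = 0.
    have E : (u *m diag_mx w *m u^T) 0 0 = 0 by rewrite q0 mxE.
    rewrite -[RHS]E [RHS]mxE; apply: eq_bigr => k _.
    by rewrite mul_mx_diag mxE [u^T _ _]mxE; ring.
  move=> /eqP; rewrite psumr_eq0; last by move=> k _; rewrite mulr_ge0 ?sqr_ge0 ?ltW.
  move=> /allP h; apply/rowP => k; rewrite [RHS]mxE.
  have := h k; rewrite mem_index_enum => /(_ isT)/=.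
  by rewrite mulf_eq0 gt_eqF//= sqrf_eq0 => /eqP.
have : design m *m v^T = 0 by rewrite -[design m]trmxK -trmx_mul -/u u0 trmx0.
move/(congr1 trmx); rewrite trmx_mul trmxK trmx0 => /eqP.
have : row_free (design m)^T by rewrite /row_free mxrank_tr rm.
by move=> /mulmx_free_eq0 ->; move/eqP.
Qed.

(** The rank of a product is at most that of its last factor. This lets invertibility of the Gram
    matrix trigger the specification of the estimator, which is stated through the rank. *)
Lemma gram_unit_rank m : gram m \in unitmx -> \rank (design m) = d.+1.
Proof.
move=> gu; apply/eqP; rewrite eqn_leq rank_leq_col.
by have := mxrankM_maxr ((design m)^T *m diag_mx w) (design m); rewrite -/(gram m) mxrank_unit.
Qed.

Lemma moment_mxK m : gram m \in unitmx -> moment_mx m *m design m = 1%:M.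
Proof. by move=> gu; rewrite /moment_mx -!mulmxA [_^T *m _]mulmxA mulVmx. Qed.

Lemma moment_map_sub m y (b : 'cV[R]_(1 + d)) : gram m \in unitmx ->
  moment_map w m y = b + moment_mx m *m (y - design m *m b).
Proof.
by move=> gu; rewrite mulmxBr mulmxA moment_mxK// mul1mx addrC subrK.
Qed.

Lemma cvg_moment_mx (S : Type) (F : set_system S) {FF : Filter F}
    (m : S -> 'M[R]_(K, d)) (m0 : 'M[R]_(K, d)) :
  (forall i j, (fun x => m x i j) @ F --> m0 i j) -> gram m0 \in unitmx ->
  (\forall x \near F, gram (m x) \in unitmx) /\
  forall i j, (fun x => moment_mx (m x) i j) @ F --> moment_mx m0 i j.
Proof.
move=> hm gu.
have hD i j : (fun x => design (m x) i j) @ F --> design m0 i j.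
  rewrite /design; under eq_fun do rewrite mxE; rewrite mxE.
  by case: splitP => k _; [under eq_fun do rewrite mxE; rewrite mxE; exact: cvg_cst|exact: hm].
have hDT i j : (fun x => (design (m x))^T i j) @ F --> (design m0)^T i j.
  by under eq_fun do rewrite mxE; rewrite mxE; exact: hD.
have hDw i j : (fun x => ((design (m x))^T *m diag_mx w) i j) @ F -->
    ((design m0)^T *m diag_mx w) i j.
  by apply: cvg_mulmx => // k l; exact: cvg_cst.
have hg i j : (fun x => gram (m x) i j) @ F --> gram m0 i j by exact: cvg_mulmx.
have [nu hi] := cvg_invmx hg gu.
split => // i j; apply: cvg_mulmx => [k l|k l]; last exact: cvg_cst.
exact: cvg_mulmx.
Qed.

End moment_matrix.

Section mx_norm_entries.
Context (R : realType) (m n : nat).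

Lemma mx_norm_le (A : 'M[R]_(m, n)) c : 0 <= c ->
  (forall i j, `|A i j| <= c) -> `|A| <= c.
Proof.
move=> c0 Ac; rewrite -[leLHS]/(mx_norm A) mx_normrE.
by apply/bigmax_leP; split => // -[i j] _; exact: Ac.
Qed.

Lemma le_mx_norm (A : 'M[R]_(m, n)) i j : `|A i j| <= `|A|.
Proof.
rewrite -[leRHS]/(mx_norm A) mx_normrE.
by apply/bigmax_geP; right; exists (i, j).
Qed.

End mx_norm_entries.

(** * The Jacobian at the population moments *)

Section jacobian_moment_map.
Context (R : realType) (K d : nat) (w : 'rV[R]_K).
Variables (m0 : 'M[R]_(K, d)) (y0 : 'cV[R]_K) (b : 'cV[R]_(1 + d)).
Hypothesis gu : gram w m0 \in unitmx.
Hypothesis yE : y0 = design m0 *m b.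

Let N := (\sum_(k < K) d + K)%N.
Let mx_of (x : 'rV[R]_N) : 'M[R]_(K, d) := \matrix_(k < K) submxrow (lsubmx x) k.
Let y_of (x : 'rV[R]_N) : 'cV[R]_K := (rsubmx x)^T.
(** The increment of y - design m *m b. The column of ones is constant, so only the slopes
    [dsubmx b] appear. *)
Let lin (x : 'rV[R]_N) : 'cV[R]_K := y_of x - mx_of x *m dsubmx b.
Let df (x : 'rV[R]_N) : 'rV[R]_(1 + d) := (moment_mx w m0 *m lin x)^T.

Let mx_of_linear (a : R) x z : mx_of (a *: x + z) = a *: mx_of x + mx_of z.
Proof. by apply/matrixP => i j; rewrite !mxE. Qed.

Let y_of_linear (a : R) x z : y_of (a *: x + z) = a *: y_of x + y_of z.
Proof. by apply/matrixP => i j; rewrite !mxE. Qed.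

Let df_linear : linear df.
Proof.
move=> a x z; rewrite /df /lin mx_of_linear y_of_linear mulmxDl -scalemxAl.
rewrite opprD addrACA -scalerBr mulmxDr -scalemxAr.
by apply/matrixP => i j; rewrite !mxE.
Qed.

Let theta := stack m0 y0.

Let mx_theta : mx_of theta = m0.
Proof.
apply/matrixP => i j; rewrite mxE /theta /stack row_mxKl mxrowK.
by rewrite mxE.
Qed.

Let y_theta : y_of theta = y0.
Proof. by rewrite /y_of /theta /stack row_mxKr trmxK. Qed.

Let design_mul m : design m *m b = (const_mx 1 : 'M[R]_(K, 1)) *m usubmx b + m *m dsubmx b.
Proof. by rewrite -{1}[b]vsubmxK /design mul_row_col. Qed.

(** An exact expansion: the residual y - design m *m b is affine in the moments and vanishes at
    [theta], so its value at the perturbed point is [lin x]. *)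
Let smE x : gram w (mx_of (x + theta)) \in unitmx ->
  stacked_moment_map w (x + theta) =
    b^T + (moment_mx w (mx_of (x + theta)) *m lin x)^T.
Proof.
move=> xu; rewrite /stacked_moment_map -/(mx_of _) -/(y_of _) (moment_map_sub _ b)//.
rewrite linearD/=; congr (_ + (_ *m _)^T).
have := mx_of_linear 1 x theta; rewrite !scale1r => ->.
have := y_of_linear 1 x theta; rewrite !scale1r => ->.
rewrite mx_theta y_theta yE !design_mul mulmxDl /lin.
by rewrite opprD [in X in _ + (_ + X)]opprD; apply/matrixP => i j; rewrite !mxE; ring.
Qed.

Let stacked_theta : stacked_moment_map w theta = b^T.
Proof.
have df0 : df 0 = 0.
  by have := df_linear (- 1) 0 0; rewrite scaler0 add0r scaleN1r addNr.
have := smE (x := 0); rewrite add0r mx_theta => -> //.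
by rewrite -/(df 0) df0 addr0.
Qed.

(** By [smE] the remainder is the change of [moment_mx] applied to [lin x]: the former tends to 0 by
    [cvg_moment_mx], the latter is O(|x|). *)
Lemma diff_stacked_moment_map : 'd (stacked_moment_map w) theta = df :> (_ -> _).
Proof.
pose dfL : {linear 'rV[R]_N -> 'rV[R]_(1 + d)} :=
  HB.pack df (GRing.isLinear.Build _ _ _ _ _ df_linear).
pose C := 1 + \sum_j `|dsubmx b j 0|.
have C0 : 0 < C by rewrite ltr_pwDl// sumr_ge0.
have linC x k : `|lin x k 0| <= C * `|x|.
  rewrite /lin mxE [X in _ + X]mxE mulrDl mul1r; apply: (le_trans (ler_normB _ _)); apply: lerD.
    by rewrite !mxE; exact: le_mx_norm.
  rewrite mxE mulr_suml; apply: (le_trans (ler_norm_sum _ _ _)); apply: ler_sum => j _.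
  by rewrite normrM mulrC ler_wpM2l// !mxE; exact: le_mx_norm.
have df_le (A : 'M[R]_(1 + d, K)) (c : R) x : 0 <= c -> (forall i k, `|A i k| <= c) ->
    `|(A *m lin x)^T| <= K%:R * c * (C * `|x|).
  move=> c0 Ac; apply: mx_norm_le => [|i j].
    by rewrite !mulr_ge0// ltW.
  rewrite mxE mxE; apply: (le_trans (ler_norm_sum _ _ _)).
  rewrite (_ : K%:R * c * _ = \sum_(k < K) c * (C * `|x|)); last first.
    by rewrite sumr_const card_ord -mulrA mulr_natl.
  by apply: ler_sum => k _; rewrite normrM; apply: ler_pM => //; rewrite ord1; exact: linC.
apply: (@diff_unique _ _ _ _ dfL).
  apply: bounded_linear_continuous; apply/bounded_funP => r.
  pose c := \sum_i \sum_k `|moment_mx w m0 i k|.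
  have c0 : 0 <= c by apply: sumr_ge0 => i _; exact: sumr_ge0.
  exists (K%:R * c * (C * r)) => x xr.
  apply: (le_trans (df_le _ c x c0 _)).
    move=> i k; rewrite /c (bigD1 i)//= (bigD1 k)//= -addrA lerDl addr_ge0//.
      by apply: sumr_ge0.
    by apply: sumr_ge0 => l _; exact: sumr_ge0.
  by rewrite !ler_wpM2l ?mulr_ge0// ?ltW.
apply/eqaddoP => e e0.
have hm i j : (fun x => mx_of (x + theta) i j) @ (0 : 'rV[R]_N) --> m0 i j.
  apply/(@cvgrPdist_le _ _ _ (nbhs (0 : 'rV[R]_N))) => r r0.
  have hr : \forall x \near nbhs (0 : 'rV[R]_N), forall i j, `|(x : 'rV[R]_N) i j| <= r.
    apply/nbhs_ballP; exists r => //= x [_ bx] k l.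
    by have := bx k l; rewrite /ball/= mxE sub0r normrN => /ltW.
  near=> x.
  have := mx_of_linear 1 x theta; rewrite !scale1r => ->.
  rewrite mx_theta mxE opprD addrCA subrr addr0 normrN !mxE.
  have xr : forall k l, `|x k l| <= r by near: x; exact: hr.
  exact: xr.
have [nu hH] := cvg_moment_mx hm gu.
(* Gives K c C <= e; the added 1 keeps the denominator positive when K = 0. *)
pose c := e / (K%:R * C + 1).
have KC : 0 < K%:R * C + 1 by rewrite ltr_wpDl// mulr_ge0// ltW.
have c0 : 0 < c by rewrite divr_gt0.
have nH : \forall x \near (0 : 'rV[R]_N), forall i k,
    `|moment_mx w m0 i k - moment_mx w (mx_of (x + theta)) i k| <= c.
  have key i k : nbhs (0 : 'rV[R]_N)
      [set x | `|moment_mx w m0 i k - moment_mx w (mx_of (x + theta)) i k| <= c].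
    by have /cvgrPdist_le/(_ _ c0) := hH i k.
  exact: (filter_forall _ (fun i => filter_forall _ (key i))).
near=> x.
have xu : gram w (mx_of (x + theta)) \in unitmx by near: x; exact: nu.
have xH : forall i k, `|moment_mx w m0 i k - moment_mx w (mx_of (x + theta)) i k| <= c.
  by near: x; exact: nH.
rewrite /= !fctE /= smE// stacked_theta /df.
rewrite (_ : _ - _ = ((moment_mx w (mx_of (x + theta)) - moment_mx w m0) *m lin x)^T).
  apply: (le_trans (df_le _ c x (ltW c0) _)) => [i k|].
    by rewrite mxE [X in _ + X]mxE distrC.
  have Kc : K%:R * c * C <= e.
    have -> : K%:R * c * C = e * (K%:R * C) / (K%:R * C + 1).
      by rewrite /c; field; rewrite gt_eqF.
    by rewrite ler_pdivrMr// ler_wpM2l ?(ltW e0)// lerDl.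
  by rewrite mulrA ler_wpM2r.
by rewrite mulmxBl [in RHS]linearB/= opprD addrACA subrr add0r.
Unshelve. all: by end_near. Qed.

(** The library's Jacobian acts on row vectors on the right, hence the transposes. *)
Lemma mul_tr_jacobian_at (a : 'cV[R]_(1 + d)) (c := (moment_mx w m0)^T *m a) :
  (jacobian_at w theta)^T *m a =
  (row_mx (\mxrow_(k < K) (- c k 0 *: (dsubmx b)^T)) c^T)^T.
Proof.
rewrite /jacobian_at trmxK; apply/row_matrixP => i.
rewrite row_mul rowE mul_rV_lin1 diff_stacked_moment_map -[row i _]mul1mx.
set e := delta_mx 0 i.
rewrite [RHS]mul1mx rowE -/e /df trmx_mul -mulmxA -/c.
rewrite tr_row_mx trmxK -[e in RHS]hsubmxK mul_row_col tr_mxrow -[lsubmx e]submxrowK.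
rewrite mul_mxrow_mxcol; apply/matrixP => i0 j0; rewrite !ord1.
rewrite /lin linearB/= mulmxBl trmxK mxE [in RHS]mxE addrC; congr (_ + _).
rewrite [LHS]mxE [X in - X]mxE summxE -sumrN; apply: eq_bigr => k _.
have -> : (- c k 0 *: (dsubmx b)^T)^T = - c k 0 *: dsubmx b.
  by apply/matrixP => ? ?; rewrite !mxE.
rewrite -scalemxAr [RHS]mxE mulNr mulrC; congr (- (_ * _)).
by rewrite 3!mxE; apply: eq_bigr => l _; rewrite !mxE.
Qed.

End jacobian_moment_map.

(** Block diagonality leaves one term per group, and squaring removes the minus sign of the slope
    part; the second factor will be the variance of the group residual. *)
Lemma block_quadratic_form (R : realType) (K d : nat) (V : 'I_K -> 'M[R]_d)
    (v : 'I_K -> R) (c : 'cV[R]_K) (b : 'cV[R]_d)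
    (u := row_mx (\mxrow_(k < K) (- c k 0 *: b^T)) c^T) :
  (u *m block_mx (\mxdiag_(k < K) V k) 0 0 (diag_mx (\row_k v k)) *m u^T) 0 0 =
  \sum_k c k 0 ^+ 2 * (v k + (b^T *m V k *m b) 0 0).
Proof.
rewrite /u mul_row_block !mulmx0 addr0 add0r tr_row_mx trmxK mul_row_col.
rewrite mul_mxrow_mxdiag tr_mxrow mul_mxrow_mxcol mxE summxE.
have -> : (c^T *m diag_mx (\row_k v k) *m c) 0 0 = \sum_k c k 0 ^+ 2 * v k.
  by rewrite mxE; apply: eq_bigr => k _; rewrite mul_mx_diag !mxE; ring.
rewrite -big_split/=; apply: eq_bigr => k _; rewrite mulrDr addrC; congr (_ + _).
have -> : (- c k 0 *: b^T)^T = - c k 0 *: b by apply/matrixP => ? ?; rewrite !mxE.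
by rewrite -scalemxAr -!scalemxAl scalerA mulrNN -expr2 mxE.
Qed.

(** * Gaussian limits with possibly degenerate covariance *)

Section normal_limit.
Context (R : realType).
Local Notation gauss := (@normal_prob R 0 1).

Lemma normal_prob_scale (s : R) (B : set R) : 0 < s -> measurable B ->
  normal_prob 0 s B = gauss [set z | B (s * z)].
Proof.
move=> s0 mB.
have mS : measurable [set z : R | B (s * z)].
  by apply: (@measurable_preimage_set _ _ _ _ (fun z : R => s * z) B _ mB); exact: measurable_funM.
have pdfE x : normal_pdf 0 s x = s^-1 * gpdf (x / s).
  rewrite /normal_pdf gt_eqF// /gpdf /normal_peak /normal_fun subr0 expr1n mul1r.
  rewrite -mulrnAr sqrtrM ?sqr_ge0// sqrtr_sqr gtr0_norm// invfM -mulrA.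
  congr (_ * (_ * expR _)); by field; rewrite gt_eqF.
have mg := @measurable_gpdf R.
pose F (x : R) : \bar R := ((\1_B x)%:E * (s^-1 * gpdf (x / s))%:E)%E.
have mF : measurable_fun setT F.
  apply: emeasurable_funM; first exact/measurable_EFinP/measurable_indic.
  apply/measurable_EFinP; apply: measurable_funM => //; apply: (measurableT_comp mg).
  exact: measurable_funM.
have F0 x : (0 <= F x)%E.
  by rewrite mule_ge0// lee_fin// mulr_ge0 ?gpdf_ge0// invr_ge0 ltW.
transitivity (\int[lebesgue_measure]_x F x)%E.
  rewrite /normal_prob integral_mkcond; apply: eq_integral => x _.
  rewrite /patch /F indicE; case: ifPn => xB; last by rewrite mul0e.
  by rewrite mul1e pdfE.
rewrite -(ge0_integral_affine 0 s0 mF F0) -ge0_integralZl//; last 2 first.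
  by apply: (measurableT_comp mF); apply: measurable_funD => //; exact: measurable_funM.
  by rewrite lee_fin ltW.
transitivity (\int[gauss]_z (\1_[set z : R | B (s * z)] z)%:E)%E; last first.
  by rewrite integral_indic// setIT.
rewrite ge0_integral_gauss//; last exact/measurable_EFinP/measurable_indic.
apply: eq_integral => z _; rewrite /F addr0.
have -> : s * z / s = z by field; rewrite gt_eqF.
rewrite -!EFinM; congr EFin.
rewrite (_ : \1_[set z0 : R | B (s * z0)] z = \1_B (s * z)) //.
by field; rewrite gt_eqF.
Qed.

(** Unifies the two branches of [normal1] as images of the standard Gaussian: multiplication by sqrt
    0 yields the Dirac mass. *)
Lemma normal1E (q : R) (B : set R) : 0 <= q -> measurable B ->
  normal1 0 q B = gauss [set z | B (Num.sqrt q * z)].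
Proof.
move=> q0 mB; rewrite /normal1; case: ifPn => [qp|].
  by rewrite normal_prob_scale// sqrtr_gt0.
rewrite -leNgt => q0'; have -> : q = 0 by apply/eqP; rewrite eq_le q0 q0'.
rewrite sqrtr0; under [in RHS]eq_set do rewrite mul0r.
have [B0|B0] := pselect (B 0).
  rewrite (_ : [set _ | B 0] = setT) ?probability_setT; last by apply/seteqP; split.
  by rewrite diracE mem_set.
rewrite (_ : [set _ | B 0] = set0) ?measure0; last by apply/seteqP; split.
by rewrite diracE memNset.
Qed.

(** [is_normal] tests a law through linear forms, so matching the covariance as a quadratic form is
    enough; a linear form of the image is again a linear form of [u]. *)
Lemma gaussian_image K p (mu : probability 'cV[R]_K R) (v : 'I_K -> R)
    (H : 'M[R]_(p, K)) (S : 'M[R]_p) :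
  std_gaussian mu -> (forall k, 0 <= v k) ->
  (forall a : 'cV[R]_p, (a^T *m S *m a) 0 0 = \sum_k (H^T *m a) k 0 ^+ 2 * v k) ->
  exists nu : probability 'cV[R]_p R, is_normal nu 0 S /\
    forall f : 'cV[R]_p -> R, continuous f ->
      Ex nu f = Ex mu (fun u => f (H *m \col_k (Num.sqrt (v k) * u k 0))).
Proof.
move=> [_ muL] v0 SE.
pose D (u : 'cV[R]_K) : 'cV[R]_p := H *m \col_k (Num.sqrt (v k) * u k 0).
have mD : measurable_fun setT D.
  apply: measurable_mx => i j; under eq_fun do rewrite mxE.
  apply: measurable_sum => k; apply: measurable_funM => //; under eq_fun do rewrite mxE.
  by apply: measurable_funM => //; exact: measurable_coord.
pose X : {RV mu >-> 'cV[R]_p} := HB.pack D (isMeasurableFun.Build _ _ _ _ _ mD).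
exists (distribution mu X); split; last first.
  by move=> f cf; rewrite Ex_distribution//; exact: measurable_continuous_mx.
move=> a B mB; rewrite mulmx0 mxE SE normal1E//; last first.
  by apply: sumr_ge0 => k _; rewrite mulr_ge0// sqr_ge0.
have E u : (a^T *m D u) 0 0 = \sum_k ((H^T *m a) k 0 * Num.sqrt (v k)) * u k 0.
  rewrite /D mulmxA -[a^T *m H]trmxK trmx_mul trmxK mxE; apply: eq_bigr => k _.
  by rewrite [_^T 0 k]mxE [X in _ * X]mxE mulrA.
transitivity (mu [set u | B (\sum_k ((H^T *m a) k 0 * Num.sqrt (v k)) * u k 0)]).
  by congr (mu _); apply/seteqP; split => u /=; rewrite E.
rewrite muL//; congr (gauss _); apply/seteqP.
rewrite (eq_bigr (fun k => (H^T *m a) k 0 ^+ 2 * v k)); first by split.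
by move=> k _; rewrite exprMn sqr_sqrtr.
Qed.

End normal_limit.

(** * Conditional laws *)

Section conditional_probability.
Context d (T : measurableType d) (R : realType) (P : probability T R).
Variables (G : {RV P >-> nat}) (k : nat).
Hypothesis Gk : (0 < P (G @^-1` [set k]))%E.
Local Notation Pk := (cond_prob G k).
Let D := G @^-1` [set k].
Let p := fine (P D).

Let pE : P D = p%:E.
Proof. by rewrite /p fineK// fin_num_measure//; exact: measurable_label. Qed.

Let p0 : 0 < p.
Proof. by rewrite -lte_fin -pE. Qed.

Lemma cond_probE A : Pk A = (P (A `&` D) * (p^-1)%:E)%E.
Proof.
(* [mnormalize] falls back on [P] when the total mass is zero or infinite; the positive finite mass
   p excludes this. *)
have key (mu : {measure set T -> \bar R}) : mu setT = p%:E ->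
    mnormalize mu P A = (mu A * (p^-1)%:E)%E.
  by move=> muT; rewrite /mnormalize muT/= eqe gt_eqF.
apply: key; rewrite -pE; congr (P _); exact: setTI.
Qed.

(** Up to the factor 1 / p the integral is the one over [D], bounded by that over the whole space;
    the complement of [D] is null for the restricted measure. *)
Lemma cond_prob_summable (f : T -> R) : summable P f -> summable Pk f.
Proof.
move=> sf; have mf := summable_measurable sf.
have mfE : measurable_fun setT (fun x => `|(f x)%:E|%E).
  by apply: measurableT_comp => //; exact/measurable_EFinP.
apply/integrableP; split; first exact/measurable_EFinP.
have mD : measurable D := measurable_label G k.
have pV0 : 0 <= p^-1 by rewrite invr_ge0 ltW.
pose nu : {measure set T -> \bar R} := mscale (NngNum pV0) (mrestr P mD).
have -> : (\int[Pk]_x `|(f x)%:E| = \int[nu]_x `|(f x)%:E|)%E.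
  apply: eq_measure_integral => A mA _.
  exact: (etrans (cond_probE A) (muleC _ _)).
rewrite ge0_integral_mscale// lte_mul_pinfty//.
have DT : setT = D `|` ~` D by rewrite setUv.
have mDC : measurable (~` D) by exact: measurableC.
rewrite DT ge0_integral_setU//=; last 2 first.
- by rewrite -DT.
- by rewrite disj_set2E setICr.
rewrite [X in (_ + X)%E](_ : _ = 0%E) ?adde0; last first.
  apply: null_set_integral => //; first exact: measurable_funTS.
  have e : P (~` D `&` D) = 0%E by rewrite setICl measure0.
  exact: e.
rewrite (_ : integral _ D _ = \int[P]_(x in D) `|(f x)%:E|)%E; last first.
  apply: eq_measure_integral => A mA AD.
  have e : P (A `&` D) = P A by rewrite setIidl.
  exact: e.
case/integrableP: sf => _; apply: le_lt_trans.
by apply: ge0_subset_integral.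
Qed.

Lemma cond_prob_ae (Q : T -> Prop) : {ae P, forall x, Q x} -> {ae Pk, forall x, Q x}.
Proof.
move=> [N [mN N0 QN]]; exists N; split => //.
rewrite cond_probE (_ : P _ = 0%E) ?mul0e//.
by apply: (subset_measure0 _ mN) => //; apply: measurableI => //; exact: measurable_label.
Qed.

Lemma cond_prob_law d' (T' : measurableType d') (X : T -> T') A :
  independent_RVs P X G -> measurable A -> Pk (X @^-1` A) = P (X @^-1` A).
Proof.
move=> XG mA; rewrite cond_probE [X in (X * _)%E]XG// -/D pE -muleA -EFinM divff ?mule1//.
by rewrite gt_eqF.
Qed.

End conditional_probability.

(** * Slutsky's theorem *)

Lemma cvg_mx_entries (R : realType) (S : Type) (F : set_system S) {FF : Filter F}
    m n (A : S -> 'M[R]_(m, n)) (A0 : 'M[R]_(m, n)) :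
  (forall i j, (fun x => A x i j) @ F --> A0 i j) -> A @ F --> A0.
Proof.
move=> hA; apply/cvg_ballP => e e0.
have key i j : F [set x | `|A0 i j - A x i j| < e].
  by have /cvgrPdist_lt/(_ _ e0) := hA i j.
apply: (filterS _ (filter_forall _ (fun i => filter_forall _ (key i)))).
by move=> x h; split => // i j; exact: h.
Qed.

Lemma continuous_mulmxl (R : realType) p K (H : 'M[R]_(p, K)) :
  continuous (fun z : 'cV[R]_K => H *m z).
Proof.
move=> z; apply: (@cvg_mx_entries _ _ (nbhs z)) => i j.
by apply: (@cvg_mulmx _ _ (nbhs z)) => k l; [exact: cvg_cst|exact: coord_continuous].
Qed.

(** The order of quantifiers matters: M depends on the tolerated mass alone, the uniform continuity
    radius r of [f] on the box of size M comes next, and closeness is asked for large n. *)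
Lemma slutsky d (T : measurableType d) (R : realType) (Q : probability T R) p
    (A B : nat -> T -> 'cV[R]_p) (f : 'cV[R]_p -> R) (F l : R) :
  continuous f -> (forall x, `|f x| <= F) ->
  (forall n, measurable_fun setT (A n)) -> (forall n, measurable_fun setT (B n)) ->
  (forall e, 0 < e -> exists M, forall r, 0 < r -> \forall n \near \oo,
    exists S, [/\ measurable S, fine (Q S) <= e & forall x, ~ S x ->
      (forall k, `|A n x k 0| <= M) /\ (forall k, `|A n x k 0 - B n x k 0| <= r)]) ->
  (fun n => Ex Q (fun x => f (A n x))) @ \oo --> l ->
  (fun n => Ex Q (fun x => f (B n x))) @ \oo --> l.
Proof.
move=> cf fF mA mB AB Al; have mf := measurable_continuous_mx cf.
have F0 : 0 <= F by apply: le_trans (fF 0).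
apply/cvgrPdist_le => e' e'0; pose e := e' / 3.
have e0 : 0 < e by rewrite divr_gt0.
(* A mass this small costs at most e when multiplied by 2 F; the added 1 covers F = 0. *)
have e1 : 0 < e / (2 * F + 1) by rewrite divr_gt0// ltr_wpDl// mulr_ge0.
have [M hM] := AB _ e1.
have [r r0 fr] := box_uniform_continuity M cf e0.
have hr := hM r r0.
move/cvgrPdist_le : Al => /(_ _ e0) Al.
near=> n.
have [S [mS QS nS]] : exists S, [/\ measurable S, fine (Q S) <= e / (2 * F + 1) &
    forall x, ~ S x -> (forall k, `|A n x k 0| <= M) /\ (forall k, `|A n x k 0 - B n x k 0| <= r)].
  by near: n; exact: hr.
have hl : `|l - Ex Q (fun x => f (A n x))| <= e by near: n; exact: Al.
have close : `|Ex Q (fun x => f (A n x)) - Ex Q (fun x => f (B n x))| <=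
    e + 2 * F * fine (Q S).
  apply: Ex_close => //.
  - exact: measurableT_comp.
  - exact: measurableT_comp.
  - exact: ltW.
  - by move=> x /nS[h1 h2]; exact: fr.
have h3 : 2 * F * fine (Q S) <= e.
  have F2 : 0 <= 2 * F by rewrite mulr_ge0.
  apply: (le_trans (ler_wpM2l F2 QS)).
  by rewrite mulrCA ger_pMr// ler_pdivrMr ?mul1r ?lerDl// ltr_wpDl.
have -> : l - Ex Q (fun x => f (B n x)) = (l - Ex Q (fun x => f (A n x))) +
   (Ex Q (fun x => f (A n x)) - Ex Q (fun x => f (B n x))) by ring.
apply: (le_trans (ler_normD _ _)).
have -> : e' = e + (e + e) by rewrite /e; field.
by apply: lerD => //; apply: (le_trans close); rewrite lerD2l.
Unshelve. all: by end_near. Qed.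

(** * Asymptotics of the samples *)

Section samples.
Context (R : realType) (d K : nat) (dQ : measure_display) (T : measurableType dQ).
Variables (Q : probability T R).
Variables (Ys : 'I_K -> nat -> {RV Q >-> R}) (Xs : 'I_K -> nat -> {RV Q >-> 'rV[R]_d}).
Variables (LY : 'I_K -> probability R R) (LX : 'I_K -> probability 'rV[R]_d R).
Hypothesis Ys_law : forall k i A, measurable A -> Q (Ys k i @^-1` A) = LY k A.
Hypothesis Xs_law : forall k i A, measurable A -> Q (Xs k i @^-1` A) = LX k A.
Hypothesis indep : mutually_independent Q (observations Ys Xs).
Hypothesis LY2 : forall k, summable (LY k) (fun y => y ^+ 2).
Hypothesis LX2 : forall k j, summable (LX k) (fun x => x 0 j ^+ 2).
Variable b : 'cV[R]_d.

Local Notation F := (observations Ys Xs).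
Local Notation index := ('I_K * nat + 'I_K * nat)%type.

Lemma observations_setT a : F a setT.
Proof. by case: a => -[k i] /=; exists setT => //; rewrite preimage_setT setIT. Qed.

Lemma observations_setI a : setI_closed (F a).
Proof.
case: a => -[k i] _ _ [A mA <-] [B mB <-]; exists (A `&` B);
  by [exact: measurableI|rewrite preimage_setI !setTI].
Qed.

Lemma observations_measurable a : F a `<=` measurable.
Proof.
by case: a => -[k i] _ [A mA <-]; rewrite setTI; exact: measurable_funPTI.
Qed.

Lemma observations_independent (J L : {fset index}) d1 d2 (T1 : measurableType d1)
    (T2 : measurableType d2) (f : T -> T1) (g : T -> T2) :
  [disjoint J & L]%fset ->
  measurable_fun (setT : set (g_sigma_algebraType (cylinder F J))) f ->
  measurable_fun (setT : set (g_sigma_algebraType (cylinder F L))) g ->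
  independent_RVs Q f g.
Proof.
apply: cylinder_independent => //.
- exact: observations_setT.
- exact: observations_setI.
- exact: observations_measurable.
Qed.

Lemma Ys_cylinder (J : {fset index}) k i : inl (k, i) \in J ->
  measurable_fun (setT : set (g_sigma_algebraType (cylinder F J))) (Ys k i).
Proof.
move=> J1 _ A mA; apply: sub_sigma_algebra.
apply: (sub_cylinder observations_setT J1); exists A => //.
Qed.

Lemma Xs_cylinder (J : {fset index}) k i : inr (k, i) \in J ->
  measurable_fun (setT : set (g_sigma_algebraType (cylinder F J))) (Xs k i).
Proof.
move=> J1 _ A mA; apply: sub_sigma_algebra.
by apply: (sub_cylinder observations_setT J1); exists A.
Qed.

(** Observations of both kinds, since a residual combines the Y and X observations with the same
    group and index. *)
Definition block (ks : seq 'I_K) (ns : seq nat) : {fset index} :=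
  [fset a in [seq inl (k, i) | k <- ks, i <- ns] ++ [seq inr (k, i) | k <- ks, i <- ns]]%fset.

Lemma mem_block ks ns (a : index) : (a \in block ks ns) =
  match a with inl (k, i) | inr (k, i) => (k \in ks) && (i \in ns) end.
Proof.
rewrite /block in_fset mem_cat; case: a => -[k i].
  apply/orP/andP => [[|]|[kk ii]].
  - by move=> /allpairsP[[k' i'] /= [? ? [-> ->]]].
  - by move=> /allpairsP[[k' i'] /= [? ? []]].
  - by left; apply/allpairsP; exists (k, i).
apply/orP/andP => [[|]|[kk ii]].
- by move=> /allpairsP[[k' i'] /= [? ? []]].
- by move=> /allpairsP[[k' i'] /= [? ? [-> ->]]].
- by right; apply/allpairsP; exists (k, i).
Qed.

(** [W k i] only depends on the [i]-th observations in group [k]. *)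
Definition observed (W : 'I_K -> nat -> T -> R) := forall (J : {fset index}) k i,
  inl (k, i) \in J -> inr (k, i) \in J ->
  measurable_fun (setT : set (g_sigma_algebraType (cylinder F J))) (W k i).

Lemma observed_measurable (W : 'I_K -> nat -> T -> R) k i : observed W ->
  measurable_fun setT (W k i).
Proof.
move=> oW _ A mA.
have := oW (block [:: k] [:: i]) k i.
rewrite !mem_block !mem_seq1 !eqxx => /(_ isT isT) /(_ measurableT A mA).
have : <<s cylinder F (block [:: k] [:: i]) >> `<=` measurable.
  apply: smallest_sub; first exact: sigma_algebra_measurable.
  by apply: cylinder_measurable; exact: observations_measurable.
exact.
Qed.

Lemma observed_sum (W : 'I_K -> nat -> T -> R) (J : {fset index}) k n : observed W ->
  (forall i, (i < n)%N -> inl (k, i) \in J /\ inr (k, i) \in J) ->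
  measurable_fun (setT : set (g_sigma_algebraType (cylinder F J)))
    (fun x => \sum_(i < n) W k i x).
Proof.
move=> oW inJ; apply: measurable_sum => i.
by apply: oW; have [] := inJ i (ltn_ord i).
Qed.

(** The indices below i and the index i itself form disjoint blocks. *)
Lemma observed_independent (W : 'I_K -> nat -> T -> R) k i : observed W ->
  independent_RVs Q (fun x => \sum_(j < i) W k j x) (W k i).
Proof.
move=> oW; apply: (@observations_independent (block [:: k] (iota 0 i)) (block [:: k] [:: i])).
- apply/fdisjointP => a; rewrite !mem_block.
  by case: a => -[k' i'] /andP[_]; rewrite !mem_seq1 mem_iota add0n negb_and
    => /andP[_ /ltn_eqF ->]; rewrite orbT.
- apply: observed_sum => // j ji; rewrite !mem_block mem_seq1 eqxx mem_iota add0n ji.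
  by split.
- by apply: oW; rewrite mem_block !mem_seq1 !eqxx.
Qed.

Lemma observed_prod (W : 'I_K -> nat -> T -> R) n (g : 'I_K -> R -> R) M : observed W ->
  (forall k, measurable_fun setT (g k)) -> (forall k x, `|g k x| <= M) ->
  Ex Q (fun x => \prod_k g k (\sum_(i < n) W k i x)) =
  \prod_k Ex Q (fun x => g k (\sum_(i < n) W k i x)).
Proof.
move=> oW mg gM.
(* Duplicate-free lists allow the induction: the block of a new group is disjoint from those of the
   remaining ones. *)
suff : forall s : seq 'I_K, uniq s ->
    Ex Q (fun x => \prod_(k <- s) g k (\sum_(i < n) W k i x)) =
    \prod_(k <- s) Ex Q (fun x => g k (\sum_(i < n) W k i x)).
  by apply; exact: index_enum_uniq.
have mgJ (J : {fset index}) k : (forall i, (i < n)%N -> inl (k, i) \in J /\ inr (k, i) \in J) ->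
    measurable_fun (setT : set (g_sigma_algebraType (cylinder F J)))
      (fun x => g k (\sum_(i < n) W k i x)).
  by move=> inJ; apply: (measurableT_comp (mg k)); exact: observed_sum.
have mW k i : measurable_fun setT (W k i).
  exact: observed_measurable.
have mgW k : measurable_fun setT (fun x => g k (\sum_(i < n) W k i x)).
  by apply: (measurableT_comp (mg k)); exact: measurable_sum.
elim=> [|k s ih] /=.
  by rewrite big_nil; under eq_Ex do rewrite big_nil; rewrite Ex_cst.
move=> /andP[ks us]; rewrite big_cons -ih//.
under eq_Ex do rewrite big_cons.
apply: (proj2 (independent_RVs_mul _ _ _)).
- apply: (@observations_independent (block [:: k] (iota 0 n)) (block s (iota 0 n))).
  + apply/fdisjointP => a; rewrite !mem_block.
    case: a => -[k' i'] /andP[]; rewrite mem_seq1 => /eqP -> _; rewrite (negbTE ks)//.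
  + apply: mgJ => i ni; rewrite !mem_block mem_seq1 eqxx mem_iota add0n ni.
    by split.
  + apply: measurable_prod => l ls; apply: mgJ => i ni; rewrite !mem_block ls mem_iota add0n ni.
    by split.
- exact: (@bounded_summable _ _ _ _ _ M).
- apply: (@bounded_summable _ _ _ _ _ (\prod_(l <- s) M)).
    by apply: measurable_prod => l _.
  move=> x; rewrite normr_prod.
  by apply: ler_prod => l _; rewrite normr_ge0 gM.
Qed.

Variable mu : 'I_K -> R.
Variable m : 'M[R]_(K, d).
Hypothesis muE : forall k, Ex (LY k) (fun y => y) = mu k.
Hypothesis mE : forall k j, Ex (LX k) (fun x => x 0 j) = m k j.

Definition centered_Y k i x : R := Ys k i x - mu k.
Definition centered_X j k i x : R := Xs k i x 0 j - m k j.
(** Written in centered variables, it has mean zero by construction. The linear relation between the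
    means enters in [score_estimator], where it turns this into Y - beta_0 - sum_j beta_j X_j. *)
Definition residual k i x : R :=
  centered_Y k i x - \sum_j b j 0 * centered_X j k i x.

Lemma observed_centered_Y : observed centered_Y.
Proof. by move=> J k i J1 J2; apply: measurable_funB => //; exact: Ys_cylinder. Qed.

Lemma observed_centered_X j : observed (centered_X j).
Proof.
move=> J k i J1 J2; apply: measurable_funB => //.
exact: (measurableT_comp (measurable_coord 0 j) (Xs_cylinder J2)).
Qed.

Lemma observed_residual : observed residual.
Proof.
move=> J k i J1 J2; apply: measurable_funB; first exact: observed_centered_Y.
apply: measurable_sum => j; apply: measurable_funM => //; exact: observed_centered_X.
Qed.

Lemma centered_Y_moments k i : [/\ summable Q (fun x => centered_Y k i x ^+ 2),
  Ex Q (centered_Y k i) = 0 &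
  Ex Q (fun x => centered_Y k i x ^+ 2) = Ex (LY k) (fun y => (y - mu k) ^+ 2)].
Proof.
have mid : measurable_fun setT (fun y : R => y) by exact: measurable_id.
have mc : measurable_fun setT (fun y : R => (y - mu k) ^+ 2).
  by apply: measurable_funX; exact: measurable_funB.
have mY : measurable_fun setT (Ys k i) by exact: measurable_funPT.
have s1 : summable (LY k) (fun y => y) by exact: summable_sqr.
split.
- apply: (proj2 (law_summable mY (Ys_law k i) mc)).
  exact: summable_sqrB.
- rewrite /centered_Y ExB ?Ex_cst; [|exact: (proj2 (law_summable mY (Ys_law k i) mid))|exact: summable_cst].
  by rewrite (law_Ex mY (Ys_law k i) mid) muE subrr.
- exact: (law_Ex mY (Ys_law k i) mc).
Qed.

Lemma centered_X_moments j k i : [/\ summable Q (fun x => centered_X j k i x ^+ 2),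
  Ex Q (centered_X j k i) = 0 &
  forall l, Ex Q (fun x => centered_X j k i x * centered_X l k i x) =
    Ex (LX k) (fun x => (x 0 j - m k j) * (x 0 l - m k l))].
Proof.
have mj j' := @measurable_coord R 1 d 0 j'.
have mc j' : measurable_fun setT (fun x : 'rV[R]_d => x 0 j' - m k j').
  by apply: measurable_funB => //; exact: mj.
have mc2 : measurable_fun setT (fun x : 'rV[R]_d => (x 0 j - m k j) ^+ 2).
  exact: measurable_funX.
have mX : measurable_fun setT (Xs k i) by exact: measurable_funPT.
have s1 : summable (LX k) (fun x => x 0 j) by exact: summable_sqr.
split.
- apply: (proj2 (law_summable mX (Xs_law k i) mc2)).
  exact: summable_sqrB.
- rewrite /centered_X ExB ?Ex_cst; [|exact: (proj2 (law_summable mX (Xs_law k i) (mj j)))|exact: summable_cst].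
  by rewrite (law_Ex mX (Xs_law k i) (mj j)) mE subrr.
- move=> l; apply: (law_Ex mX (Xs_law k i) (f := fun x => (x 0 j - m k j) * (x 0 l - m k l))).
  exact: measurable_funM.
Qed.

(** No cross term between Y and X: the two samples of a group are independent, whatever the
    dependence of Y and X in the population. *)
Definition residual_var k : R := Ex (LY k) (fun y => (y - mu k) ^+ 2) +
  \sum_j \sum_l b j 0 * b l 0 * Ex (LX k) (fun x => (x 0 j - m k j) * (x 0 l - m k l)).

Lemma residual_moments k i : [/\ summable Q (fun x => residual k i x ^+ 2),
  Ex Q (residual k i) = 0 & Ex Q (fun x => residual k i x ^+ 2) = residual_var k].
Proof.
have [Y2 EY EY2] := centered_Y_moments k i.
have mY : measurable_fun setT (centered_Y k i) := observed_measurable k i observed_centered_Y.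
have mX j : measurable_fun setT (centered_X j k i) :=
  observed_measurable k i (@observed_centered_X j).
pose S x := \sum_j b j 0 * centered_X j k i x.
have mbX j : measurable_fun setT (fun x => b j 0 * centered_X j k i x).
  exact: measurable_funM.
have X2 j : summable Q (fun x => centered_X j k i x ^+ 2) by have [] := centered_X_moments j k i.
have mS : measurable_fun setT S by exact: measurable_sum.
have S2 : summable Q (fun x => S x ^+ 2).
  by apply: summable_sqr_sum => // j; exact: summable_sqrZ.
have sY : summable Q (centered_Y k i) by exact: summable_sqr.
have sS : summable Q S by exact: summable_sqr.
have sX j : summable Q (centered_X j k i) by exact: summable_sqr.
have ES : Ex Q S = 0.
  rewrite Ex_sum; last by move=> j; exact: summableZ.
  rewrite big1// => j _; rewrite ExZ//.
  by have [_ -> _] := centered_X_moments j k i; rewrite mulr0.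
have YS : independent_RVs Q (centered_Y k i) S.
  apply: (@observations_independent [fset inl (k, i)]%fset [fset inr (k, i)]%fset).
  - by apply/fdisjointP => a; rewrite !inE => /eqP ->.
  - by apply: measurable_funB => //; apply: Ys_cylinder; rewrite inE.
  - apply: measurable_sum => j; apply: measurable_funM => //; apply: measurable_funB => //.
    by apply: (measurableT_comp (measurable_coord 0 j)); apply: Xs_cylinder; rewrite inE.
have [sYS EYS] := independent_RVs_mul YS sY sS.
have E x : residual k i x ^+ 2 = centered_Y k i x ^+ 2 - 2 * (centered_Y k i x * S x) + S x ^+ 2.
  by rewrite /residual -/(S x); ring.
have s1 : summable Q (fun x => centered_Y k i x ^+ 2 - 2 * (centered_Y k i x * S x)).
  by apply: summableB => //; exact: summableZ.
split.
- by under eq_fun do rewrite E; exact: summableD.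
- by rewrite /residual ExB// EY ES subrr.
- under eq_Ex do rewrite E.
  rewrite ExD// ExB//; last exact: summableZ.
  rewrite ExZ// EYS EY mul0r mulr0 subr0 EY2; congr (_ + _).
  transitivity (Ex Q (fun x => \sum_j \sum_l b j 0 * b l 0 * (centered_X j k i x * centered_X l k i x))).
    apply: eq_Ex => x; rewrite expr2 {1}/S mulr_suml; apply: eq_bigr => j _.
    by rewrite /S mulr_sumr; apply: eq_bigr => l _; ring.
  have sXX j l : summable Q (fun x => b j 0 * b l 0 * (centered_X j k i x * centered_X l k i x)).
    by apply: summableZ; exact: summableM.
  rewrite Ex_sum => [|j]; last exact: summable_sum.
  apply: eq_bigr => j _; rewrite Ex_sum//; apply: eq_bigr => l _.
  rewrite ExZ; last exact: summableM.
  by have [_ _ ->] := centered_X_moments j k i.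
Qed.

(** For every index the pair of observations has the product law of [LY k] and [LX k], and the
    residual is a fixed function of the pair. *)
Lemma residual_law k i (h : R -> R) : measurable_fun setT h ->
  Ex Q (fun x => h (residual k i x)) = Ex Q (fun x => h (residual k 0%N x)).
Proof.
move=> mh.
pose r (p : R * 'rV[R]_d) := h (p.1 - mu k - \sum_j b j 0 * (p.2 0 j - m k j)).
have mr : measurable_fun setT r.
  apply: measurableT_comp => //; apply: measurable_funB; first exact: measurable_funB.
  apply: measurable_sum => j; apply: measurable_funM => //; apply: measurable_funB => //.
  exact: measurableT_comp (measurable_coord 0 j) measurable_snd.
have key i' : Ex Q (fun x => h (residual k i' x)) = Ex (LY k \x LX k)%E r.
  have mp : measurable_fun setT (fun x => (Ys k i' x, Xs k i' x)).
    exact: measurable_fun_pair.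
  have law A : measurable A -> Q ((fun x => (Ys k i' x, Xs k i' x)) @^-1` A) = (LY k \x LX k)%E A.
    move=> mA.
    pose XY : {RV Q >-> (R * 'rV[R]_d)%type} :=
      HB.pack (fun x => (Ys k i' x, Xs k i' x)) (isMeasurableFun.Build _ _ _ _ _ mp).
    apply/esym; apply: (@product_measure_unique _ _ _ _ _ (LY k) (LX k) (distribution Q XY)) => //.
    move=> A1 B1 mA1 mB1.
    have ind : independent_RVs Q (Ys k i') (Xs k i').
      apply: (@observations_independent [fset inl (k, i')]%fset [fset inr (k, i')]%fset).
      - by apply/fdisjointP => a; rewrite !inE => /eqP ->.
      - by apply: Ys_cylinder; rewrite inE.
      - by apply: Xs_cylinder; rewrite inE.
    transitivity (Q (Ys k i' @^-1` A1 `&` Xs k i' @^-1` B1)); first by [].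
    by rewrite ind// Ys_law// Xs_law.
  exact: (law_Ex mp law mr).
by rewrite !key.
Qed.

(** Junk value: [score 0] is 0, because both the sum and [0^-1] vanish. *)
Definition score n x : 'cV[R]_K :=
  \col_k ((\sum_(i < n) residual k i x) / Num.sqrt n%:R).

Lemma residual_var_ge0 k : 0 <= residual_var k.
Proof.
have [_ _ <-] := residual_moments k 0.
by apply: Ex_ge0 => x; exact: sqr_ge0.
Qed.

Lemma measurable_score n : measurable_fun setT (score n).
Proof.
apply: measurable_mx => k j; under eq_fun do rewrite mxE.
apply: measurable_funM => //; apply: measurable_sum => i.
exact: (observed_measurable k i observed_residual).
Qed.

(** An inequality because of the junk value at n = 0; for n > 0 the second moment equals
    [residual_var k]. *)
Lemma score_sqr n k : summable Q (fun x => score n x k 0 ^+ 2) /\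
  Ex Q (fun x => score n x k 0 ^+ 2) <= residual_var k.
Proof.
have mres i := observed_measurable k i observed_residual.
have res1 i : summable Q (fun x => residual k i x ^+ 2) by have [] := residual_moments k i.
have res2 i : Ex Q (residual k i) = 0 by have [] := residual_moments k i.
have res3 i : Ex Q (fun x => residual k i x ^+ 2) = residual_var k.
  by have [] := residual_moments k i.
have ind i := observed_independent k i observed_residual.
have [s1 E1] := sum_sqr n mres ind res1 res2 res3.
have E x : score n x k 0 ^+ 2 = n%:R^-1 * (\sum_(j < n) residual k j x) ^+ 2.
  by rewrite mxE expr_div_n sqr_sqrtr ?ler0n// mulrC.
split; first by under eq_fun do rewrite E; exact: summableZ.
under eq_Ex do rewrite E.
rewrite ExZ// E1 mulrA; have [->|n0] := posnP n.
  by rewrite invr0 mul0r mul0r residual_var_ge0.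
by rewrite mulVf ?mul1r// pnatr_eq0 -lt0n.
Qed.

Lemma score_cvg (nu : probability 'cV[R]_K R) (f : 'cV[R]_K -> R) :
  std_gaussian nu -> continuous f -> (exists M, forall x, `|f x| <= M) ->
  (fun n => Ex Q (fun x => f (score n x))) @ \oo -->
  Ex nu (fun u => f (\col_k (Num.sqrt (residual_var k) * u k 0))).
Proof.
have mres k i := observed_measurable k i observed_residual.
have res k i := residual_moments k i.
have res1 k i : summable Q (fun x => residual k i x ^+ 2) by have [] := res k i.
have res2 k i : Ex Q (residual k i) = 0 by have [] := res k i.
have res3 k i : Ex Q (fun x => residual k i x ^+ 2) = residual_var k by have [] := res k i.
have ind k i := observed_independent k i observed_residual.
move=> snu cf bf; apply: cvg_vector => //.
- exact: residual_var_ge0.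
- exact: measurable_score.
- move=> n g M mg gM.
  have mg' k : measurable_fun setT (fun t : R => g k (t / Num.sqrt n%:R)).
    by apply: (measurableT_comp (mg k)); exact: measurable_funM.
  have := observed_prod n (M := M) observed_residual mg' (fun k x => gM k _).
  by under eq_Ex do under eq_bigr do [];
  move=> H; under eq_Ex do (under eq_bigr do rewrite mxE);
  rewrite H; apply: eq_bigr => k _; apply: eq_Ex => x; rewrite mxE.
- move=> k g [C [g1 [g2 tg]]].
  have := clt_taylor2 tg (residual_var_ge0 k) (mres k) (ind k) (res1 k) (res2 k) (res3 k).
  move=> /(_ _)H.
  under eq_fun do under eq_Ex do rewrite mxE.
  apply: H => i r.
  by rewrite (residual_law k i (h := fun t => cut (t * r)))//; apply: measurableT_comp (@measurable_cut R) _; exact: measurable_funM.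
- by move=> n k; have [] := score_sqr n k.
- by move=> n k; have [] := score_sqr n k.
Qed.

(** A weak law of large numbers by Chebyshev's inequality, uniform over groups and coordinates. *)
Lemma sample_meanX_dev e r : 0 < e -> 0 < r -> \forall n \near \oo, exists S : set T,
  [/\ measurable S, fine (Q S) <= e &
    forall x, ~ S x -> forall k j, `|sample_meanX Xs n x k j - m k j| <= r].
Proof.
move=> e0 r0.
(* The entries of the matrix of means are listed as one vector, to which [outside_box] applies. *)
pose N := #|{: 'I_K * 'I_d}|.
pose idx (a : 'I_N) : 'I_K * 'I_d := enum_val a.
pose W n x : 'cV[R]_N := \col_a (n%:R^-1 * \sum_(i < n) centered_X (idx a).2 (idx a).1 i x).
pose vX (a : 'I_N) := Ex (LX (idx a).1) (fun x => (x 0 (idx a).2 - m (idx a).1 (idx a).2) ^+ 2).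
have mX k j i : measurable_fun setT (centered_X j k i) :=
  observed_measurable k i (@observed_centered_X j).
have mW n : measurable_fun setT (W n).
  apply: measurable_mx => a c; under eq_fun do rewrite mxE.
  by apply: measurable_funM => //; exact: measurable_sum.
have W2 n a : summable Q (fun x => W n x a 0 ^+ 2) /\
    Ex Q (fun x => W n x a 0 ^+ 2) = n%:R^-1 ^+ 2 * (n%:R * vX a).
  have [s1 E1] : summable Q (fun x => (\sum_(i < n) centered_X (idx a).2 (idx a).1 i x) ^+ 2) /\
    Ex Q (fun x => (\sum_(i < n) centered_X (idx a).2 (idx a).1 i x) ^+ 2) = n%:R * vX a.
    apply: sum_sqr.
    - by move=> i; exact: mX.
    - by move=> i; exact: (observed_independent _ _ (@observed_centered_X _)).
    - by move=> i; have [] := centered_X_moments (idx a).2 (idx a).1 i.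
    - by move=> i; have [] := centered_X_moments (idx a).2 (idx a).1 i.
    - move=> i; have [_ _ H] := centered_X_moments (idx a).2 (idx a).1 i.
      by under eq_Ex do rewrite expr2; rewrite H; apply: eq_Ex => x; rewrite expr2.
  have E x : W n x a 0 ^+ 2 = n%:R^-1 ^+ 2 * (\sum_(i < n) centered_X (idx a).2 (idx a).1 i x) ^+ 2.
    by rewrite mxE exprMn.
  split; first by under eq_fun do rewrite E; exact: summableZ.
  by under eq_Ex do rewrite E; rewrite ExZ// E1.
have cv : (fun n => (\sum_a vX a) / r ^+ 2 * (n%:R : R)^-1) @ \oo --> (0 : R).
  rewrite -[X in _ --> X](mulr0 ((\sum_a vX a) / r ^+ 2)); apply: cvgM; first exact: cvg_cst.
  by apply/gtr0_cvgV0; [near=> n; rewrite ltr0n; near: n; exists 1%N|exact: cvgr_idn].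
move/cvgrPdist_le : cv => /(_ _ e0) cv.
near=> n.
have n0 : (0 < n)%N by near: n; exists 1%N.
have nn0 : n%:R != 0 :> R by rewrite pnatr_eq0 -lt0n.
have W2le a : Ex Q (fun x => W n x a 0 ^+ 2) <= n%:R^-1 ^+ 2 * (n%:R * vX a).
  by rewrite (proj2 (W2 n a)).
have [mS QS] := outside_box r0 (mW n) (fun a => proj1 (W2 n a)) W2le.
exists [set x | exists a, r < `|W n x a 0|]; split=> //.
- apply: (le_trans QS).
  have h : `|0 - (\sum_a vX a) / r ^+ 2 * n%:R^-1| <= e by near: n; exact: cv.
  rewrite sub0r normrN in h; apply: le_trans h.
  apply: le_trans (ler_norm _).
  rewrite le_eqVlt; apply/orP; left; apply/eqP.
  rewrite -mulr_sumr -mulr_sumr; field; rewrite nn0/=; exact: lt0r_neq0.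
- move=> x Sx k j; rewrite leNgt; apply/negP => h; apply: Sx.
  exists (enum_rank (k, j)).
  rewrite mxE /idx enum_rankK/=.
  suff -> : n%:R^-1 * (\sum_(i < n) centered_X j k i x) = sample_meanX Xs n x k j - m k j by [].
  rewrite /centered_X sumrB sumr_const card_ord -[m k j *+ n]mulr_natl mulrBr mulKf// !mxE; congr (_ * _ - _).
  by rewrite summxE.
Unshelve. all: by end_near. Qed.

(** The identity [mu = design m *m beta] makes the intercept reappear in the centered residuals,
    whose group averages form the last factor of [moment_map_sub]. The scaling sqrt n / n = 1 / sqrt
    n requires n > 0. *)
Lemma score_estimator (w : 'rV[R]_K) (beta : 'cV[R]_(1 + d)) n x :
  b = dsubmx beta -> (forall k, mu k = (design m *m beta) k 0) -> (0 < n)%N ->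
  gram w (sample_meanX Xs n x) \in unitmx ->
  Num.sqrt n%:R *: (moment_map w (sample_meanX Xs n x) (sample_meanY Ys n x) - beta) =
  moment_mx w (sample_meanX Xs n x) *m score n x.
Proof.
move=> bE muE' n0 gu; rewrite (moment_map_sub _ beta)// addrC addKr scalemxAr.
congr (_ *m _); apply/matrixP => k j; rewrite ord1 {j}.
have s0 : 0 < Num.sqrt (n%:R : R) by rewrite sqrtr_gt0 ltr0n.
have nn0 : n%:R != 0 :> R by rewrite pnatr_eq0 -lt0n.
have desE (A : 'M[R]_(K, d)) k' : (design A *m beta) k' 0 =
    usubmx beta 0 0 + \sum_j A k' j * b j 0.
  rewrite -{1}[beta]vsubmxK /design mul_row_col mxE; congr (_ + _).
    by rewrite mxE big_ord1 mxE mul1r.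
  by rewrite mxE bE.
have sE : Num.sqrt (n%:R : R) ^+ 2 = n%:R by rewrite sqr_sqrtr// ler0n.
rewrite mxE [X in _ * X]mxE [X in _ + X]mxE [X in _ * (X - _)]mxE desE [RHS]mxE.
have resE i : residual k i x = Ys k i x - usubmx beta 0 0 - \sum_j Xs k i x 0 j * b j 0.
  rewrite /residual /centered_Y muE' desE /centered_X.
  have -> : \sum_j b j 0 * (Xs k i x 0 j - m k j) =
      \sum_j Xs k i x 0 j * b j 0 - \sum_j m k j * b j 0.
    by rewrite -sumrB; apply: eq_bigr => j _; ring.
  by ring.
have -> : \sum_(i < n) residual k i x = \sum_(i < n) Ys k i x - n%:R * usubmx beta 0 0
    - \sum_j (\sum_(i < n) Xs k i x 0 j) * b j 0.
  under eq_bigr do rewrite resE.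
  rewrite !sumrB sumr_const card_ord -[usubmx beta 0 0 *+ n]mulr_natl; congr (_ - _).
  by rewrite exchange_big/=; apply: eq_bigr => j _; rewrite mulr_suml.
have -> : \sum_j sample_meanX Xs n x k j * b j 0 =
    n%:R^-1 * \sum_j (\sum_(i < n) Xs k i x 0 j) * b j 0.
  by rewrite mulr_sumr; apply: eq_bigr => j _; rewrite !mxE summxE mulrA.
move: s0 nn0 sE; set s := Num.sqrt _ => /lt0r_neq0 sn0; move: (n%:R) => N nn0 sE; rewrite -sE.
by field.
Qed.

(** Slutsky's theorem compares the scaled error with [H0] applied to the score, where the random
    matrix is replaced by its limit; [score_cvg] gives the limit of the latter. *)
Lemma estimator_cvg (w : 'rV[R]_K) (beta : 'cV[R]_(1 + d)) (betaM : nat -> T -> 'cV[R]_(1 + d))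
    (nu : probability 'cV[R]_K R) (f : 'cV[R]_(1 + d) -> R) :
  b = dsubmx beta -> (forall k, mu k = (design m *m beta) k 0) ->
  gram w m \in unitmx ->
  (forall n, measurable_fun setT (betaM n)) ->
  (forall n x, gram w (sample_meanX Xs n x) \in unitmx ->
    betaM n x = moment_map w (sample_meanX Xs n x) (sample_meanY Ys n x)) ->
  std_gaussian nu -> continuous f -> (exists M, forall x, `|f x| <= M) ->
  (fun n => Ex Q (fun x => f (Num.sqrt n%:R *: (betaM n x - beta)))) @ \oo -->
  Ex nu (fun u => f (moment_mx w m *m \col_k (Num.sqrt (residual_var k) * u k 0))).
Proof.
move=> bE muE' gu mbetaM betaME snu cf [Fb fF].
pose H0 := moment_mx w m.
have cH : continuous (fun z : 'cV[R]_K => H0 *m z) := @continuous_mulmxl _ _ _ H0.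
apply: (@slutsky _ _ _ Q _ (fun n x => H0 *m score n x) _ f Fb) => //; last first.
- apply: (score_cvg (f := fun z => f (H0 *m z)) snu); last by exists Fb => x; exact: fF.
  by move=> z; apply: continuous_comp; [exact: cH|exact: cf].
- move=> e e0; pose V := \sum_k residual_var k.
  have V0 : 0 <= V by apply: sumr_ge0 => k _; exact: residual_var_ge0.
  have e2 : 0 < e / 2 by rewrite divr_gt0.
  (* As L >= 1, V / L^2 <= V / L <= e / 2: the score leaves the box of size L with probability at
     most e / 2. *)
  pose L := 1 + V / (e / 2).
  have L1 : 1 <= L by rewrite lerDl divr_ge0// ltW.
  have L0 : 0 < L by apply: lt_le_trans L1.
  have VL : V / L ^+ 2 <= e / 2.
    rewrite ler_pdivrMr ?exprn_gt0// -ler_pdivrMl// mulrC.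
    apply: (@le_trans _ _ L); first by rewrite /L lerDr.
    by rewrite expr2 ler_peMr// ltW.
  exists (\sum_i \sum_k `|H0 i k| * L) => r r0.
  have KL : 0 < K%:R * L + 1 by rewrite ltr_wpDl// mulr_ge0// ltW.
  (* A row sum of K products, each of a matrix error at most eta and a score at most L, is then at
     most r. *)
  pose eta := r / (K%:R * L + 1).
  have eta0 : 0 < eta by rewrite divr_gt0.
  have [near_unit near_H] := @cvg_moment_mx R K d w _ (nbhs m) _ id m
    (fun i j => @coord_continuous _ _ _ i j m) gu.
  have near_eta i k : \forall m' \near nbhs m, `|H0 i k - moment_mx w m' i k| <= eta.
    by have /cvgrPdist_le/(_ _ eta0) := near_H i k.
  have both : nbhs m [set m' | gram w m' \in unitmx /\
      forall i k, `|H0 i k - moment_mx w m' i k| <= eta].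
    exact: (filterI near_unit (filter_forall _ (fun i => filter_forall _ (near_eta i)))).
  move/nbhs_ballP : both => [del /= del0 hdel].
  (* Half the radius, because balls are open while the deviation bound is not strict. *)
  have del2 : 0 < del / 2 by rewrite divr_gt0.
  near=> n.
  have n0 : (0 < n)%N by near: n; exists 1%N.
  have [S2 [mS2 QS2 S2P]] : exists S : set T, [/\ measurable S, fine (Q S) <= e / 2 &
      forall x, ~ S x -> forall k j, `|sample_meanX Xs n x k j - m k j| <= del / 2].
    by near: n; exact: sample_meanX_dev.
  have [mS1 QS1] := outside_box L0 (measurable_score n)
    (fun k => proj1 (score_sqr n k)) (fun k => proj2 (score_sqr n k)).
  exists ([set x | exists k, L < `|score n x k 0|] `|` S2); split.
  + exact: measurableU.
  + have fQ A : measurable A -> Q A \is a fin_num by exact: fin_num_measure.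
    set S1 := [set x | exists k, L < `|score n x k 0|] in mS1 QS1 *.
    have h : (Q (S1 `|` S2) <= Q S1 + Q S2)%E by exact: measureU2.
    have mU := measurableU _ _ mS1 mS2.
    apply: (le_trans (fine_le (fQ _ mU) _ h)); first by rewrite fin_numD !fQ.
    by rewrite fineD ?fQ// [leRHS](splitr e) lerD// (le_trans QS1).
  + move=> x nS.
    have sL k : `|score n x k 0| <= L.
      by rewrite leNgt; apply/negP => h; apply: nS; left; exists k.
    have near_m : ball m del (sample_meanX Xs n x).
      split => // i j; rewrite /ball/= distrC.
      apply: (@le_lt_trans _ _ (del / 2)); last by rewrite ltr_pdivrMr// ltr_pMr// ltr1n.
      by apply: S2P => ?; apply: nS; right.
    (* The Gram matrix is invertible here, so the arbitrary values of the estimator are confined to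
       the exceptional set. *)
    have [gn Hn] := hdel _ near_m.
    split => i.
    * rewrite mxE (le_trans (ler_norm_sum _ _ _))//.
      rewrite [leRHS](bigD1 i)//= ler_wpDr//.
        by apply: sumr_ge0 => i' _; apply: sumr_ge0 => k _; rewrite mulr_ge0// ltW.
      by apply: ler_sum => k _; rewrite normrM ler_wpM2l.
    * rewrite betaME// score_estimator// -[_ i 0 - _ i 0]/((_ *m _) i 0 - _).
      rewrite 2!mxE -sumrB (le_trans (ler_norm_sum _ _ _))//.
      apply: (@le_trans _ _ (\sum_(k < K) eta * L)).
        apply: ler_sum => k _; rewrite -mulrBl normrM ler_pM//; exact: Hn.
      rewrite sumr_const card_ord -mulr_natl /eta.
      rewrite mulrCA -mulrA ger_pMr// mulrC ler_pdivrMr ?mul1r// lerDl//.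
- move=> n; apply: measurable_mx => i j; under eq_fun do rewrite !mxE.
  apply: measurable_funM => //; apply: measurable_funB => //.
  exact: measurableT_comp (measurable_coord i j) (mbetaM n).
- move=> n; apply: (measurableT_comp _ (measurable_score n)).
  exact: measurable_continuous_mxmx.
Unshelve. all: by end_near. Qed.

End samples.

Lemma fine_covariance d (T : measurableType d) (R : realType) (P : probability T R)
    (f g : T -> R) :
  fine (covariance P f g) = Ex P (fun x => (f x - Ex P f) * (g x - Ex P g)).
Proof. by rewrite unlock !fine_expectation. Qed.

Lemma ge0_summable d (T : measurableType d) (R : realType) (P : probability T R)
    (f : T -> R) :
  measurable_fun setT f -> (forall x, 0 <= f x) -> ('E_P[f] < +oo)%E -> summable P f.
Proof.
move=> mf f0; rewrite unlock => fi.
apply/integrableP; split; first exact/measurable_EFinP.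
by under eq_integral do rewrite gee0_abs ?lee_fin//.
Qed.

(** * Moments within a group *)

Section group_moments.
Context dP (Omega : measurableType dP) (R : realType) (P : probability Omega R).
Context (d K : nat) (Y eps : {RV P >-> R}) (X : {RV P >-> 'rV[R]_d}) (G : {RV P >-> nat}).
Variable k : 'I_K.
Hypothesis Gk : (0 < P (G @^-1` [set (k : nat)]))%E.
Variable beta : 'cV[R]_(1 + d).
Hypothesis model : {ae P, forall o, Y o =
  beta (lshift d 0) 0 + \sum_(j < d) beta (rshift 1 j) 0 * X o ord0 j + eps o}.
Hypothesis eps_indep : independent_RVs P eps (fun o => (X o, G o)).
Hypothesis eps_mean : ('E_P[eps] = 0)%E.
Hypothesis X2 : forall j, summable P (fun o => X o ord0 j ^+ 2).
Local Notation Pk := (cond_prob G k).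

Lemma measurable_RV_coord j : measurable_fun setT (fun o => X o ord0 j).
Proof. exact: measurableT_comp (measurable_coord ord0 j) (measurable_funPT X). Qed.

(** A finite integral forces integrability, as an undefined difference of infinities evaluates to
    -oo. *)
Lemma noise_summable : summable P eps.
Proof.
have me : measurable_fun setT eps by exact: measurable_funPT.
apply/integrableP; split; first exact/measurable_EFinP.
rewrite integral_fin_num_abs//.
have <- : 'E_P[eps]%E = (\int[P]_x (eps x)%:E)%E by rewrite unlock.
by rewrite eps_mean.
Qed.

(** By independence, conditioning on the group leaves the law of the noise unchanged. *)
Lemma cond_mean_noise : Ex Pk eps = 0.
Proof.
have me : measurable_fun setT eps by exact: measurable_funPT.
have ind : independent_RVs P eps G.
  exact: (independent_RVs_comp (@measurable_id _ _ setT) measurable_snd eps_indep).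
have mid : measurable_fun setT (fun x : R => x) by exact: measurable_id.
have law A : measurable A -> Pk (eps @^-1` A) = distribution P eps A.
  by move=> mA; rewrite (cond_prob_law Gk ind mA).
rewrite (law_Ex me law mid) Ex_distribution//.
by rewrite -(@fine_expectation _ _ _ P eps) eps_mean.
Qed.

(** [cond_prob] is absolutely continuous with respect to [P], so the almost sure model can be
    averaged within the group, where the noise has mean zero. *)
Lemma meanY_model : meanY K Y G k 0 = (design (meanX K X G) *m beta) k 0.
Proof.
have sX j : summable Pk (fun o => X o ord0 j).
  by apply: cond_prob_summable => //; apply: summable_sqr => //; exact: measurable_RV_coord.
have se : summable Pk eps by apply: cond_prob_summable => //; exact: noise_summable.
have sbX j : summable Pk (fun o => beta (rshift 1 j) 0 * X o ord0 j) by exact: summableZ.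
have sS : summable Pk (fun o => \sum_(j < d) beta (rshift 1 j) 0 * X o ord0 j).
  exact: summable_sum.
have sbS : summable Pk (fun o => beta (lshift d 0) 0 +
    \sum_(j < d) beta (rshift 1 j) 0 * X o ord0 j).
  by apply: summableD => //; exact: summable_cst.
have EY : Ex Pk Y = Ex Pk (fun o => beta (lshift d 0) 0 +
    \sum_(j < d) beta (rshift 1 j) 0 * X o ord0 j + eps o).
  congr fine; apply: ae_eq_integral => //.
  - by apply/measurable_EFinP; exact: measurable_funPT.
  - by have /integrableP[] := summableD sbS se.
  - by apply: (filterS _ (cond_prob_ae Gk model)) => o /= -> _.
rewrite mxE fine_expectation EY ExD// cond_mean_noise addr0 ExD//; last exact: summable_cst.
rewrite Ex_cst Ex_sum//.
rewrite -[beta in RHS]vsubmxK /design mul_row_col mxE; congr (_ + _).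
  by rewrite mxE big_ord1 !mxE mul1r.
rewrite mxE; apply: eq_bigr => j _; rewrite ExZ// !mxE mulrC; congr (_ * _).
by rewrite fine_expectation.
Qed.

Hypothesis Y2 : summable P (fun o => Y o ^+ 2).

Lemma residual_var_group (LY : 'I_K -> probability R R) (LX : 'I_K -> probability 'rV[R]_d R)
    (b : 'cV[R]_d) :
  LY k = distribution Pk Y -> LX k = distribution Pk X ->
  residual_var LY LX b (fun k => meanY K Y G k 0) (meanX K X G) k =
  varY Y G k + (b^T *m covX X G k *m b) 0 0.
Proof.
move=> LYk LXk; rewrite /residual_var LYk LXk; congr (_ + _).
  rewrite /varY /variance fine_covariance Ex_distribution; last first.
    by apply: measurable_funX; exact: measurable_funB.
  by apply: eq_Ex => o; rewrite /= !mxE fine_expectation expr2.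
rewrite [(_ *m b) 0 0]mxE exchange_big; apply: eq_bigr => l _.
rewrite [(b^T *m _) 0 l]mxE mulr_suml; apply: eq_bigr => j _.
rewrite [b^T 0 j]mxE [covX _ _ _ _ _]mxE fine_covariance mulrAC; congr (_ * _ * _).
have mj j' := @measurable_coord R 1 d 0 j'.
rewrite Ex_distribution; last by apply: measurable_funM; exact: measurable_funB.
by apply: eq_Ex => o; rewrite /= !mxE !fine_expectation.
Qed.

End group_moments.

Theorem proposition4p1 (R : realType) (d K : nat)
  (dP : measure_display) (Omega : measurableType dP) (P : probability Omega R)
  (Y eps : {RV P >-> R}) (X : {RV P >-> 'rV[R]_d}) (G : {RV P >-> nat})
  (G_lt : forall o, (G o < K)%N)
  (G_pos : forall k : 'I_K, (0 < P (G @^-1` [set (k : nat)]))%E)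
  (beta : 'cV[R]_(1 + d)) (sigma_eps : R)
  (model : {ae P, forall o, Y o =
    beta (lshift d 0) 0 + \sum_(j < d) beta (rshift 1 j) 0 * X o ord0 j + eps o})
  (eps_indep : independent_RVs P eps (fun o => (X o, G o)))
  (eps_mean : ('E_P[eps] = 0)%E)
  (eps_var : ('V_P[eps] = (sigma_eps ^+ 2)%:E)%E)
  (Y_L2 : ('E_P[fun o => (Y o ^+ 2)%R] < +oo)%E)
  (X_L2 : ('E_P[fun o => (\sum_(j < d) X o ord0 j ^+ 2)%R] < +oo)%E)
  (full_rank : \rank (design (meanX K X G)) = d.+1)
  (dQ : measure_display) (T : measurableType dQ) (Q : probability T R)
  (Ys : 'I_K -> nat -> {RV Q >-> R}) (Xs : 'I_K -> nat -> {RV Q >-> 'rV[R]_d})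
  (Ys_law : forall k i B, measurable B ->
    distribution Q (Ys k i) B = distribution (cond_prob G k) Y B)
  (Xs_law : forall k i B, measurable B ->
    distribution Q (Xs k i) B = distribution (cond_prob G k) X B)
  (data_indep : mutually_independent Q (observations Ys Xs))
  (w : 'rV[R]_K) (w_pos : forall k, 0 < w 0 k) (w_sum : \sum_k w 0 k = 1)
  (betaM : nat -> {RV Q >-> 'cV[R]_(1 + d)})
  (betaME : forall n s, \rank (design (sample_meanX Xs n s)) = d.+1 ->
    betaM n s = moment_map w (sample_meanX Xs n s) (sample_meanY Ys n s)) :
  exists2 mu : probability 'cV[R]_(1 + d) R,
    is_normal mu 0 (Gamma_beta Y X G w) &
    cvg_in_distribution Q
      (fun n s => Num.sqrt n%:R *: (betaM n s - beta)) mu.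
Proof.
have mY : measurable_fun setT Y by exact: measurable_funPT.
have sY2 : summable P (fun o => Y o ^+ 2).
  by apply: ge0_summable Y_L2 => [|x]; [exact: measurable_funX|exact: sqr_ge0].
have mX j := measurable_RV_coord X j.
have sX2 j : summable P (fun o => X o ord0 j ^+ 2).
  have s : summable P (fun o => \sum_(j < d) X o ord0 j ^+ 2).
    apply: ge0_summable X_L2 => [|x]; last by apply: sumr_ge0 => i _; exact: sqr_ge0.
    by apply: measurable_sum => i; exact: measurable_funX.
  apply: le_summable s; first exact: measurable_funX.
  move=> x; rewrite ger0_norm ?sqr_ge0// (bigD1 j)//= lerDl.
  by apply: sumr_ge0 => i _; exact: sqr_ge0.
(* The data live on another probability space; the laws [LY] and [LX] tie them to the population. *)
pose LY (k : 'I_K) : probability R R := distribution (cond_prob G k) Y.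
pose LX (k : 'I_K) : probability 'rV[R]_d R := distribution (cond_prob G k) X.
pose m0 := meanX K X G; pose b := dsubmx beta.
pose v k := residual_var LY LX b (fun k => meanY K Y G k 0) m0 k.
have LY2 k : summable (LY k) (fun y => y ^+ 2).
  have mf : measurable_fun setT (fun y : R => y ^+ 2) by exact: measurable_funX.
  apply/(law_summable (X := Y) mY _ mf) => //.
  exact: cond_prob_summable.
have LX2 k j : summable (LX k) (fun x => x 0 j ^+ 2).
  have mf : measurable_fun setT (fun x : 'rV[R]_d => x 0 j ^+ 2).
    by apply: measurable_funX; exact: measurable_coord.
  apply/(law_summable (X := X) (measurable_funPT X) _ mf) => //.
  exact: cond_prob_summable.
have muE k : Ex (LY k) (fun y => y) = meanY K Y G k 0.
  by rewrite mxE fine_expectation Ex_distribution.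
have mE k j : Ex (LX k) (fun x => x 0 j) = m0 k j.
  by rewrite mxE fine_expectation Ex_distribution; last exact: measurable_coord.
have gu : gram w m0 \in unitmx by exact: gram_unit.
have modelE k : meanY K Y G k 0 = (design m0 *m beta) k 0 by apply: (meanY_model (G_pos k) model eps_indep eps_mean sX2).
have v0 k : 0 <= v k.
  exact: (residual_var_ge0 Ys_law Xs_law data_indep LY2 LX2 b muE mE).
have vE k : v k = varY Y G k + (b^T *m covX X G k *m b) 0 0 by exact: residual_var_group.
(* Matches [Gamma_beta] with the covariance of the limit as a quadratic form, the shape that
   [gaussian_image] asks for. *)
have quad (a : 'cV[R]_(1 + d)) : (a^T *m Gamma_beta Y X G w *m a) 0 0 =
    \sum_k ((moment_mx w m0)^T *m a) k 0 ^+ 2 * v k.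
  have yE : meanY K Y G = design m0 *m beta by apply/matrixP => k j; rewrite ord1.
  have JE := mul_tr_jacobian_at gu yE a.
  set J := jacobian_at w (stack m0 (meanY K Y G)) in JE.
  have -> : a^T *m Gamma_beta Y X G w *m a = (J^T *m a)^T *m Gamma_mu K Y X G *m (J^T *m a).
    by rewrite /Gamma_beta -/m0 -/J trmx_mul trmxK !mulmxA.
  rewrite JE trmxK block_quadratic_form.
  by apply: eq_bigr => k _; rewrite vE.
have [mu0 smu0] := std_gaussian_exists R K.
have [nu [normal_nu nuE]] := gaussian_image smu0 v0 quad.
exists nu => // f cf [M fM].
have mf := measurable_continuous_mx cf.
have mbeta n : measurable_fun setT (fun s => Num.sqrt n%:R *: (betaM n s - beta)).
  apply: measurable_mx => i j; under eq_fun do rewrite !mxE.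
  apply: measurable_funM => //; apply: measurable_funB => //.
  exact: measurableT_comp (measurable_coord i j) (measurable_funPT (betaM n)).
rewrite (expectation_Ex (bounded_summable nu mf fM)).
under eq_fun do rewrite (expectation_Ex (bounded_summable Q (measurableT_comp mf (mbeta _)) (fun x => fM _))).
apply: cvg_EFin; first exact: nearW.
rewrite nuE//.
apply: (estimator_cvg Ys_law Xs_law data_indep LY2 LX2 muE mE) => //.
- by move=> n x gn; apply: betaME; exact: gram_unit_rank gn.
- by exists M.
Qed.
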